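(* Let $d\geq1$ be an integer, and let $\gamma>0$ if $d=1$ and $\gamma\geq0$ if $d\geq2$. Then there exists a constant $S_{\gamma,d}$ such that for any real-valued $v\in L_{2\gamma+d}(\mathbb{R}^d)$ and all $\mathbf{A}\in L_{2,\mathrm{loc}}(\mathbb{R}^{d+1},\mathbb{R}^{d+1})$ one has $$\operatorname{tr}\left[H(\mathbf{A},v)\right]_-^\gamma\leq S_{\gamma,d}\int_{\mathbb{R}^d}v(x)_-^{2\gamma+d}\,dx.$$
   Context: Points of $\mathbb{R}^{d+1}$ are written $(x,y)$ with $x\in\mathbb{R}^d$, $y\in\mathbb{R}$, and $\mathbf{D}=-i\nabla$. The operator $H(\mathbf{A},v)$ is the self-adjoint operator in $L_2(\mathbb{R}^{d+1})$ defined through the closure of the quadratic form $$\iint_{\mathbb{R}^{d+1}}|(\mathbf{D}-\mathbf{A})u|^2\,dx\,dy+\int_{\mathbb{R}^d}v(x)|u(x,0)|^2\,dx,\qquad u\in C_0^\infty(\mathbb{R}^{d+1}).$$ Here $v_-=\max\{-v,0\}$. For a self-adjoint operator $T$ and $\gamma>0$, $\operatorname{tr}T_-^\gamma$ is the sum of $|\lambda_j|^\gamma$ over the negative eigenvalues $\lambda_j$ of $T$, counting multiplicities (i.e. the trace of $\max\{-T,0\}^\gamma$); for $\gamma=0$ it is the number of negative eigenvalues (the dimension of the spectral subspace of $T$ for $(-\infty,0)$). *)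

(* Defs.v *)
From HB Require Import structures.
From mathcomp Require Import all_boot all_order all_algebra.
From mathcomp Require Import all_classical all_reals all_analysis.
From mathcomp Require Import complex.

Set Implicit Arguments.
Unset Strict Implicit.
Unset Printing Implicit Defensive.

Import Order.TTheory GRing.Theory Num.Theory.
Import numFieldNormedType.Exports.

Local Open Scope classical_set_scope.
Local Open Scope ring_scope.

(* The product sigma-algebra on row vectors, generated by the coordinates, as
   for [n.-tuple T] in the library; on ['rV[R]_n] it is the Borel one. *)
Definition measure_rV_display : measure_display -> measure_display.
Proof. exact. Qed.

Section measurable_rV.
Context {d} {T : measurableType d}.
Variable n : nat.

Let coords : 'I_n -> 'rV[T]_n -> T := fun i x => x ord0 i.

Let rV_set0 : g_sigma_preimage coords set0.
Proof. exact: sigma_algebra0. Qed.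

Let rV_setC A : g_sigma_preimage coords A -> g_sigma_preimage coords (~` A).
Proof. exact: sigma_algebraC. Qed.

Let rV_bigcup (F : _^nat) : (forall i, g_sigma_preimage coords (F i)) ->
  g_sigma_preimage coords (\bigcup_i (F i)).
Proof. exact: sigma_algebra_bigcup. Qed.

HB.instance Definition _ := @isMeasurable.Build (measure_rV_display d)
  'rV[T]_n (g_sigma_preimage coords) rV_set0 rV_setC rV_bigcup.

End measurable_rV.

Lemma measurable_fun_rV d1 d2 (T1 : measurableType d1) (T2 : measurableType d2)
    n (f : T1 -> 'rV[T2]_n) :
  (forall i, measurable_fun [set: T1] (fun x => f x ord0 i)) ->
  measurable_fun [set: T1] f.
Proof.
move=> mf _ A mA; rewrite setTI; move: A mA.
apply: smallest_sub.
  split => /=.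
  - by rewrite preimage_set0.
  - by move=> A mA; rewrite setTD preimage_setC; exact: measurableC.
  - by move=> F mF; rewrite preimage_bigcup; exact: bigcup_measurable.
rewrite -bigcup_seq; apply: bigcup_sub => i _ A [B mB <-] /=.
by rewrite setTI; have := mf i measurableT _ mB; rewrite setTI.
Qed.

Lemma measurable_coord d (T : measurableType d) n (i : 'I_n) :
  measurable_fun [set: 'rV[T]_n] (fun x : 'rV[T]_n => x ord0 i).
Proof.
move=> _ Y mY; rewrite setTI; apply: sub_sigma_algebra => /=.
rewrite -bigcup_seq/=; exists i => /=; first by rewrite mem_index_enum.
by exists Y => //; rewrite setTI.
Qed.

Section lebesgue_rV.
Context {R : realType}.

Definition cons_rV n (p : R * 'rV[R]_n) : 'rV[R]_n.+1 :=
  row_mx (const_mx p.1 : 'rV_1) p.2.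

Lemma cons_rVl n p (j : 'I_1) : @cons_rV n p ord0 (lshift n j) = p.1.
Proof. by apply: etrans (row_mxEl _ _ _ _) _; rewrite mxE. Qed.

Lemma cons_rVr n p (j : 'I_n) : @cons_rV n p ord0 (rshift 1 j) = p.2 ord0 j.
Proof. exact: row_mxEr. Qed.

Lemma measurable_cons_rV n :
  measurable_fun [set: measurableTypeR R * 'rV[R]_n] (@cons_rV n).
Proof.
apply: measurable_fun_rV => i; case: (@split_ordP 1 n i) => j ->.
- by under eq_fun do rewrite cons_rVl; exact: measurable_fst.
- under eq_fun do rewrite cons_rVr.
  exact: (measurableT_comp (measurable_coord j)).
Qed.

Section cons_measure.
Local Open Scope ereal_scope.
Variables (n : nat) (m : {sigma_finite_measure set 'rV[R]_n -> \bar R}).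

Definition cons_measure (A : set 'rV[R]_n.+1) : \bar R :=
  (lebesgue_measure \x m) (@cons_rV n @^-1` A).

Let mcons := @measurable_cons_rV n.

Let cons_measure0 : cons_measure set0 = 0.
Proof. by rewrite /cons_measure preimage_set0 measure0. Qed.

Let cons_measure_ge0 A : 0 <= cons_measure A.
Proof. exact: measure_ge0. Qed.

Let cons_measure_sigma_additive : semi_sigma_additive cons_measure.
Proof.
move=> F mF tF mUF; rewrite /cons_measure preimage_bigcup.
apply: measure_semi_sigma_additive.
- by move=> k; rewrite -[X in measurable X]setTI; exact: mcons.
- apply/trivIsetP => /= i j _ _ ij; rewrite -preimage_setI.
  by move/trivIsetP : tF => /(_ _ _ _ _ ij) ->//; rewrite preimage_set0.
- by rewrite -preimage_bigcup -[X in measurable X]setTI; exact: mcons.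
Qed.

HB.instance Definition _ := isMeasure.Build _ _ _
  cons_measure cons_measure0 cons_measure_ge0 cons_measure_sigma_additive.

Let cons_measure_sigma_finite : sigma_finite setT cons_measure.
Proof.
have /sigma_finiteP[F [TF ndF Foo]] :=
  sigma_finiteT (@lebesgue_measure R).
have /sigma_finiteP[G [TG ndG Goo]] := sigma_finiteT m.
pose hd (x : 'rV[R]_n.+1) : R := x ord0 ord0.
pose tl (x : 'rV[R]_n.+1) : 'rV[R]_n := @rsubmx R 1 1 n x.
have mhd : measurable_fun [set: 'rV[R]_n.+1] hd by exact: measurable_coord.
have mtl : measurable_fun [set: 'rV[R]_n.+1] tl.
  apply: measurable_fun_rV => i; rewrite /tl.
  under eq_fun do rewrite mxE.
  exact: measurable_coord.
have hdK p : hd (cons_rV p) = p.1.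
  rewrite -[RHS](cons_rVl p ord0); congr (_ _ _); exact: val_inj.
have tlK p : tl (cons_rV p) = p.2 by rewrite /tl /cons_rV row_mxKr.
exists (fun k => hd @^-1` F k `&` tl @^-1` G k).
  rewrite predeqE => x; split => // _.
  have [i _ Fi] : (\bigcup_i F i) (hd x) by rewrite -TF.
  have [j _ Gj] : (\bigcup_i G i) (tl x) by rewrite -TG.
  exists (maxn i j) => //; split.
  - by have /subsetPset := ndF _ _ (leq_maxl i j); exact.
  - by have /subsetPset := ndG _ _ (leq_maxr i j); exact.
move=> k; have [mFk Fk] := Foo k; have [mGk Gk] := Goo k; split.
  apply: measurableI.
  - by rewrite -[X in measurable X]setTI; exact: mhd.
  - by rewrite -[X in measurable X]setTI; exact: mtl.
rewrite /cons_measure (_ : _ @^-1` _ = F k `*` G k); last first.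
  by rewrite predeqE => p; rewrite /= hdK tlK.
by rewrite product_measure1E// lte_mul_pinfty// ge0_fin_numE.
Qed.

HB.instance Definition _ := Measure_isSigmaFinite.Build _ _ _
  cons_measure cons_measure_sigma_finite.

End cons_measure.

(* Lebesgue measure on R^n, as the n-fold product of the one on R. *)
Fixpoint lebesgue_rV n : {sigma_finite_measure set 'rV[R]_n -> \bar R} :=
  match n with
  | 0 => dirac (0 : 'rV[R]_0)
  | n'.+1 => cons_measure (lebesgue_rV n')
  end.

End lebesgue_rV.

Local Open Scope complex_scope.
Import ComplexField.Normc.

(* not those of numClosedFieldType *)
Local Notation Re := (@complex.Re _).
Local Notation Im := (@complex.Im _).

(* Elements of the complex L2 space are functions, considered up to almost
   everywhere equality. *)
Section L2.
Context d (T : measurableType d) (R : realType).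
Variable mu : {measure set T -> \bar R}.
Implicit Types (u w f : T -> R[i]) (phi psi e : nat -> T -> R[i]).

Definition L2C : set (T -> R[i]) :=
  [set u : T -> R[i] |
    (Re \o u) \in Lfun mu 2%:E /\ (Im \o u) \in Lfun mu 2%:E].

(* antilinear in the second argument *)
Definition dotL2 u w : R[i] :=
  (\int[mu]_x Re (u x * (w x)^*%C)) +i* (\int[mu]_x Im (u x * (w x)^*%C)).

Definition sqdistL2 u w : R :=
  Re (dotL2 (fun x => u x - w x) (fun x => u x - w x)).

Definition orthonormalL2 (I : eqType) (e : I -> T -> R[i]) :=
  (forall j, L2C (e j)) /\ (forall j k, dotL2 (e j) (e k) = (j == k)%:R).

Definition hilbert_basis e :=
  orthonormalL2 e /\
  forall u, L2C u -> (forall j, dotL2 u (e j) = 0) -> u = cst 0 %[ae mu].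

Section form.
(* D is the domain of the quadratic form h. *)
Variables (D : set (T -> R[i])) (h : (T -> R[i]) -> R).

(* the sesquilinear form whose diagonal is h, by polarization *)
Definition polar u w : R[i] :=
  4%:R^-1 * \sum_(k < 4) 'i%C ^+ k * (h (fun x => u x + 'i%C ^+ k * w x))%:C.

Definition form_converges phi u :=
  [/\ forall n, D (phi n), L2C u,
      (fun n => sqdistL2 (phi n) u) @ \oo --> (0 : R)
    & forall eps : R, 0 < eps ->
        exists N, forall n m, (N <= n)%N -> (N <= m)%N ->
        `|h (fun x => phi n x - phi m x)| < eps].

Definition closure_dom u := exists phi, form_converges phi u.

(* z is the value at (u, w) of (the sesquilinear form of) the closure of h;
   for a closable h it depends on u and w only *)
Definition closure_val u w (z : R[i]) := exists phi psi,
  [/\ form_converges phi u, form_converges psi w,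
      (fun n => Re (polar (phi n) (psi n))) @ \oo --> Re z
    & (fun n => Im (polar (phi n) (psi n))) @ \oo --> Im z].

(* The graph of the operator of the closure of h: u is in the operator domain
   and is mapped to f (first representation theorem). *)
Definition form_operator u f :=
  [/\ closure_dom u, L2C f
    & forall w, closure_dom w -> closure_val u w (dotL2 f w)].

End form.

Section spectral.
Variable H : (T -> R[i]) -> (T -> R[i]) -> Prop.
Variable E : set R -> (T -> R[i]) -> (T -> R[i]).
Variable nu : (T -> R[i]) -> {measure set (measurableTypeR R) -> \bar R}.

(* E is a projection-valued measure, and nu u the measure B |-> (E B u, u).
   Symmetry makes each E B linear up to almost everywhere equality. *)
Definition projection_valued_measure :=
  [/\ forall B u, measurable (B : set (measurableTypeR R)) -> L2C u ->
        L2C (E B u),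
      forall B u w, measurable (B : set (measurableTypeR R)) ->
        L2C u -> L2C w -> dotL2 (E B u) w = dotL2 u (E B w),
      forall u, L2C u -> E setT u = u %[ae mu],
      forall B C u, measurable (B : set (measurableTypeR R)) ->
        measurable (C : set (measurableTypeR R)) -> L2C u ->
        E (B `&` C) u = E B (E C u) %[ae mu]
    & forall B u, measurable (B : set (measurableTypeR R)) -> L2C u ->
        nu u B = (Re (dotL2 (E B u) u))%:E].

(* H (given by its graph) is the self-adjoint operator with spectral
   measure E. *)
Definition spectral_resolution :=
  [/\ projection_valued_measure,
      forall u f, H u f -> L2C u /\ L2C f,
      forall u, L2C u ->
        ((exists f, H u f) <-> (\int[nu u]_l (l ^+ 2)%:E < +oo)%E)
    & forall u f, H u f -> dotL2 f u = (\int[nu u]_l l)%:C].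

(* dimension of the range of E ]-oo, 0[ *)
Definition dim_negative : \bar R :=
  ereal_sup [set n%:R%:E | n in [set n : nat | exists f : 'I_n -> T -> R[i],
    orthonormalL2 f /\ forall j, E `]-oo, 0%R[ (f j) = f j %[ae mu]]].

(* In the basis e the trace of max(-H, 0)^gamma is the sum of the diagonal
   entries, which the functional calculus gives as integrals against nu. *)
Definition trace_negative (e : nat -> T -> R[i]) (gamma : R) : \bar R :=
  (\sum_(0 <= j <oo) \int[nu (e j)]_l (Num.max (- l) 0 `^ gamma)%:E)%E.

End spectral.

(* t = tr H_-^gamma, where for gamma = 0 this is the dimension of the spectral
   subspace for ]-oo, 0[; it does not depend on E, nu, e. *)
Definition is_tr_neg H (gamma : R) (t : \bar R) := exists E nu,
  spectral_resolution H E nu /\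
  if gamma == 0 then t = dim_negative E
  else exists e, hilbert_basis e /\ t = trace_negative nu e gamma.

End L2.

Section magnetic.
Context {R : realType}.

Definition partial n (i : 'I_n) (g : 'rV[R]_n -> R) : 'rV[R]_n -> R :=
  fun x => 'D_(delta_mx ord0 i) g x.

(* all iterated partial derivatives exist and are continuous *)
Definition smooth n (g : 'rV[R]_n -> R) := forall s : seq 'I_n,
  let gs := foldr (@partial n) g s in
  continuous gs /\ forall (i : 'I_n) x, derivable gs x (delta_mx ord0 i).

Definition test_function n : set ('rV[R]_n -> R[i]) :=
  [set u : 'rV[R]_n -> R[i] | [/\ smooth (Re \o u), smooth (Im \o u)
             & compact (closure [set x | u x != 0])]].

(* k-th component of -i grad u *)
Definition momentum n (u : 'rV[R]_n -> R[i]) (k : 'I_n) (x : 'rV[R]_n) : R[i] :=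
  - 'i%C * (partial k (Re \o u) x +i* partial k (Im \o u) x).

Definition L2loc n m (A : 'rV[R]_n -> 'rV[R]_m) :=
  measurable_fun [set: 'rV[R]_n] A /\
  forall (K : set 'rV[R]_n) (k : 'I_m), compact K ->
    (\int[lebesgue_rV n]_(x in K) (A x ord0 k ^+ 2)%:E < +oo)%E.

Definition magnetic_form d (A : 'rV[R]_(d + 1) -> 'rV[R]_(d + 1))
    (v : 'rV[R]_d -> R) (u : 'rV[R]_(d + 1) -> R[i]) : R :=
  \int[lebesgue_rV (d + 1)]_z
     (\sum_(k < d + 1) normc (momentum u k z - (A z ord0 k)%:C * u z) ^+ 2) +
  \int[lebesgue_rV d]_x (v x * normc (u (row_mx x (0 : 'rV_1))) ^+ 2).

Definition magnetic_operator d (A : 'rV[R]_(d + 1) -> 'rV[R]_(d + 1))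
    (v : 'rV[R]_d -> R) :=
  form_operator (lebesgue_rV (d + 1)) (@test_function (d + 1))
    (magnetic_form A v).

End magnetic.

(* Main.v *)
(* The space R^(d+1) is replaced by a fine cubic lattice, on which -Laplace
   becomes 1 - P for a walk that moves in all coordinates at once. By the
   diamagnetic principle the magnetic kernel P is dominated entrywise by the
   transition probabilities, so that the spectral projections of 1 - P below
   lambda have diagonal at most a constant times lambda^((d+1)/2), uniformly in
   A. Rumin's method turns this into a bound on the number N of linearly
   independent functions on which the form is at most -E, the restriction to
   the hyperplane y = 0 being controlled by a one-dimensional trace inequality:
     N <= C E^(-s/2) int (v_- - sqrt E / 2)_+^(d+s),
   first on the lattice and then, letting the mesh tend to 0, for test functions.

   The spectral subspace of H for ]-oo, -E[ is approximated in the form norm by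
   test functions, which bounds its dimension by the right-hand side. For
   gamma > 0 the trace is then summed over dyadic values of E with s = gamma. *)
From HB Require Import structures.
From mathcomp Require Import all_boot all_order all_algebra.
From mathcomp Require Import all_classical all_reals all_analysis.
From mathcomp Require Import measurable_realfun complex ring lra zify.
Require Import Defs.

Set Implicit Arguments.
Unset Strict Implicit.
Unset Printing Implicit Defensive.

Import Order.TTheory GRing.Theory Num.Theory.
Import numFieldNormedType.Exports.
Import ComplexField.Normc.

Local Open Scope classical_set_scope.
Local Open Scope ring_scope.

(** * Complex numbers as pairs of reals *)

(** On a finite lattice the spectral theorem is the one for Hermitian matrices and the diamagnetic
    principle is the triangle inequality for sums over paths, so neither resolvents nor heat kernels
    of magnetic operators enter.

    At the level 1 - P ~ 4^-m the density is 2^(-m(d+1)); dividing by the energy and spending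
    E^(-s/2) leaves 2^(-m beta) with beta = d - 1 + s. The series over levels needs beta > 0, which
    admits s = 0 for d >= 2 and forces s > 0 for d = 1.

    Half of the form is spent on sqrt E / 2 times the trace on the hyperplane. Lowering v_- by this
    amount makes the sum over E finite: at a point x only the E below 4 v_-(x)^2 contribute, and
    their powers E^(gamma/2) add up to a multiple of v_-(x)^gamma.

    Neither semiboundedness nor closability of the form is given. As soon as the bound on N for some
    E is below 1, no test function has form below -E times its squared norm. Closability is read off
    from the operator: the spectral measure fixes (H u, u), while for a form that is not closable
    the graph over u would contain all of L2. *)

(* [R[i]] seen through a single structure, so that all operations on it are
   inferred along the same inheritance path *)
Definition cplx (R : realType) : numClosedFieldType := R[i]%C.

Section complex_basics.
Context {R : realType}.
Implicit Types (z w : cplx R).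

Definition re z : R := complex.Re z.
Definition im z : R := complex.Im z.
Definition rc (x : R) : cplx R := x%:C%C.
Definition cmod z : R := normc z.
Definition csq z : R := re z ^+ 2 + im z ^+ 2.

Lemma cplx_eq z w : re z = re w -> im z = im w -> z = w.
Proof. by case: z w => a b [c d]; rewrite /re /im /= => -> ->. Qed.

Lemma reD z w : re (z + w) = re z + re w. Proof. by case: z w => ? ? []. Qed.
Lemma imD z w : im (z + w) = im z + im w. Proof. by case: z w => ? ? []. Qed.
Lemma reN z : re (- z) = - re z. Proof. by case: z. Qed.
Lemma imN z : im (- z) = - im z. Proof. by case: z. Qed.
Lemma reM z w : re (z * w) = re z * re w - im z * im w.
Proof. by case: z w => ? ? []. Qed.
Lemma imM z w : im (z * w) = re z * im w + im z * re w.
Proof. by case: z w => ? ? []. Qed.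
Lemma re_conj z : re z^* = re z. Proof. by case: z. Qed.
Lemma im_conj z : im z^* = - im z. Proof. by case: z. Qed.
Lemma conjM z w : (z * w)^* = z^* * w^*. Proof. exact: rmorphM. Qed.
Lemma conjD z w : (z + w)^* = z^* + w^*. Proof. exact: rmorphD. Qed.
Lemma conjN z : (- z)^* = - z^*. Proof. exact: rmorphN. Qed.
Lemma re0 : re 0 = 0. Proof. by []. Qed.
Lemma im0 : im 0 = 0. Proof. by []. Qed.
Lemma re1 : re 1 = 1. Proof. by []. Qed.
Lemma im1 : im 1 = 0. Proof. by []. Qed.
Lemma re_rc (x : R) : re (rc x) = x. Proof. by []. Qed.
Lemma im_rc (x : R) : im (rc x) = 0. Proof. by []. Qed.

Definition reimE := (reD, imD, reN, imN, reM, imM, re_conj, im_conj,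
  re0, im0, re1, im1, re_rc, im_rc).

Lemma rcD (x y : R) : rc (x + y) = rc x + rc y.
Proof. by apply: cplx_eq; rewrite !reimE ?addr0. Qed.
Lemma rcM (x y : R) : rc (x * y) = rc x * rc y.
Proof. by apply: cplx_eq; rewrite !reimE ?mulr0 ?mul0r ?subr0 ?addr0. Qed.
Lemma rcN (x : R) : rc (- x) = - rc x.
Proof. by apply: cplx_eq; rewrite !reimE ?oppr0. Qed.
Lemma rc0 : rc 0 = 0. Proof. by []. Qed.
Lemma rc1 : rc 1 = 1. Proof. by []. Qed.
Lemma rc_inj : injective rc. Proof. by move=> x y []. Qed.
Lemma rc_conj (x : R) : (rc x)^* = rc x.
Proof. by apply: cplx_eq; rewrite !reimE ?oppr0. Qed.

Lemma rc_sum I (r : seq I) (P : pred I) (F : I -> R) :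
  rc (\sum_(i <- r | P i) F i) = \sum_(i <- r | P i) rc (F i).
Proof. exact: (big_morph rc rcD rc0). Qed.

Lemma conj_sum I (r : seq I) (P : pred I) (F : I -> cplx R) :
  (\sum_(i <- r | P i) F i)^* = \sum_(i <- r | P i) (F i)^*.
Proof. exact: rmorph_sum. Qed.

Lemma re_sum I (r : seq I) (P : pred I) (F : I -> cplx R) :
  re (\sum_(i <- r | P i) F i) = \sum_(i <- r | P i) re (F i).
Proof. exact: (big_morph re reD re0). Qed.

Lemma im_sum I (r : seq I) (P : pred I) (F : I -> cplx R) :
  im (\sum_(i <- r | P i) F i) = \sum_(i <- r | P i) im (F i).
Proof. exact: (big_morph im imD im0). Qed.

Lemma re_rcM (x : R) z : re (rc x * z) = x * re z.
Proof. by rewrite !reimE mul0r subr0. Qed.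

Lemma im_rcM (x : R) z : im (rc x * z) = x * im z.
Proof. by rewrite !reimE mul0r addr0. Qed.

Lemma csq_ge0 z : 0 <= csq z.
Proof. by rewrite addr_ge0 ?sqr_ge0. Qed.

Lemma csq0 : csq 0 = 0.
Proof. by rewrite /csq re0 im0 expr0n/= addr0. Qed.

Lemma cmod_sq z : cmod z ^+ 2 = csq z.
Proof. by case: z => a b; rewrite /csq /= sqr_sqrtr ?addr_ge0 ?sqr_ge0. Qed.

Lemma cmod_ge0 z : 0 <= cmod z.
Proof. by case: z => a b /=; exact: sqrtr_ge0. Qed.

Lemma cmodM z w : cmod (z * w) = cmod z * cmod w.
Proof. exact: normcM. Qed.

Lemma cmod_conj z : cmod z^* = cmod z.
Proof. by case: z => a b; rewrite /cmod /= sqrrN. Qed.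

Lemma cmod_rc (x : R) : cmod (rc x) = `|x|.
Proof. by rewrite /cmod/= expr0n/= addr0 sqrtr_sqr. Qed.

Lemma cmod0 : cmod 0 = 0. Proof. exact: normc0. Qed.
Lemma cmod1 : cmod 1 = 1. Proof. exact: normc1. Qed.

Lemma cmodD z w : cmod (z + w) <= cmod z + cmod w.
Proof.
have : (`|z + w| <= `|z| + `|w|)%R by exact: ler_normD.
rewrite -[`|z + w|]/(rc (cmod (z + w))) -[`|z|]/(rc (cmod z)).
by rewrite -[`|w|]/(rc (cmod w)) -rcD lecE => /andP[].
Qed.

Lemma cmod_sum I (r : seq I) (P : pred I) (F : I -> cplx R) :
  cmod (\sum_(i <- r | P i) F i) <= \sum_(i <- r | P i) cmod (F i).
Proof.
apply: (big_rec2 (fun z x => cmod z <= x)); first by rewrite cmod0.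
by move=> i x z _ H; apply: (le_trans (cmodD _ _)); rewrite lerD2l.
Qed.

Lemma re_le_cmod z : `|re z| <= cmod z.
Proof.
case: z => a b; rewrite /re /cmod /=.
by rewrite -sqrtr_sqr ler_wsqrtr // lerDl sqr_ge0.
Qed.

Lemma csqM z w : csq (z * w) = csq z * csq w.
Proof. by rewrite -!cmod_sq cmodM exprMn. Qed.

Lemma mul_conj z : z * z^* = rc (csq z).
Proof. by apply: cplx_eq; rewrite !reimE /csq; ring. Qed.

Lemma csq_conj z : csq z^* = csq z.
Proof. by rewrite /csq !reimE sqrrN. Qed.

Lemma csqN z : csq (- z) = csq z.
Proof. by rewrite /csq !reimE !sqrrN. Qed.

Lemma csq_rc (x : R) : csq (rc x) = x ^+ 2.
Proof. by rewrite /csq !reimE expr0n/= addr0. Qed.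

Lemma csqD z w : csq (z + w) = csq z + csq w + 2 * re (z * w^*).
Proof. by rewrite /csq !reimE; ring. Qed.

Lemma csqB z w : csq (z - w) = csq z + csq w - 2 * re (z * w^*).
Proof. by rewrite /csq !reimE; ring. Qed.

Lemma csqD_le z w : csq (z + w) <= 2 * csq z + 2 * csq w.
Proof.
rewrite /csq !reimE.
have := sqr_ge0 (re z - re w); have := sqr_ge0 (im z - im w); nra.
Qed.

Lemma csq_eq0 z : csq z = 0 -> z = 0.
Proof. by rewrite -cmod_sq => /eqP; rewrite sqrf_eq0 => /eqP/eq0_normc. Qed.

End complex_basics.

(** * The spectral theorem for Hermitian kernels on a finite set *)

Section spectral.
Local Open Scope sesquilinear_scope.
Context {R : realType}.
Local Notation C := (cplx R).

(** The spectral theorem for matrices, transported along [enum_val]. In this form it serves both the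
    walk on the lattice and the Gram matrix of a family of functions. The completeness relation is
    recorded as well: on the diagonal it says that the densities of all eigenfunctions add up to 1
    at every point. *)
Lemma hermitian_kernel_spectral (X : finType) (K : X -> X -> C) :
  (forall x y, K y x = (K x y)^*) ->
  exists (psi : X -> X -> C) (p : X -> R),
  [/\ forall i j, \sum_x psi i x * (psi j x)^* = (i == j)%:R,
      forall x y, \sum_i psi i x * (psi i y)^* = (x == y)%:R &
      forall x y, K x y = \sum_i rc (p i) * (psi i x * (psi i y)^*)].
Proof.
move=> Kherm.
pose A : 'M[C]_#|X| := \matrix_(i, j) K (enum_val i) (enum_val j).
have Ah : A \is hermsymmx.
  apply/is_hermitianmxP; rewrite expr0 scale1r.
  by apply/matrixP => i j; rewrite !mxE Kherm.
have /orthomx_spectralP AE := hermitian_normalmx Ah.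
have Ar := hermitian_spectral_diag_real Ah.
set U := spectralmx A in AE; set sp := spectral_diag A in AE Ar.
have Uu : U \is unitarymx by exact: spectral_unitarymx.
rewrite (invmx_unitary Uu) in AE.
have UU : U *m U ^t* = 1%:M by exact/unitarymxP.
have UU' : U ^t* *m U = 1%:M.
  by rewrite -(invmx_unitary Uu) mulVmx ?unitarymx_unit.
have spE i : rc (re (sp 0 i)) = sp 0 i.
  have /mxOverP /(_ 0 i) := Ar; rewrite realE !lecE /=.
  by case: (sp 0 i) => a b /= /orP[] /andP[/eqP bE _]; [rewrite bE | rewrite -bE].
(* [AE] has the form A = U^* D U, so the eigenfunctions are the conjugated rows of [U]. *)
exists (fun i x => (U (enum_rank i) (enum_rank x))^*).
exists (fun i => re (sp 0 (enum_rank i))).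
have reindexX (F : 'I_#|X| -> C) : \sum_i F i = \sum_x F (enum_rank x).
  rewrite (reindex (@enum_rank X)) //=.
  by exists enum_val => z _; rewrite ?enum_valK ?enum_rankK.
split.
- move=> i j.
  have /matrixP /(_ (enum_rank j) (enum_rank i)) := UU.
  rewrite !mxE (inj_eq enum_rank_inj) eq_sym => <-.
  by rewrite reindexX; apply: eq_bigr => k _; rewrite !mxE conjCK mulrC.
- move=> x y; have /matrixP /(_ (enum_rank x) (enum_rank y)) := UU'.
  rewrite !mxE (inj_eq enum_rank_inj) => <-; rewrite reindexX.
  by apply: eq_bigr => k _; rewrite !mxE conjCK.
- move=> x y; have /matrixP /(_ (enum_rank x) (enum_rank y)) := AE.
  rewrite !mxE !enum_rankK => ->; rewrite reindexX; apply: eq_bigr => k _.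
  rewrite mul_mx_diag !mxE conjCK spE mulrA; congr (_ * _).
  by rewrite mulrC.
Qed.

End spectral.

(** * The lattice walk and the lattice inequality *)

Section walks.
Context {R : realType}.

(* probability that the simple random walk on the integers is at j at time m *)
Fixpoint walk (m : nat) (j : int) : R :=
  if m is m'.+1 then 2^-1 * (walk m' (j - 1) + walk m' (j + 1))
  else (j == 0)%:R.

Lemma walk_ge0 m j : 0 <= walk m j.
Proof.
elim: m j => [|m IH] j /=; first exact: ler0n.
by rewrite mulr_ge0 ?invr_ge0 ?addr_ge0.
Qed.

Lemma walk_out m (j : int) : j < - m%:Z -> walk m j = 0.
Proof.
elim: m j => [|m IH] j jm /=; first by case: eqP => // j0; exfalso; lia.
by rewrite !IH ?addr0 ?mulr0//; lia.
Qed.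

Lemma walkE m i : walk m (2 * i%:Z - m%:Z) = 'C(m, i)%:R / 2 ^+ m.
Proof.
elim: m i => [|m IH] i /=.
  by rewrite expr0 divr1; case: i => [|i] /=; rewrite ?bin0n; case: eqP => //; lia.
have -> : 2 * i%:Z - m.+1%:Z + 1 = 2 * i%:Z - m%:Z by lia.
rewrite IH exprS; case: i => [|i].
  rewrite walk_out ?add0r ?bin0; last by lia.
  by rewrite mul1r invfM mul1r.
have -> : 2 * i.+1%:Z - m.+1%:Z - 1 = 2 * i%:Z - m%:Z by lia.
by rewrite IH binS natrD addrC -mulrDl invfM mulrCA mulrA.
Qed.

(** Induction on k: with x = 2k + 1 the ratio of consecutive terms is x / (x + 1), and the step
    reduces to x (x + 2) <= (x + 1)^2. This takes the place of Stirling's formula. *)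
Lemma central_binomial_bound k :
  ('C(k.*2, k)%:R / 2 ^+ k.*2) ^+ 2 * (k.*2.+1)%:R <= 1 :> R.
Proof.
elim: k => [|k IH]; first by rewrite bin0 expr0 divr1 expr1n mul1r.
set c := (X in X ^+ 2 * _) in IH.
have cS : 'C(k.+1.*2, k.+1)%:R / 2 ^+ k.+1.*2 =
    c * (k.*2.+1)%:R / (k.*2.+2)%:R :> R.
  have H1 : ('C(k.+1.*2, k.+1) * k.+1 = (k.*2.+1 * 'C(k.*2, k)).*2)%N.
    have e1 := mul_bin_diag k.*2.+2 k.
    have e2 := mul_bin_diag k.*2.+1 k.
    have e3 : ('C(k.*2.+1, k.+1) = 'C(k.*2.+1, k))%N.
      by rewrite -[in RHS]bin_sub; [congr 'C(_, _)|]; lia.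
    rewrite /= in e1 e2; rewrite e3 in e2.
    by rewrite doubleS mulnC -e1 e2; lia.
  rewrite doubleS in H1 *; rewrite 2!exprS.
  have {}H1 : 'C(k.*2.+2, k.+1)%:R * k.+1%:R =
      2 * ((k.*2.+1)%:R * 'C(k.*2, k)%:R) :> R by rewrite -!natrM H1 mul2n.
  have k1 : k.+1%:R != 0 :> R by rewrite pnatr_eq0.
  have -> : (k.*2.+2)%:R = 2 * k.+1%:R :> R by rewrite -natrM; congr _%:R; lia.
  have p0 : 2 ^+ k.*2 != 0 :> R by rewrite expf_neq0.
  rewrite /c; apply: (mulIf k1).
  transitivity ('C(k.*2.+2, k.+1)%:R * k.+1%:R / (2 * (2 * 2 ^+ k.*2)) : R).
    by field; rewrite ?p0.
  by rewrite H1; field; rewrite nat1r k1 p0.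
rewrite cS.
have -> : (k.+1.*2.+1)%:R = (k.*2.+1)%:R + 2 :> R by rewrite -natrD; congr _%:R; lia.
have -> : (k.*2.+2)%:R = (k.*2.+1)%:R + 1 :> R by rewrite natr1.
set x := (k.*2.+1)%:R in IH *.
have x0 : 0 < x by rewrite ltr0n.
apply: le_trans IH.
have -> : (c * x / (x + 1)) ^+ 2 * (x + 2) =
   c ^+ 2 * x * (x * (x + 2) / (x + 1) ^+ 2).
  by field; rewrite lt0r_neq0//; lra.
rewrite ler_piMr ?mulr_ge0 ?sqr_ge0 ?(ltW x0)//.
have x1 : 0 < x + 1 by lra.
rewrite ler_pdivrMr ?exprn_gt0// mul1r.
nra.
Qed.

(** The time 2 * 4^m is the one at which the walk has spread over a distance of order 2^m. It is
    even, so that the powers of negative eigenvalues in [density_bound] are nonnegative. *)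
Lemma walk_return m : walk (4 ^ m).*2 0 <= 2^-1 ^+ m.
Proof.
have e : 2 * (4 ^ m)%N%:Z - (4 ^ m).*2%:Z = 0%R by lia.
rewrite -[X in walk _ X]e walkE; have := central_binomial_bound (4 ^ m).
set c := _ / _ => cb.
have c0 : 0 <= c by rewrite divr_ge0 ?exprn_ge0.
rewrite -(@ler_pXn2r _ 2) ?nnegrE ?exprn_ge0 ?invr_ge0//.
have <- : (4 ^ m)%N%:R^-1 = (2^-1 ^+ m) ^+ 2 :> R.
  by rewrite -exprM mulnC exprM exprVn -natrX natrX exprVn natrX.
rewrite -[leRHS]mul1r ler_pdivlMr ?ltr0n ?expn_gt0//.
apply: le_trans cb; rewrite ler_wpM2l ?sqr_ge0// ler_nat.
lia.
Qed.

End walks.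

Section hopping.
Context {R : realType}.
Local Notation C := (cplx R).

Definition step (i j : nat) : R :=
  if (i == j.+1) || (j == i.+1) then 2^-1 else 0.

Lemma step_ge0 i j : 0 <= step i j.
Proof. by rewrite /step; case: ifP => // _; rewrite invr_ge0. Qed.

Lemma stepC i j : step i j = step j i.
Proof. by rewrite /step orbC. Qed.

Lemma sum_ord_pick M (t : int) (phi : int -> R) : (forall j, 0 <= phi j) ->
  \sum_(j < M) (j%:Z == t)%:R * phi j%:Z <= phi t.
Proof.
move=> phi0; have [[j jt]|nt] := pselect (exists j : 'I_M, j%:Z = t).
  rewrite (bigD1 j)//= jt eqxx mul1r big1 ?addr0// => k kj.
  case: eqP => [kt|_]; rewrite ?mul0r//; exfalso; move/eqP: kj; apply.
  by apply/val_inj => /=; lia.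
rewrite big1 ?phi0// => j _; case: eqP => [jt|_]; rewrite ?mul0r//.
by exfalso; apply: nt; exists j.
Qed.

(** Neighbours outside ['I_M] are missing from the sum: the walk is killed at the boundary of the
    box, which can only lower the left-hand side for a nonnegative [phi]. *)
Lemma step_sum M (i : nat) (phi : int -> R) : (forall j, 0 <= phi j) ->
  \sum_(j < M) step i j * phi j%:Z <= 2^-1 * (phi (i%:Z - 1) + phi (i%:Z + 1)).
Proof.
move=> phi0.
apply: (@le_trans _ _ (2^-1 * (\sum_(j < M) (j%:Z == i%:Z - 1)%:R * phi j%:Z
    + \sum_(j < M) (j%:Z == i%:Z + 1)%:R * phi j%:Z))); last first.
  by rewrite ler_wpM2l ?invr_ge0// lerD// sum_ord_pick.
rewrite -big_split/= mulr_sumr; apply: ler_sum => j _.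
rewrite -mulrDl mulrA ler_wpM2r// /step.
case: eqP => e1; case: eqP => e2; case: eqP => e3; case: eqP => e4 /=;
  rewrite ?addr0 ?add0r ?mulr1 ?mulr0 ?ler01 ?invr_ge0//; exfalso; lia.
Qed.

Variables (n M : nat).
Local Notation X := {ffun 'I_n -> 'I_M}.
Implicit Types (x y : X) (g : X -> C).

(** Because every coordinate moves at every step, the iterated kernel is dominated by a product of
    one-dimensional walks, and [walk_return] alone yields the decay with the full power n. *)
Definition hop x y : R := \prod_k step (x k) (y k).

Lemma hop_ge0 x y : 0 <= hop x y.
Proof. by apply: prodr_ge0 => k _; exact: step_ge0. Qed.

Lemma hopC x y : hop x y = hop y x.
Proof. by apply: eq_bigr => k _; rewrite stepC. Qed.

Lemma hop_sum x (phi psi : 'I_n -> int -> R) :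
  (forall k j, 0 <= phi k j) ->
  (forall k, 2^-1 * (phi k ((x k : nat)%:Z - 1) + phi k ((x k : nat)%:Z + 1))
       <= psi k (x k : nat)%:Z) ->
  \sum_y hop x y * \prod_k phi k (y k : nat)%:Z
     <= \prod_k psi k (x k : nat)%:Z.
Proof.
move=> phi0 phipsi.
have -> : \sum_y hop x y * \prod_k phi k (y k : nat)%:Z =
    \sum_(y : X) \prod_k (step (x k) (y k) * phi k (y k : nat)%:Z).
  by apply: eq_bigr => y _; rewrite big_split.
rewrite -(bigA_distr_bigA (fun k (j : 'I_M) =>
  step (x k) j * phi k (j : nat)%:Z))/=.
apply: ler_prod => k _; apply/andP; split.
  by apply: sumr_ge0 => j _; rewrite mulr_ge0 ?step_ge0.
by apply: le_trans (phipsi k); exact: step_sum.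
Qed.

Fixpoint kpow (P : X -> X -> C) m x y : C :=
  if m is m'.+1 then \sum_z P x z * kpow P m' z y else (x == y)%:R.

(** The phases of [P] disappear in the triangle inequality over paths. What remains is the killed
    walk, and [hop_sum] compares it with the free walk in each coordinate. *)
Lemma kpow_walk (P : X -> X -> C) m x y :
  (forall x y, cmod (P x y) <= hop x y) ->
  cmod (kpow P m x y) <= \prod_k walk m ((x k : nat)%:Z - (y k : nat)%:Z).
Proof.
move=> Phop; elim: m x => [|m IH] x /=.
  case: eqP => [<-|xy]; last first.
    by rewrite cmod0 prodr_ge0.
  by rewrite cmod1 big1// => k _; rewrite subrr eqxx.
apply: (le_trans (cmod_sum _ _ _)).
apply: (@le_trans _ _ (\sum_z hop x z *
    \prod_k walk m ((z k : nat)%:Z - (y k : nat)%:Z))).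
  apply: ler_sum => z _; rewrite cmodM.
  by apply: ler_pM; rewrite ?cmod_ge0.
apply: (@hop_sum x (fun k j => walk m (j - (y k : nat)%:Z))
   (fun k j => walk m.+1 (j - (y k : nat)%:Z))) => k.
  by move=> j; exact: walk_ge0.
rewrite /= ler_wpM2l ?invr_ge0// le_eqVlt; apply/orP; left; apply/eqP.
by congr (walk _ _ + walk _ _); lia.
Qed.

Definition qf (P : X -> X -> C) g : R :=
  re (\sum_x \sum_y P x y * g y * (g x)^*).

(** With r = phi y / phi x one has 2 |g x| |g y| <= r |g x|^2 + |g y|^2 / r; after summation, the
    symmetry of [hop] turns both halves into the action of [hop] on [phi]. *)
Lemma schur_test (P : X -> X -> C) g (phi psi : X -> R) :
  (forall x y, cmod (P x y) <= hop x y) -> (forall x, 0 < phi x) ->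
  (forall x, \sum_y hop x y * phi y <= psi x * phi x) ->
  qf P g <= \sum_x psi x * csq (g x).
Proof.
move=> Phop phi0 phipsi.
pose F x y := hop x y * (csq (g x) * (phi y / phi x)).
have step1 : qf P g <= \sum_x \sum_y 2^-1 * (F x y + F y x).
  rewrite /qf re_sum; apply: ler_sum => x _; rewrite re_sum.
  apply: ler_sum => y _; apply: (le_trans (ler_norm _)); apply: (le_trans (re_le_cmod _)).
  rewrite !cmodM cmod_conj /F (hopC y x) -mulrDr mulrCA -mulrA.
  apply: (@le_trans _ _ (hop x y * (cmod (g y) * cmod (g x)))).
    by rewrite ler_wpM2r ?mulr_ge0 ?cmod_ge0.
  rewrite ler_wpM2l ?hop_ge0// -!cmod_sq.
  have : 0 < phi y / phi x by rewrite divr_gt0.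
  have -> : phi x / phi y = (phi y / phi x)^-1 by rewrite invf_div.
  move: (phi y / phi x) => r r0.
  rewrite -subr_ge0.
  have -> : 2^-1 * (cmod (g x) ^+ 2 * r + cmod (g y) ^+ 2 / r)
      - cmod (g y) * cmod (g x) =
      2^-1 * r * (cmod (g x) - cmod (g y) / r) ^+ 2.
    by field; rewrite gt_eqF.
  by rewrite mulr_ge0 ?sqr_ge0// mulr_ge0 ?invr_ge0// ltW.
apply: (le_trans step1).
under eq_bigr do rewrite -mulr_sumr big_split/=.
rewrite -mulr_sumr big_split/= [X in _ + X]exchange_big/=.
set S := \sum_x \sum_y F x y; have -> : 2^-1 * (S + S) = S by field.
rewrite /S {S}.
apply: ler_sum => x _; rewrite /F.
have -> : \sum_y hop x y * (csq (g x) * (phi y / phi x)) =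
    (\sum_y hop x y * phi y) / phi x * csq (g x).
  by rewrite mulrAC !mulr_suml; apply: eq_bigr => y _; ring.
by rewrite ler_wpM2r ?csq_ge0// ler_pdivrMr.
Qed.

Lemma prod_single (k0 : 'I_n) (F : 'I_n -> R) :
  \prod_k (if k == k0 then F k else 1) = F k0.
Proof.
rewrite (bigD1 k0)//= eqxx big1 ?mulr1// => k /negbTE kk0.
by rewrite kk0.
Qed.

(* Schur test with the weight [r ^ |x_k0 - t0|] *)
Lemma trace_inequality (P : X -> X -> C) (k0 : 'I_n) (t0 : nat) (kappa : R) g :
  (forall x y, cmod (P x y) <= hop x y) -> 0 < kappa -> kappa <= 2^-1 ->
  \sum_(x : X | (x k0 : nat) == t0) csq (g x) <=
    (\sum_x csq (g x) - qf P g) / kappa + kappa * \sum_x csq (g x).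
Proof.
move=> Phop kappa0 kappa1.
pose r := 1 - kappa.
have r0 : 0 < r by rewrite /r; lra.
pose ph (j : int) : R := r ^+ absz (j - t0%:Z)%R.
have ph0 j : 0 < ph j by exact: exprn_gt0.
(* Away from t0 the weight is an eigenfunction of the free step with eigenvalue (r + 1/r) / 2, only
   of order kappa^2 above 1. At t0 the average of the neighbours is r = 1 - kappa, and this defect
   of first order is what produces the trace term. *)
pose ps (j : int) : R := if j == t0%:Z then r else 2^-1 * (r + r^-1).
have phps (j : int) : 2^-1 * (ph (j - 1) + ph (j + 1)) <= ps j * ph j.
  rewrite /ph /ps; case: eqP => [->|jt].
    have -> : absz (t0%:Z - 1 - t0%:Z)%R = 1%N by lia.
    have -> : absz (t0%:Z + 1 - t0%:Z)%R = 1%N by lia.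
    have -> : absz (t0%:Z - t0%:Z)%R = 0%N by lia.
    by rewrite expr0 expr1; lra.
  have [m em] : exists m, absz (j - t0%:Z)%R = m.+1 by exists (absz (j - t0%:Z)%R).-1; lia.
  have {jt} : absz (j - 1 - t0%:Z)%R = m /\ absz (j + 1 - t0%:Z)%R = m.+2 \/
    absz (j - 1 - t0%:Z)%R = m.+2 /\ absz (j + 1 - t0%:Z)%R = m by lia.
  rewrite em => -[] [-> ->]; rewrite !exprS le_eqVlt; apply/orP; left; apply/eqP;
    by field; rewrite gt_eqF.
have := @schur_test P g (fun x => ph (x k0 : nat)%:Z)
  (fun x => ps (x k0 : nat)%:Z) Phop (fun x => ph0 _).
have H x : \sum_y hop x y * ph (y k0 : nat)%:Z <=
    ps (x k0 : nat)%:Z * ph (x k0 : nat)%:Z.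
  have := @hop_sum x (fun k j => if k == k0 then ph j else 1)
    (fun k j => if k == k0 then ps j * ph j else 1).
  rewrite (@prod_single k0 (fun k => ps (x k : nat)%:Z * ph (x k : nat)%:Z)).
  have -> : \sum_y hop x y * \prod_k (if k == k0 then ph (y k : nat)%:Z else 1)
      = \sum_y hop x y * ph (y k0 : nat)%:Z.
    by apply: eq_bigr => y _; rewrite (@prod_single k0 (fun k => ph (y k : nat)%:Z)).
  apply => k; first by move=> j; case: ifP => // _; exact: ltW.
  by case: ifP => // _; lra.
move=> /(_ H) {H}.
rewrite (bigID (fun x : X => (x k0 : nat) == t0))/=.
have -> : \sum_(x : X | (x k0 : nat) == t0) ps (x k0 : nat)%:Z * csq (g x)
    = r * \sum_(x : X | (x k0 : nat) == t0) csq (g x).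
  by rewrite mulr_sumr; apply: eq_bigr => x /eqP ->; rewrite /ps eqxx.
have -> : \sum_(x : X | (x k0 : nat) != t0) ps (x k0 : nat)%:Z * csq (g x)
    = 2^-1 * (r + r^-1) * \sum_(x : X | (x k0 : nat) != t0) csq (g x).
  by rewrite mulr_sumr; apply: eq_bigr => x /eqP nx; rewrite /ps; case: eqP => // -[].
rewrite [\sum_x csq (g x)](bigID (fun x : X => (x k0 : nat) == t0))/=.
set a := \sum_(x | _) _; set b := \sum_(x | _) _; set q := qf _ _ => H.
have a0 : 0 <= a by apply: sumr_ge0 => x _; exact: csq_ge0.
have b0 : 0 <= b by apply: sumr_ge0 => x _; exact: csq_ge0.
(* The excess over 1 is exactly kappa^2 / (2 r), and 2 r >= 1 because kappa <= 1/2. *)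
have rE : 2^-1 * (r + r^-1) <= 1 + kappa ^+ 2.
  have -> : 2^-1 * (r + r^-1) = 1 + kappa ^+ 2 * (2 * r)^-1.
    by rewrite /r; field; rewrite gt_eqF.
  by rewrite lerD2l ler_piMr ?sqr_ge0// invf_le1 ?mulr_gt0// /r; lra.
have : a * kappa <= a + b - q + kappa ^+ 2 * (a + b).
  have := ler_wpM2r b0 rE; rewrite /r in H *; nra.
have -> : (a + b - q) / kappa + kappa * (a + b) =
  (a + b - q + kappa ^+ 2 * (a + b)) / kappa by field; rewrite gt_eqF.
by rewrite ler_pdivlMr.
Qed.

Section density.
Variables (P : X -> X -> C) (psi : X -> X -> C) (p : X -> R).
Hypothesis Phop : forall x y, cmod (P x y) <= hop x y.
Hypothesis psi_orth : forall i j, \sum_x psi i x * (psi j x)^* = (i == j)%:R.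
Hypothesis psi_full : forall x y, \sum_i psi i x * (psi i y)^* = (x == y)%:R.
Hypothesis PE : forall x y, P x y = \sum_i rc (p i) * (psi i x * (psi i y)^*).

Lemma kpowE m x y :
  kpow P m x y = \sum_i rc (p i ^+ m) * (psi i x * (psi i y)^*).
Proof.
elim: m x y => [|m IH] x y /=.
  by rewrite -psi_full; apply: eq_bigr => i _; rewrite expr0 mul1r.
under eq_bigr do rewrite PE IH mulr_suml.
rewrite exchange_big/=; apply: eq_bigr => i _.
transitivity (\sum_z \sum_j (rc (p i) * psi i x * rc (p j ^+ m) * (psi j y)^*) *
   (psi j z * (psi i z)^*)).
  by apply: eq_bigr => z _; rewrite mulr_sumr; apply: eq_bigr => j _; ring.
rewrite exchange_big/= (bigD1 i)//= -mulr_sumr psi_orth eqxx mulr1.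
rewrite big1 ?addr0; last first.
  by move=> j ji; rewrite -mulr_sumr psi_orth (negbTE ji) mulr0.
by rewrite exprS rcM/=; ring.
Qed.

Lemma csq_psi_full x : \sum_i csq (psi i x) = 1.
Proof.
have := psi_full x x; rewrite eqxx.
under eq_bigr do rewrite mul_conj.
by rewrite -rc_sum => -[].
Qed.

Lemma bernoulli_ineq (t : R) N : t <= 1 -> 1 - N%:R * t <= (1 - t) ^+ N.
Proof.
move=> t1; elim: N => [|N IH]; first by rewrite mul0r subr0 expr0.
rewrite exprS; apply: (@le_trans _ _ ((1 - t) * (1 - N%:R * t))); last first.
  by rewrite ler_wpM2l// subr_ge0.
rewrite -natr1; have : 0 <= N%:R :> R by exact: ler0n.
by move: (N%:R) => a a0; have := sqr_ge0 t; nra.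
Qed.

(** On these indices p_i is so close to 1 that its even power at the time of [walk_return] is still
    at least 1/2. The sum is therefore at most twice a diagonal entry of that power of [P], which
    the return probability dominates. At level 0 completeness alone suffices. *)
Lemma density_bound m x :
  \sum_(i | 1 - p i <= 4^-1 ^+ m) csq (psi i x) <= 2 * 2 ^+ n * (2^-1 ^+ m) ^+ n.
Proof.
case: m => [|m].
  apply: (@le_trans _ _ 1); last first.
    rewrite expr0 expr1n mulr1; have : 1 <= 2 ^+ n :> R by rewrite exprn_ege1// ler1n.
    lra.
  rewrite -[leRHS](csq_psi_full x) [leRHS](bigID (fun i => 1 - p i <= 4^-1 ^+ 0))/=.
  by rewrite lerDl sumr_ge0// => i _; exact: csq_ge0.
(* The number of steps is 2 k; times the threshold 4^-(m+1) it equals 1/2, which makes Bernoulli's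
   inequality give the lower bound 1/2. *)
pose k := (4 ^ m)%N.
apply: (@le_trans _ _ (2 * \sum_i p i ^+ k.*2 * csq (psi i x))).
  rewrite mulr_sumr [leRHS](bigID (fun i => 1 - p i <= 4^-1 ^+ m.+1))/=.
  apply: ler_wpDr.
    apply: sumr_ge0 => i _; rewrite !mulr_ge0 ?csq_ge0//.
    by rewrite -mul2n exprM exprn_ge0 ?sqr_ge0.
  apply: ler_sum => i pi; rewrite mulrA ler_peMl ?csq_ge0//.
  have kk : (k.*2)%:R * 4^-1 ^+ m.+1 = 2^-1 :> R.
    rewrite /k -mul2n natrM natrX exprS exprVn; field.
    by rewrite expf_neq0.
  have ts : 4^-1 ^+ m.+1 <= 1 :> R by rewrite exprn_ile1 ?invr_ge0// invf_le1// ler1n.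
  have := @bernoulli_ineq (1 - p i) k.*2 (le_trans pi ts).
  rewrite subKr.
  have : (k.*2)%:R * (1 - p i) <= (k.*2)%:R * 4^-1 ^+ m.+1 by rewrite ler_wpM2l.
  rewrite kk; lra.
have -> : \sum_i p i ^+ k.*2 * csq (psi i x) = re (kpow P k.*2 x x).
  rewrite kpowE re_sum; apply: eq_bigr => i _.
  by rewrite mul_conj -rcM.
rewrite -mulrA ler_wpM2l//; apply: (le_trans (ler_norm _)); apply: (le_trans (re_le_cmod _)).
apply: (le_trans (kpow_walk _ _ _ Phop)).
under eq_bigr do rewrite subrr.
rewrite prodr_const card_ord -exprMn exprS mulrA mulfV// mul1r.
by rewrite lerXn2r ?nnegrE ?walk_ge0 ?exprn_ge0 ?invr_ge0 ?walk_return.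
Qed.

End density.

End hopping.

(** * Finite orthonormal sums and dyadic levels *)

Section orthonormal_sums.
Context {R : realType}.
Local Notation C := (cplx R).

Lemma csq_sum_herm (I : finType) (c : I -> C) (Y : finType) (v : I -> Y -> C) :
  (forall i j, \sum_y v i y * (v j y)^* = (i == j)%:R) ->
  \sum_y csq (\sum_i c i * v i y) = \sum_i csq (c i).
Proof.
move=> vorth; apply: (@rc_inj R); rewrite !rc_sum.
transitivity (\sum_y \sum_i \sum_j (c i * (c j)^*) * (v i y * (v j y)^*)).
  apply: eq_bigr => y _; rewrite -mul_conj conj_sum mulr_suml.
  apply: eq_bigr => i _; rewrite mulr_sumr; apply: eq_bigr => j _.
  by rewrite rmorphM; ring.
rewrite exchange_big/=; apply: eq_bigr => i _.
rewrite exchange_big/= (bigD1 i)//= -mulr_sumr vorth eqxx mulr1 mul_conj.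
by rewrite big1 ?addr0// => j ji; rewrite -mulr_sumr vorth eq_sym (negbTE ji) mulr0.
Qed.

Lemma bessel_sum (I Y : finType) (v : I -> Y -> C) (g : Y -> C) :
  (forall i j, \sum_y v i y * (v j y)^* = (i == j)%:R) ->
  \sum_i csq (\sum_y v i y * g y) <= \sum_y csq (g y).
Proof.
move=> vorth.
pose c i := (\sum_y v i y * g y)^*.
have H : 0 <= \sum_y csq ((g y)^* - \sum_i c i * v i y).
  by apply: sumr_ge0 => y _; exact: csq_ge0.
move: H; under eq_bigr do rewrite csqB csq_conj.
rewrite big_split/= big_split/= (csq_sum_herm c vorth).
rewrite sumrN -mulr_sumr.
have -> : \sum_y re ((g y)^* * (\sum_i c i * v i y)^*) = \sum_i csq (c i).
  rewrite -re_sum.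
  under eq_bigr do rewrite conj_sum mulr_sumr.
  rewrite exchange_big/= re_sum; apply: eq_bigr => i _.
  transitivity (re ((c i)^* * c i)); last by rewrite mulrC mul_conj.
  have cE : c i = \sum_y (v i y)^* * (g y)^*.
    by rewrite /c conj_sum; apply: eq_bigr => y _; rewrite rmorphM.
  rewrite [X in _ * X]cE mulr_sumr; congr re.
  by apply: eq_bigr => y _; rewrite rmorphM; ring.
have -> : \sum_i csq (c i) = \sum_i csq (\sum_y v i y * g y).
  by apply: eq_bigr => i _; rewrite csq_conj.
lra.
Qed.

Lemma weighted_cauchy m (z : nat -> C) (w : nat -> R) : (forall j, 0 < w j) ->
  csq (\sum_(j < m) z j) <=
    (\sum_(j < m) w j) * \sum_(j < m) csq (z j) / w j.
Proof.
move=> w0; elim: m => [|m IH]; first by rewrite !big_ord0 csq0 mul0r.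
rewrite !big_ord_recr/=; set Z := \sum_(j < m) _ in IH *.
set W := \sum_(j < m) _ in IH *; set S := \sum_(j < m) _ in IH *.
have W0 : 0 <= W by apply: sumr_ge0 => j _; exact: ltW.
have S0 : 0 <= S by apply: sumr_ge0 => j _; rewrite divr_ge0 ?csq_ge0// ltW.
rewrite csqD.
have wm := w0 m; move: (w m) wm => u u0.
set zz := csq (z m) / u.
have -> : csq (z m) = zz * u by rewrite /zz divfK// gt_eqF.
have zz0 : 0 <= zz by rewrite divr_ge0 ?csq_ge0// ltW.
suff : 2 * re (Z * (z m)^*) <= W * zz + u * S by nra.
have sq : re (Z * (z m)^*) ^+ 2 <= (W * S) * (zz * u).
  have -> : zz * u = csq (z m) by rewrite /zz divfK// gt_eqF.
  apply: (@le_trans _ _ (csq (Z * (z m)^*))); first by rewrite /csq lerDl sqr_ge0.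
  by rewrite csqM csq_conj ler_wpM2r// csq_ge0.
have A0 : 0 <= W * zz + u * S by apply: addr_ge0; apply: mulr_ge0 => //; exact: ltW.
rewrite leNgt; apply/negP => lt.
have : (W * zz + u * S) ^+ 2 < (2 * re (Z * (z m)^*)) ^+ 2 by rewrite ltr_pXn2r ?nnegrE// ltW// (le_lt_trans A0).
have := sqr_ge0 (W * zz - u * S); nra.
Qed.

Lemma geometric_le (q : R) m L : 0 <= q -> q < 1 ->
  \sum_(j < L | (m <= j)%N) q ^+ j <= q ^+ m / (1 - q).
Proof.
move=> q0 q1; have q1' : 0 < 1 - q by rewrite subr_gt0.
have H k : \sum_(j < k) q ^+ j <= (1 - q)^-1.
  rewrite -[leRHS]mul1r ler_pdivlMr// mulrC.
  have := subrX1 q k; rewrite -[q - 1]opprB mulNr => /eqP; rewrite -eqr_oppLR opprB => /eqP <-.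
  by rewrite gerBl exprn_ge0.
rewrite -(big_mkord (fun j => m <= j)%N (fun j => q ^+ j)).
have [Lm|mL] := leqP L m.
  rewrite big_nat_cond big1 ?divr_ge0 ?exprn_ge0 ?(ltW q1')//.
  by move=> j /andP[/andP[_ jL]] mj; exfalso; move: (leq_ltn_trans mj jL); lia.
rewrite (big_cat_nat (n := m)) ?(ltnW mL)//=.
rewrite big_nat_cond big1 ?add0r; last first.
  by move=> j /andP[/andP[_ jm]] mj; exfalso; lia.
rewrite big_nat_cond (eq_bigl (fun j => (m <= j < L)%N && true)); last first.
  by move=> j /=; rewrite andbT -andbA; case: (m <= j)%N; rewrite ?andbF ?andbT.
rewrite -big_nat_cond -{1}[m]add0n big_addn big_mkord.
under eq_bigr do rewrite exprD.
by rewrite -mulr_suml mulrC ler_wpM2l ?exprn_ge0// H.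
Qed.

(** Taking the least m puts every x above q into level 0, values above 1 included; hence the upper
    bound comes only for positive m. *)
Lemma dyadic_level (q x : R) : 0 < q -> q < 1 -> 0 < x ->
  exists m, q ^+ m.+1 < x /\ ((0 < m)%N -> x <= q ^+ m).
Proof.
move=> q0 q1 x0.
have ex : exists m, q ^+ m.+1 < x.
  have /cvgrPdist_lt /(_ x x0) [N _ HN] : (fun n => q ^+ n) @ \oo --> (0 : R).
    by apply: cvg_expr; rewrite ger0_norm// ltW.
  exists N; have := HN N.+1 (leqnSn N); rewrite /= sub0r normrN ger0_norm//.
  by rewrite exprn_ge0// ltW.
have := ex_minnP ex; case=> m Hm min; exists m; split => //.
case: m Hm min => // m Hm min _; rewrite leNgt; apply/negP => lt.
by have := min m lt; rewrite ltnn.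
Qed.

End orthonormal_sums.

(** * Rumin's method on the lattice *)

Section rumin.
Context {R : realType}.
Local Notation C := (cplx R).
Variables (n M N : nat).
Local Notation X := {ffun 'I_n -> 'I_M}.
Variables (P : X -> X -> C) (psi : X -> X -> C) (p : X -> R).
Hypothesis Phop : forall x y, cmod (P x y) <= hop x y.
Hypothesis psi_orth : forall i j, \sum_x psi i x * (psi j x)^* = (i == j)%:R.
Hypothesis psi_full : forall x y, \sum_i psi i x * (psi i y)^* = (x == y)%:R.
Hypothesis PE : forall x y, P x y = \sum_i rc (p i) * (psi i x * (psi i y)^*).

Lemma csq_expand (a : X -> C) :
  \sum_x csq (\sum_i a i * psi i x) = \sum_i csq (a i).
Proof. exact: csq_sum_herm. Qed.

Lemma qf_expand (a : X -> C) :
  qf P (fun x => \sum_i a i * psi i x) = \sum_i p i * csq (a i).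
Proof.
have H i : \sum_y (psi i y)^* * (\sum_j a j * psi j y) = a i.
  under eq_bigr do rewrite mulr_sumr.
  rewrite exchange_big/=.
  transitivity (\sum_j a j * \sum_y psi j y * (psi i y)^*).
    by apply: eq_bigr => j _; rewrite mulr_sumr; apply: eq_bigr => y _; ring.
  rewrite (bigD1 i)//= psi_orth eqxx mulr1 big1 ?addr0// => j ji.
  by rewrite psi_orth (negbTE ji) mulr0.
transitivity (re (\sum_i rc (p i) * (a i * (a i)^*))); last first.
  by rewrite re_sum; apply: eq_bigr => i _; rewrite mul_conj -rcM re_rc.
rewrite /qf; congr re.
transitivity (\sum_x \sum_y \sum_i rc (p i) * (((psi i y)^* * (\sum_j a j * psi j y)) *
   (psi i x * (\sum_j a j * psi j x)^*))).
  apply: eq_bigr => x _; apply: eq_bigr => y _.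
  rewrite PE !mulr_suml; apply: eq_bigr => i _; ring.
under eq_bigr do rewrite exchange_big/=.
rewrite exchange_big/=; apply: eq_bigr => i _.
under eq_bigr do rewrite -mulr_sumr -mulr_suml H.
rewrite -mulr_sumr -mulr_sumr; congr (_ * (_ * _)).
rewrite -[in RHS](H i) conj_sum; apply: eq_bigr => x _.
by rewrite conjM conjCK.
Qed.

Lemma hop_le1 (x : X) : \sum_y (hop x y : R) <= 1.
Proof.
have := @hop_sum R n M x (fun _ _ => 1) (fun _ _ => 1).
have -> : \prod_(k < n) (1 : R) = 1 by rewrite big1.
under eq_bigr do rewrite mulr1.
by apply => k //; lra.
Qed.

(** Schur's test with constant weights, applied to the eigenfunction itself. *)
Lemma p_le1 i : p i <= 1.
Proof.
have := @schur_test R n M P (psi i) (fun _ => 1) (fun _ => 1) Phop (fun _ => ltr01).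
have H (x : X) : \sum_y hop x y * 1 <= 1 * 1 :> R.
  by under eq_bigr do rewrite mulr1; rewrite mulr1 hop_le1.
move=> /(_ H) {H}.
have -> : \sum_x 1 * csq (psi i x) = 1.
  under eq_bigr do rewrite mul1r.
  by apply: rc_inj; rewrite rc_sum rc1; under eq_bigr do rewrite -mul_conj;
    rewrite psi_orth eqxx.
have psiE : psi i = fun x => \sum_j (j == i)%:R * psi j x.
  apply/funext => x; rewrite (bigD1 i)//= eqxx mul1r big1 ?addr0// => j ji.
  by rewrite (negbTE ji) mul0r.
rewrite {1}psiE qf_expand (bigD1 i)//= eqxx csq_rc expr1n mulr1.
rewrite big1 ?addr0// => j ji.
by rewrite (negbTE ji) csq0 mulr0.
Qed.

Variables (e beta s : R).
Hypotheses (e0 : 0 < e) (e1 : e <= 1) (s0 : 0 <= s) (beta0 : 0 < beta).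
Hypothesis betaE : beta = n%:R - 2 + s.

(** The ratio of the geometric series over levels. [qX] factors its powers into the inverse energy
    4^m, the density (2^-m)^n and the factor (2^-m)^s bought with [e]. *)
Let q : R := 2 `^ (- beta).

Let q_gt0 : 0 < q. Proof. exact: powR_gt0. Qed.

Let q_lt1 : q < 1.
Proof.
by rewrite /q /powR gt_eqF// expR_lt1 mulNr oppr_lt0 mulr_gt0// ln_gt0// ltr1n.
Qed.

Let qX m : q ^+ m = 4 ^+ m * (2^-1 ^+ m) ^+ n * (2^-1 ^+ m) `^ s.
Proof.
have e4 : 4 = 2 `^ 2 :> R by rewrite powR_mulrn// -natrX.
have e2 : 2^-1 = 2 `^ (-1) :> R by rewrite powR_inv1.
rewrite /q e4 e2 -!powR_mulrn ?powR_ge0// -!powRrM -!powRD ?pnatr_eq0 ?implybT//.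
by rewrite betaE; congr (_ `^ _); ring.
Qed.

Let q_pow m : q ^+ m = (2^-1 ^+ m) `^ beta.
Proof.
have -> : 2^-1 ^+ m = 2 `^ (- m%:R) :> R by rewrite powRN powR_mulrn// exprVn.
rewrite /q -(powR_mulrn m (powR_ge0 2 (- beta))) -!powRrM.
by congr (_ `^ _); ring.
Qed.

Let lam i : R := 1 - p i + e.

Let lam_gt0 i : 0 < lam i.
Proof. by rewrite /lam ltr_wpDl ?subr_ge0 ?p_le1. Qed.

Let quarter_gt0 : 0 < 4^-1 :> R. Proof. by rewrite invr_gt0. Qed.
Let quarter_lt1 : 4^-1 < 1 :> R. Proof. by rewrite invf_lt1// ltr1n. Qed.

Let lev i : nat := projT1 (cid (dyadic_level quarter_gt0 quarter_lt1 (lam_gt0 i))).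

Let lev_gt i : 4^-1 ^+ (lev i).+1 < lam i.
Proof. by rewrite /lev; case: cid => /= m []. Qed.

Let lev_le i : (0 < lev i)%N -> lam i <= 4^-1 ^+ lev i.
Proof. by rewrite /lev; case: cid => /= m []. Qed.

Let L := (\max_i lev i).+1.

Let lev_lt i : (lev i < L)%N.
Proof. by rewrite ltnS leq_bigmax. Qed.

Let sum_lev (V : nmodType) (A : pred nat) (F : X -> V) :
  \sum_(i | A (lev i)) F i = \sum_(m < L | A m) \sum_(i | lev i == m) F i.
Proof.
rewrite (partition_big (fun i => Ordinal (lev_lt i)) (fun m : 'I_L => A m))//=.
apply: eq_bigr => m Am; apply: eq_bigl => i.
rewrite -val_eqE /=; case: eqP => [->|]; rewrite ?andbT ?andbF//.
Qed.

Let density_lev m x :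
  \sum_(i | lev i == m) csq (psi i x) <= 2 * 2 ^+ n * (2^-1 ^+ m) ^+ n.
Proof.
case: m => [|m].
  apply: (@le_trans _ _ 1); last first.
    rewrite expr0 expr1n mulr1; have : 1 <= 2 ^+ n :> R by rewrite exprn_ege1// ler1n.
    lra.
  rewrite -[leRHS](csq_psi_full psi_full x) [leRHS](bigID (fun i => lev i == 0%N))/=.
  by rewrite lerDl sumr_ge0// => i _; exact: csq_ge0.
apply: le_trans (density_bound Phop psi_orth psi_full PE m.+1 x).
rewrite [leRHS](bigID (fun i => lev i == m.+1))/= ler_wpDr//.
  by apply: sumr_ge0 => i _; exact: csq_ge0.
rewrite le_eqVlt; apply/orP; left; apply/eqP; apply: eq_bigl => i.
case: eqP => [li|]; rewrite ?andbF// andbT; apply/esym.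
have := @lev_le i; rewrite li => /(_ isT); apply: le_trans.
by rewrite /lam lerDl ltW.
Qed.

(** The 8 is 4 * 2: a level determines [lam] only up to a factor 4, and [density_lev] carries a 2.
    The denominator sums the series over the levels. *)
Let B : R := 8 * 2 ^+ n * e `^ (- s / 2) / (1 - q).

Let B_ge0 : 0 <= B.
Proof. by rewrite divr_ge0 ?subr_ge0 ?(ltW q_lt1)// !mulr_ge0 ?exprn_ge0 ?powR_ge0. Qed.

(* Levels below [e] are empty, which is where the factor [e `^ (- s / 2)]
   comes from. *)
Let low_bound m x :
  \sum_(i | (m <= lev i)%N) (lam i)^-1 * csq (psi i x) <= B * q ^+ m.
Proof.
rewrite (sum_lev (fun k => m <= k)%N).
apply: (@le_trans _ _ (\sum_(k < L | (m <= k)%N)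
    8 * 2 ^+ n * e `^ (- s / 2) * q ^+ k)); last first.
  rewrite -mulr_sumr /B -[leRHS]mulrA; apply: ler_wpM2l.
    by rewrite !mulr_ge0 ?exprn_ge0 ?powR_ge0.
  by rewrite [leRHS]mulrC geometric_le// ltW.
apply: ler_sum => k _.
have [[i0 i0k]|nok] := pselect (exists i, lev i = k); last first.
  rewrite big_pred0 ?mulr_ge0 ?exprn_ge0 ?powR_ge0 ?(ltW q_gt0)//.
  by move=> i; apply/negP => /eqP ik; apply: nok; exists i.
have ek : e <= 4^-1 ^+ k.
  have elam : e <= lam i0 by rewrite /lam; have := p_le1 i0; lra.
  case: (posnP k) => [->|k0]; first by rewrite expr0.
  by apply: (le_trans elam); rewrite -i0k lev_le// i0k.
have es : 1 <= (2^-1 ^+ k) `^ s * e `^ (- s / 2).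
  rewrite mulNr powRN -[leLHS](@mulfV _ (e `^ (s / 2))) ?gt_eqF ?powR_gt0//.
  rewrite ler_wpM2r ?invr_ge0 ?powR_ge0//.
  have -> : (2^-1 ^+ k) `^ s = (4^-1 ^+ k) `^ (s / 2) :> R.
    have -> : 4^-1 = 2^-1 ^+ 2 :> R by rewrite exprVn -natrX.
    rewrite -exprM mulnC exprM -[X in X `^ (s / 2)]powR_mulrn ?exprn_ge0 ?invr_ge0//.
    by rewrite -powRrM; congr (_ `^ _); field.
  by rewrite ge0_ler_powR ?nnegrE ?divr_ge0 ?exprn_ge0 ?invr_ge0 ?(ltW e0).
apply: (@le_trans _ _ (\sum_(i | lev i == k) 4 ^+ k.+1 * csq (psi i x))).
  apply: ler_sum => i /eqP ik; rewrite ler_wpM2r ?csq_ge0//.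
  have := lev_gt i; rewrite ik exprVn => h.
  by rewrite -[leRHS]invrK lef_pV2 ?posrE ?invr_gt0 ?exprn_gt0 ?lam_gt0// ltW.
rewrite -mulr_sumr.
apply: (@le_trans _ _ (4 ^+ k.+1 * (2 * 2 ^+ n * (2^-1 ^+ k) ^+ n))).
  by rewrite ler_wpM2l ?exprn_ge0// density_lev.
rewrite qX exprS.
have -> : 4 * 4 ^+ k * (2 * 2 ^+ n * (2^-1 ^+ k) ^+ n) =
  8 * 2 ^+ n * (4 ^+ k * (2^-1 ^+ k) ^+ n) * 1 :> R by ring.
have -> : 8 * 2 ^+ n * e `^ (- s / 2) *
    (4 ^+ k * (2^-1 ^+ k) ^+ n * (2^-1 ^+ k) `^ s) =
  8 * 2 ^+ n * (4 ^+ k * (2^-1 ^+ k) ^+ n) * ((2^-1 ^+ k) `^ s * e `^ (- s / 2)) :> R by ring.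
by rewrite ler_wpM2l// !mulr_ge0 ?exprn_ge0 ?invr_ge0.
Qed.

Variables (k0 : 'I_n) (t0 : nat).
Let H := fun x : X => (x k0 : nat) == t0.

Let piece (f : X -> C) m x :=
  \sum_(i | lev i == m) rc (Num.sqrt (lam i)^-1) * f i * psi i x.

Let csq_sqrt (i : X) : csq (rc (Num.sqrt (lam i)^-1)) = (lam i)^-1.
Proof. by rewrite csq_rc sqr_sqrtr// invr_ge0 ltW// lam_gt0. Qed.

(** With b the sum on the right, a function of level m has form at most b and mass at most 4^(m+1)
    b. The choice kappa = 2^-(m+1) balances the two terms of [trace_inequality]: each becomes
    2^(m+1) b. *)
Let trace_piece f m :
  \sum_(x | H x) csq (piece f m x) <= 4 * 2 ^+ m * \sum_(i | lev i == m) csq (f i).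
Proof.
pose a i := if lev i == m then rc (Num.sqrt (lam i)^-1) * f i else 0.
have pieceE : piece f m = fun x => \sum_i a i * psi i x.
  apply/funext => x; rewrite /piece big_mkcond/=; apply: eq_bigr => i _.
  by rewrite /a; case: ifP; rewrite ?mul0r.
have csqa i : csq (a i) = if lev i == m then (lam i)^-1 * csq (f i) else 0.
  by rewrite /a; case: ifP => _; rewrite ?csq0// csqM csq_sqrt.
pose kappa : R := 2^-1 ^+ m.+1.
have kappa0 : 0 < kappa by rewrite exprn_gt0// invr_gt0.
have kappa1 : kappa <= 2^-1.
  by rewrite /kappa exprS ler_piMr ?invr_ge0// exprn_ile1 ?invr_ge0// invf_le1// ler1n.
apply: (le_trans (@trace_inequality R n M P k0 t0 kappa (piece f m) Phop kappa0 kappa1)).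
rewrite pieceE csq_expand qf_expand -sumrB.
set b := \sum_(i | _) csq (f i).
have b0 : 0 <= b by apply: sumr_ge0 => i _; exact: csq_ge0.
have h1 : \sum_i (csq (a i) - p i * csq (a i)) <= b.
  rewrite /b [leRHS]big_mkcond/=; apply: ler_sum => i _.
  rewrite csqa; case: ifP => _; last by rewrite mulr0 subrr.
  have -> : (lam i)^-1 * csq (f i) - p i * ((lam i)^-1 * csq (f i)) =
    ((1 - p i) / lam i) * csq (f i) by ring.
  by rewrite ler_piMl ?csq_ge0// ler_pdivrMr ?lam_gt0// mul1r /lam lerDl ltW.
have h2 : \sum_i csq (a i) <= 4 ^+ m.+1 * b.
  rewrite /b [in leRHS]big_mkcond/= mulr_sumr; apply: ler_sum => i _.
  rewrite csqa; case: ifP => [/eqP im|_]; last by rewrite mulr0.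
  rewrite ler_wpM2r ?csq_ge0//.
  have := lev_gt i; rewrite im exprVn => h.
  by rewrite -[leRHS]invrK lef_pV2 ?posrE ?invr_gt0 ?exprn_gt0 ?lam_gt0// ltW.
apply: (@le_trans _ _ (b / kappa + kappa * (4 ^+ m.+1 * b))).
  by rewrite lerD// ?ler_wpM2r ?ler_wpM2l ?invr_ge0// ltW.
have e42 : 4 = 2 ^+ 2 :> R by rewrite -natrX.
rewrite /kappa exprVn invrK e42 -exprM mulnC exprM le_eqVlt; apply/orP; left.
apply/eqP; rewrite exprS; field.
by rewrite expf_neq0.
Qed.

Let high f m x := \sum_(j < m) piece f j x.

(** A discrete Hardy inequality. Level j contributes 2^j to the trace, and the square of a sum over
    j < m is opened by Cauchy-Schwarz with geometric weights; the double sum then converges because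
    the factor 2^-m beats the loss. It is uniform in K, so that m may later depend on the point. *)
Let high_bound f K :
  \sum_(m < K) 2^-1 ^+ m * \sum_(x | H x) csq (high f m x)
    <= 24 * \sum_i csq (f i).
Proof.
pose b m := \sum_(i | lev i == m) csq (f i).
have b0 m : 0 <= b m by apply: sumr_ge0 => i _; exact: csq_ge0.
(* Any ratio strictly between 1 and 2 would do. Here the weights below m add up to at most 2 th^m,
   and th / 2 = 3/4 gives the final series, whose tail beyond j is 3 (3/4)^j; thus 24 = 2 * 4 *
   3. *)
pose th : R := 3 / 2.
have th0 : 0 < th by rewrite /th; lra.
have ths m : \sum_(j < m) th ^+ j <= 2 * th ^+ m.
  elim: m => [|m IH]; first by rewrite big_ord0 mulr_ge0 ?exprn_ge0 ?(ltW th0).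
  rewrite big_ord_recr/= exprS; move: IH; rewrite /th; lra.
have term m : 2^-1 ^+ m * \sum_(x | H x) csq (high f m x) <=
    \sum_(j < K | (j < m)%N) 8 * (3 / 4) ^+ m * (4 / 3) ^+ j * b j \/ (K <= m)%N.
  have [Km|mK] := leqP K m; [by right|left].
  apply: (@le_trans _ _ (2^-1 ^+ m * (2 * th ^+ m *
      \sum_(j < m) (\sum_(x | H x) csq (piece f j x)) / th ^+ j))).
    rewrite ler_wpM2l ?exprn_ge0 ?invr_ge0//.
    under [X in _ * X]eq_bigr do rewrite mulr_suml.
    rewrite exchange_big/= mulr_sumr; apply: ler_sum => x _.
    apply: (le_trans (@weighted_cauchy R m (fun j => piece f j x) (fun j => th ^+ j) _)).
      by move=> j; rewrite exprn_gt0.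
    rewrite ler_wpM2r// sumr_ge0// => j _.
    by rewrite divr_ge0 ?csq_ge0 ?exprn_ge0 ?(ltW th0).
  rewrite !mulr_sumr -(big_mkord xpredT (fun j => 2^-1 ^+ m * (2 * th ^+ m *
    ((\sum_(x | H x) csq (piece f j x)) / th ^+ j))))
   -(big_mkord (fun j => (j < m)%N) (fun j => 8 * (3 / 4) ^+ m * (4 / 3) ^+ j * b j)).
  rewrite (big_nat_widen _ _ _ _ _ (ltnW mK)) /=.
  apply: ler_sum => j _.
  apply: (@le_trans _ _ (2^-1 ^+ m * (2 * th ^+ m * ((4 * 2 ^+ j * b j) / th ^+ j)))).
    rewrite !ler_wpM2l ?mulr_ge0 ?exprn_ge0 ?invr_ge0 ?(ltW th0)//.
    by rewrite ler_wpM2r ?trace_piece// invr_ge0 exprn_ge0// ltW.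
  have -> : 3 / 4 = 2^-1 * th :> R by rewrite /th; field.
  have -> : 4 / 3 = 2 / th :> R by rewrite /th; field.
  rewrite [(2^-1 * th) ^+ m]exprMn [(2 / th) ^+ j]exprMn [th^-1 ^+ j]exprVn.
  move: (2^-1 ^+ m) (th ^+ m) ((th ^+ j)^-1) (2 ^+ j) (b j) => v1 v2 v3 v4 v5.
  by rewrite le_eqVlt; apply/orP; left; apply/eqP; ring.
apply: (@le_trans _ _ (\sum_(m < K) \sum_(j < K | (j < m)%N)
    8 * (3 / 4) ^+ m * (4 / 3) ^+ j * b j)).
  apply: ler_sum => m _; case: (term m) => //; by rewrite leqNgt ltn_ord.
rewrite (exchange_big_dep xpredT)//=.
apply: (@le_trans _ _ (\sum_(j < K) 24 * b j)).
  apply: ler_sum => j _; rewrite -mulr_suml ler_wpM2r// -mulr_suml -mulr_sumr.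
  have := @geometric_le R (3 / 4) j.+1 K; rewrite (_ : 1 - 3 / 4 = 4^-1); last by field.
  rewrite invrK exprS => /(_ _ _) G.
  apply: (@le_trans _ _ (8 * (3 / 4 * (3 / 4) ^+ j * 4) * (4 / 3) ^+ j)).
    rewrite ler_wpM2r ?exprn_ge0 ?divr_ge0// ler_wpM2l//; apply: G; lra.
  have : (3 / 4) ^+ j * (4 / 3) ^+ j = 1 :> R.
    by rewrite -exprMn (_ : 3 / 4 * (4 / 3) = 1) ?expr1n//; field.
  move: ((3 / 4) ^+ j) ((4 / 3) ^+ j) => v1 v2 v12.
  have -> : 8 * (3 / 4 * v1 * 4) * v2 = 24 * (v1 * v2) by field.
  by rewrite v12 mulr1.
rewrite -mulr_sumr ler_wpM2l//.
have := @sum_lev R xpredT (fun i => csq (f i)); rewrite /= => ->.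
have [KL|LK] := leqP K L.
  rewrite -(big_mkord xpredT b) -(big_mkord xpredT b).
  rewrite (big_nat_widen _ _ _ _ _ KL) /= big_mkcond/=.
  by apply: ler_sum => j _; case: ifP.
rewrite -(big_mkord xpredT b) (big_cat_nat (n := L)) ?(ltnW LK)//= big_mkord.
rewrite [X in _ + X]big1_seq ?addr0// => j.
rewrite mem_index_iota => /andP[_ /andP[Lj _]].
rewrite /b big_pred0// => i; apply/negP => /eqP ij; move: (lev_lt i).
by rewrite ij ltnNge Lj.
Qed.

Variables (f : 'I_N -> X -> C).
Hypothesis f_orth : forall a b, \sum_i f a i * (f b i)^* = (a == b)%:R.

Let u a x := \sum_i rc (Num.sqrt (lam i)^-1) * f a i * psi i x.

Let rho x := \sum_a csq (u a x).

(** At a fixed x the low part is the pairing of [f a] with the vector lam_i^(-1/2) psi_i(x). Since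
    the [f a] are orthonormal, Bessel's inequality bounds the sum over a by the squared length of
    that vector, independently of N. *)
Let rho_split m x :
  rho x <= 2 * \sum_a csq (high (f a) m x) + 2 * (B * q ^+ m).
Proof.
pose low a := \sum_(i | (m <= lev i)%N) rc (Num.sqrt (lam i)^-1) * f a i * psi i x.
apply: (@le_trans _ _ (\sum_a (2 * csq (high (f a) m x) + 2 * csq (low a)))).
  apply: ler_sum => a _.
  have -> : u a x = high (f a) m x + low a.
    rewrite /u (bigID (fun i => lev i < m)%N)/=; congr (_ + _).
      rewrite (sum_lev (fun k => k < m)%N) /high /piece.
      have [mL|Lm] := leqP m L.
        rewrite -(big_mkord (fun k => k < m)%N (fun k => \sum_(i | lev i == k)
          rc (Num.sqrt (lam i)^-1) * f a i * psi i x)).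
        rewrite -(big_mkord xpredT (fun k => \sum_(i | lev i == k)
          rc (Num.sqrt (lam i)^-1) * f a i * psi i x)).
        by rewrite (big_nat_widen _ _ _ _ _ mL).
      rewrite -(big_mkord xpredT (fun k => \sum_(i | lev i == k)
          rc (Num.sqrt (lam i)^-1) * f a i * psi i x)).
      rewrite (big_cat_nat (n := L)) ?(ltnW Lm)//= big_mkord.
      rewrite [X in _ + X]big1_seq ?addr0; last first.
        move=> k; rewrite mem_index_iota => /andP[_ /andP[Lk _]].
        rewrite big_pred0// => i; apply/negP => /eqP ij; move: (lev_lt i).
        by rewrite ij ltnNge Lk.
      by apply: eq_bigl => k; rewrite (ltn_trans (ltn_ord k) Lm).
    by apply: eq_bigl => i; rewrite -leqNgt.
  exact: csqD_le.
rewrite big_split/= -!mulr_sumr lerD2l ler_wpM2l//.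
apply: le_trans (low_bound m x).
pose g i := if (m <= lev i)%N then rc (Num.sqrt (lam i)^-1) * psi i x else 0.
have := @bessel_sum R _ _ f g f_orth.
have -> : \sum_a csq (\sum_y f a y * g y) = \sum_a csq (low a).
  apply: eq_bigr => a _; congr csq; rewrite /low [RHS]big_mkcond/=.
  by apply: eq_bigr => i _; rewrite /g; case: ifP => _; [ring|rewrite mulr0].
move=> /le_trans; apply; rewrite [leRHS]big_mkcond/=; apply: ler_sum => i _.
by rewrite /g; case: ifP => _; rewrite ?csq0// csqM csq_sqrt.
Qed.

(** The cut between high and low levels is made separately at each point, where 2^-m is comparable
    to W x. The high part then costs a fixed fraction of N and is absorbed on the left; the low part
    leaves W^(1 + beta). *)
Lemma rumin_bound (W : X -> R) : (forall x, 0 <= W x) ->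
  (forall a, 1 <= \sum_(x | H x) W x * csq (u a x)) ->
  N%:R <= 4 * B * 192 `^ beta * \sum_(x | H x) W x `^ (1 + beta).
Proof.
move=> W0 uW.
have NW : N%:R <= \sum_(x | H x) W x * rho x.
  under eq_bigr do rewrite mulr_sumr.
  rewrite exchange_big/=; apply: (@le_trans _ _ (\sum_(a < N) 1)).
    by rewrite sumr_const card_ord.
  by apply: ler_sum => a _; exact: uW.
(* Chosen so that 2 * eta * 24 = 1/2, with 24 from [high_bound]: half of N is absorbed. The 192 is 2
   / eta, the factor between 2^-m and W x in the worst case. *)
pose eta : R := 96^-1.
have eta0 : 0 < eta by rewrite invr_gt0.
have choose_m x : exists m, W x * rho x <=
    2 * eta * (2^-1 ^+ m * \sum_a csq (high (f a) m x)) +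
    2 * B * 192 `^ beta * W x `^ (1 + beta).
  have S0 m : 0 <= \sum_a csq (high (f a) m x) by apply: sumr_ge0 => a _; exact: csq_ge0.
  have := W0 x; rewrite le_eqVlt => /orP[/eqP <-|Wx0].
    have h1 : 0 <= 2 * eta * (2^-1 ^+ 0 * \sum_a csq (high (f a) 0 x)).
      by rewrite expr0 mul1r mulr_ge0 ?S0// mulr_ge0// ltW.
    have h2 : 0 <= 2 * B * 192 `^ beta * 0 `^ (1 + beta).
      apply: mulr_ge0; last exact: powR_ge0.
      by apply: mulr_ge0; [exact: mulr_ge0|exact: powR_ge0].
    by exists 0%N; rewrite mul0r addr_ge0.
  have PW : W x `^ (1 + beta) = W x * W x `^ beta.
    rewrite powRD; last by rewrite (gt_eqF Wx0) implybT.
    by rewrite powRr1// ltW.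
  have WE : 192 `^ beta * W x `^ beta = (2 * (W x / eta)) `^ beta.
    rewrite -powRM ?ler0n ?(ltW Wx0)//; congr (_ `^ _).
    by rewrite /eta invrK; ring.
  have fin m : (W x <= eta * 2^-1 ^+ m) || (m == 0%N) ->
     2^-1 ^+ m <= 2 * (W x / eta) -> W x * rho x <=
     2 * eta * (2^-1 ^+ m * \sum_a csq (high (f a) m x)) +
      2 * B * 192 `^ beta * W x `^ (1 + beta).
    move=> Wm qm.
    apply: (@le_trans _ _ (W x * (2 * \sum_a csq (high (f a) m x) + 2 * (B * q ^+ m)))).
      by rewrite ler_wpM2l// rho_split.
    rewrite mulrDr; apply: lerD.
      case/orP: Wm => [Wm|/eqP ->].
        rewrite mulrCA -mulrA ler_wpM2l// mulrA ler_wpM2r//.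
      rewrite /high; under eq_bigr do rewrite big_ord0 csq0.
      by rewrite big1_eq !mulr0.
    have -> : W x * (2 * (B * q ^+ m)) = 2 * B * W x * q ^+ m by ring.
    have -> : 2 * B * 192 `^ beta * W x `^ (1 + beta) =
       2 * B * W x * (192 `^ beta * W x `^ beta) by rewrite PW; ring.
    rewrite WE; apply: ler_wpM2l; first by apply: mulr_ge0 => //; exact: mulr_ge0.
    rewrite q_pow.
    by rewrite ge0_ler_powR ?nnegrE ?exprn_ge0 ?invr_ge0 ?(ltW beta0)// mulr_ge0// divr_ge0// ltW.
  (* Where W is large there is no high part at all: for m = 0 [high] is an empty sum, and every
     level counts as low. *)
  have [etaW|Weta] := ltP eta (W x).
    exists 0%N; apply: fin; rewrite ?orbT// expr0.
    apply: (@le_trans _ _ (W x / eta)); first by rewrite ler_pdivlMr// mul1r ltW.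
    by rewrite ler_peMl ?divr_ge0 ?ler1n// ltW.
  have h0 : 0 < 2^-1 :> R by rewrite invr_gt0.
  have h1 : 2^-1 < 1 :> R by rewrite invf_lt1// ltr1n.
  have [m [mW Wm]] := @dyadic_level R _ _ h0 h1 (divr_gt0 Wx0 eta0).
  exists m.
  have Wm' : W x <= eta * 2^-1 ^+ m.
    case: (posnP m) => [->|m0]; first by rewrite expr0 mulr1.
    by rewrite mulrC -ler_pdivrMr// Wm.
  have mW' : 2^-1 ^+ m <= 2 * (W x / eta).
    by move: mW; rewrite exprS -ltr_pdivlMl// invrK => /ltW.
  by apply: fin; rewrite ?Wm'.
pose mm x := projT1 (cid (choose_m x)).
have mmP x : W x * rho x <=
    2 * eta * (2^-1 ^+ (mm x) * \sum_a csq (high (f a) (mm x) x)) +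
    2 * B * 192 `^ beta * W x `^ (1 + beta).
  by rewrite /mm; case: cid.
pose K := (\max_x mm x).+1.
have mmK x : (mm x < K)%N by rewrite ltnS leq_bigmax.
have term x : 2^-1 ^+ (mm x) * \sum_a csq (high (f a) (mm x) x) <=
  \sum_(m < K) 2^-1 ^+ m * \sum_a csq (high (f a) m x).
  rewrite (bigD1 (Ordinal (mmK x)))//= lerDl sumr_ge0// => m _.
  rewrite mulr_ge0 ?exprn_ge0 ?invr_ge0// sumr_ge0// => a _; exact: csq_ge0.
have : N%:R <= 2 * eta * (24 * N%:R) +
    2 * B * 192 `^ beta * \sum_(x | H x) W x `^ (1 + beta).
  apply: (le_trans NW); apply: (@le_trans _ _ (\sum_(x | H x)
    (2 * eta * (\sum_(m < K) 2^-1 ^+ m * \sum_a csq (high (f a) m x)) +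
    2 * B * 192 `^ beta * W x `^ (1 + beta)))).
    apply: ler_sum => x _; apply: (le_trans (mmP x)); rewrite lerD2r.
    by rewrite ler_wpM2l ?mulr_ge0 ?(ltW eta0)// term.
  rewrite big_split/= -!mulr_sumr lerD2r ler_wpM2l ?mulr_ge0 ?(ltW eta0)//.
  rewrite exchange_big/=.
  under eq_bigr do rewrite -mulr_sumr exchange_big/= mulr_sumr.
  rewrite exchange_big/=; apply: (@le_trans _ _ (\sum_(a < N) 24)); last first.
    by rewrite sumr_const card_ord mulr_natr.
  apply: ler_sum => a _; apply: (le_trans (high_bound _ _)).
  have -> : \sum_i csq (f a i) = 1.
    apply: rc_inj; rewrite rc_sum rc1; under eq_bigr do rewrite -mul_conj.
    by rewrite f_orth eqxx.
  by rewrite mulr1.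
set S := \sum_(x | _) _; rewrite /eta; lra.
Qed.

End rumin.

Section lattice_count.
Context {R : realType}.
Local Notation C := (cplx R).

Definition lattice_const (n : nat) (beta : R) : R :=
  4 * (8 * 2 ^+ n / (1 - 2 `^ (- beta))) * 192 `^ beta.

(** The family is replaced by one that is orthonormal for the form of (1 + e) - P. In the eigenbasis
    of [P] its members are lam^(-1/2) f_a with f_a orthonormal, which is what [rumin_bound] takes as
    input. The term with [delta] is a quantitative form of linear independence on the lattice. *)
Theorem lattice_count (n M N : nat) (P : {ffun 'I_n -> 'I_M} -> {ffun 'I_n -> 'I_M} -> C)
    (k0 : 'I_n) (t0 : nat) (e beta s delta : R)
    (W : {ffun 'I_n -> 'I_M} -> R) (u : 'I_N -> {ffun 'I_n -> 'I_M} -> C) :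
  (forall x y, P y x = (P x y)^*) ->
  (forall x y, cmod (P x y) <= hop x y) ->
  0 < e -> e <= 1 -> 0 <= s -> 0 < beta -> beta = n%:R - 2 + s -> 0 < delta ->
  (forall x, 0 <= W x) ->
  (forall c : 'I_N -> C,
    let g x := \sum_j c j * u j x in
    (1 + e) * \sum_x csq (g x) - qf P g <=
      \sum_(x : {ffun 'I_n -> 'I_M} | (x k0 : nat) == t0) W x * csq (g x) - delta * \sum_j csq (c j)) ->
  N%:R <= lattice_const n beta * e `^ (- s / 2) *
    \sum_(x : {ffun 'I_n -> 'I_M} | (x k0 : nat) == t0) W x `^ (1 + beta).
Proof.
move=> Pherm Phop e0 e1 s0 beta0 betaE delta0 W0 ineq.
have [psi [p [orth full PE]]] := hermitian_kernel_spectral Pherm.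
have p1 := @p_le1 R n M P psi p Phop orth PE.
pose lam i : R := 1 - p i + e.
have lam0 i : 0 < lam i by rewrite /lam ltr_wpDl ?subr_ge0 ?p1.
pose ahat j i := \sum_x u j x * (psi i x)^*.
have uE j x : u j x = \sum_i ahat j i * psi i x.
  under eq_bigr do rewrite mulr_suml.
  rewrite exchange_big/=.
  transitivity (\sum_y u j y * \sum_i psi i x * (psi i y)^*).
    rewrite (bigD1 x)//= full eqxx mulr1 big1 ?addr0// => y yx.
    by rewrite full eq_sym (negbTE yx) mulr0.
  by apply: eq_bigr => y _; rewrite mulr_sumr; apply: eq_bigr => i _; ring.
clearbody ahat.
(* The Gram matrix of the family for the form of (1 + e) - P. Its unitary diagonalisation, unlike an
   orthogonalisation step by step, keeps the coefficient vectors of norm 1, so [delta] survives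
   unchanged. *)
pose G j k := \sum_i rc (lam i) * (ahat j i * (ahat k i)^*).
have Gherm j k : G k j = (G j k)^*.
  rewrite /G conj_sum; apply: eq_bigr => i _.
  by rewrite !conjM rc_conj conjCK; ring.
have [chi [gg [chi_orth chi_full GE]]] := hermitian_kernel_spectral Gherm.
pose ghat a i := \sum_j (chi a j)^* * ahat j i.
have ghat_dot a b : \sum_i rc (lam i) * (ghat a i * (ghat b i)^*) =
    rc (gg a) * (a == b)%:R.
  transitivity (\sum_j \sum_k (chi a j)^* * chi b k * G j k).
    rewrite /G.
    under [RHS]eq_bigr do under eq_bigr do rewrite mulr_sumr.
    under [RHS]eq_bigr do rewrite exchange_big/=.
    rewrite [RHS]exchange_big/=; apply: eq_bigr => i _.
    rewrite /ghat mulr_suml mulr_sumr; apply: eq_bigr => j _.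
    rewrite conj_sum !mulr_sumr; apply: eq_bigr => k _.
    by rewrite -/(ahat j i) conjM conjCK; ring.
  transitivity (\sum_d rc (gg d) * ((\sum_j chi d j * (chi a j)^*) *
      (\sum_k chi b k * (chi d k)^*))).
    under eq_bigr do under eq_bigr do rewrite GE mulr_sumr.
    under eq_bigr do rewrite exchange_big/=.
    rewrite exchange_big/=; apply: eq_bigr => d _.
    rewrite mulr_suml mulr_sumr; apply: eq_bigr => j _.
    rewrite !mulr_sumr; apply: eq_bigr => k _; ring.
  rewrite (bigD1 a)//= !chi_orth eqxx mul1r [b == a]eq_sym big1 ?addr0// => d da.
  by rewrite chi_orth (negbTE da) mul0r mulr0.
have chi1 a : \sum_j csq (chi a j) = 1.
  apply: rc_inj; rewrite rc_sum rc1; under eq_bigr do rewrite -mul_conj.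
  by rewrite chi_orth eqxx.
pose ga a x := \sum_i ghat a i * psi i x.
have gaE a x : ga a x = \sum_j (chi a j)^* * u j x.
  rewrite /ga /ghat; under eq_bigr do rewrite mulr_suml.
  rewrite exchange_big/=; apply: eq_bigr => j _; rewrite uE mulr_sumr.
  by apply: eq_bigr => i _; ring.
have ggE a : \sum_i lam i * csq (ghat a i) = gg a.
  apply: rc_inj; rewrite rc_sum.
  have := ghat_dot a a; rewrite eqxx mulr1 => <-.
  by apply: eq_bigr => i _; rewrite mul_conj rcM.
have ineqa a : gg a <= \sum_(x : {ffun 'I_n -> 'I_M} | (x k0 : nat) == t0) W x * csq (ga a x) - delta.
  have := ineq (fun j => (chi a j)^*); rewrite /=.
  have -> : (fun x => \sum_j (chi a j)^* * u j x) = ga a.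
    by apply/funext => x; rewrite gaE.
  have -> : \sum_j csq ((chi a j)^*) = 1.
    by rewrite -(chi1 a); apply: eq_bigr => j _; rewrite csq_conj.
  under eq_bigr do rewrite -gaE.
  under [X in _ <= X - _]eq_bigr do rewrite -gaE.
  have -> : \sum_x csq (ga a x) = \sum_i csq (ghat a i) := csq_expand orth (ghat a).
  have -> : qf P (ga a) = _ := qf_expand orth PE (ghat a).
  rewrite mulr1.
  have -> : (1 + e) * \sum_i csq (ghat a i) - \sum_i p i * csq (ghat a i) = gg a.
    rewrite -ggE mulr_sumr -sumrB; apply: eq_bigr => i _; rewrite /lam; ring.
  by [].
(* If the eigenvalue vanished, [ga a] would vanish on the whole lattice and [ineqa] would read 0 <=
   - delta. *)
have gg0 a : 0 < gg a.
  have ga0 : 0 <= gg a.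
    by rewrite -ggE sumr_ge0// => i _; rewrite mulr_ge0 ?csq_ge0 ?(ltW (lam0 i)).
  rewrite lt_neqAle ga0 andbT eq_sym; apply/eqP => gga.
  have gh0 i : ghat a i = 0.
    apply: csq_eq0; move: gga; rewrite -ggE => /eqP.
    rewrite psumr_eq0; last by move=> k _; rewrite mulr_ge0 ?csq_ge0 ?(ltW (lam0 k)).
    move=> /allP /(_ i); rewrite mem_index_enum => /(_ isT) /=.
    by rewrite mulf_eq0 gt_eqF//= => /eqP.
  have := ineqa a; rewrite gga big1 ?sub0r; first by rewrite leNgt oppr_lt0 delta0.
  move=> x _; rewrite /ga big1 ?csq0 ?mulr0// => i _; by rewrite gh0 mul0r.
pose f a i := rc (Num.sqrt (lam i)) * rc (Num.sqrt (gg a))^-1 * ghat a i.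
have f_orth a b : \sum_i f a i * (f b i)^* = (a == b)%:R.
  transitivity (rc ((Num.sqrt (gg a))^-1 * (Num.sqrt (gg b))^-1) *
      \sum_i rc (lam i) * (ghat a i * (ghat b i)^*)).
    rewrite mulr_sumr; apply: eq_bigr => i _; rewrite /f !conjM !rc_conj.
    have -> : rc (lam i) = rc (Num.sqrt (lam i)) * rc (Num.sqrt (lam i)).
      by rewrite -rcM -expr2 sqr_sqrtr// ltW.
    rewrite rcM; ring.
  rewrite ghat_dot; case: eqP => [->|]; rewrite ?mulr0// mulr1 -rcM -rc1.
  congr rc; rewrite -{3}(sqr_sqrtr (ltW (gg0 b))); field.
  by rewrite gt_eqF// sqrtr_gt0.
have uaE a x : \sum_i rc (Num.sqrt (lam i)^-1) * f a i * psi i x =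
    rc (Num.sqrt (gg a))^-1 * ga a x.
  rewrite /ga mulr_sumr; apply: eq_bigr => i _.
  have : rc (Num.sqrt (lam i)^-1) * rc (Num.sqrt (lam i)) = 1.
    rewrite -rcM sqrtrV ?(ltW (lam0 i))// mulVf ?rc1// gt_eqF// sqrtr_gt0//.
  move=> h; rewrite /f.
  transitivity ((rc (Num.sqrt (lam i)^-1) * rc (Num.sqrt (lam i))) *
     (rc (Num.sqrt (gg a))^-1 * (ghat a i * psi i x))); first ring.
  by rewrite h mul1r.
have uW a : 1 <= \sum_(x : {ffun 'I_n -> 'I_M} | (x k0 : nat) == t0) W x *
    csq (\sum_i rc (Num.sqrt (1 - p i + e)^-1) * f a i * psi i x).
  rewrite -[leLHS](@mulVf _ (gg a)) ?gt_eqF//.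
  under eq_bigr do rewrite uaE csqM csq_rc exprVn sqr_sqrtr ?(ltW (gg0 a))// mulrCA.
  rewrite -mulr_sumr ler_wpM2l ?invr_ge0 ?(ltW (gg0 a))//.
  by apply: (le_trans (ineqa a)); rewrite gerBl ltW.
have := @rumin_bound R n M N P psi p Phop orth full PE e beta s e0 e1 s0 beta0 betaE
  k0 t0 f f_orth W W0 uW.
move/le_trans; apply; rewrite le_eqVlt; apply/orP; left; apply/eqP.
by rewrite /lattice_const; ring.
Qed.

End lattice_count.

(** * Lebesgue measure on boxes and test functions *)

Section boxes.
Context {R : realType}.
Local Notation mu := lebesgue_rV.

(** Half-open, so that the cells of a grid are disjoint and tile a larger box exactly. *)
Definition box n (a b : 'I_n -> R) : set 'rV[R]_n :=
  [set z | forall k, a k <= z ord0 k < b k].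

Lemma measurable_box n (a b : 'I_n -> R) : measurable (box a b).
Proof.
have -> : box a b = \bigcap_(k in [set: 'I_n])
    ((fun z : 'rV[R]_n => z ord0 k) @^-1` `[a k, b k[%classic).
  apply/seteqP; split => z /=.
    by move=> H k _ /=; rewrite in_itv /=; exact: H.
  by move=> H k; have := H k I; rewrite /= in_itv.
apply: fin_bigcap_measurable; first exact: finite_finset.
move=> k _; rewrite -[X in measurable X]setTI.
exact: measurable_coord.
Qed.

Lemma lebesgue_box n (a b : 'I_n -> R) : (forall k, a k <= b k) ->
  mu n (box a b) = (\prod_k (b k - a k))%:E.
Proof.
elim: n a b => [|n IH] a b ab.
  rewrite big_ord0 /= diracE; rewrite mem_set//.
  by move=> [].
rewrite /= /cons_measure.
have -> : @cons_rV R n @^-1` box a b =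
    `[a ord0, b ord0[%classic `*` box (a \o lift ord0) (b \o lift ord0).
  have e0 : @lshift 1 n ord0 = ord0 :> 'I_n.+1 by exact: val_inj.
  have eS (j : 'I_n) : @rshift 1 n j = lift ord0 j :> 'I_n.+1 by exact: val_inj.
  apply/seteqP; split => -[z1 z2] /=.
    move=> H; split.
      by have := H ord0; rewrite -e0 cons_rVl /= in_itv.
    by move=> k /=; have := H (lift ord0 k); rewrite -eS cons_rVr.
  move=> [H0 H] k; case: (@split_ordP 1 n k) => j ->.
    rewrite (ord1 j).
    by rewrite cons_rVl e0 /=; move: H0; rewrite in_itv.
  by rewrite cons_rVr eS; exact: H.
rewrite product_measure1E//=; last exact: measurable_box.
rewrite IH/=; last by move=> k; exact: ab.
rewrite big_ord_recl lebesgue_measure_itv/= lte_fin.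
case: ltP => // ba; rewrite mul0e.
have -> : a ord0 = b ord0 by apply/eqP; rewrite eq_le ab.
by rewrite subrr mul0r.
Qed.

Lemma fin_box n (a b : 'I_n -> R) : (mu n (box a b) < +oo)%E.
Proof.
have [ab|/existsNP[k /negP]] := pselect (forall k, a k <= b k).
  by rewrite lebesgue_box// ltry.
rewrite -ltNge => ba; rewrite (_ : box a b = set0) ?measure0//.
apply/seteqP; split => z //= /(_ k) /andP[h1 h2].
by have := lt_trans (le_lt_trans h1 h2) ba; rewrite ltxx.
Qed.

Definition grid_point n (m : nat) (t : 'I_n -> int) : 'rV[R]_n :=
  \row_k ((t k)%:~R / m.+1%:R).

Definition grid_floor n (m : nat) (z : 'rV[R]_n) : 'I_n -> int :=
  fun k => Num.floor (z ord0 k * m.+1%:R).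

Lemma grid_floor_itv n m (z : 'rV[R]_n) k :
  (grid_floor m z k)%:~R <= z ord0 k * m.+1%:R < (grid_floor m z k)%:~R + 1.
Proof. by have := real_floor_itv (num_real (z ord0 k * m.+1%:R)); rewrite intrD. Qed.

Lemma grid_cvg n (z : 'rV[R]_n) :
  (fun m => grid_point m (grid_floor m z)) @ \oo --> z.
Proof.
apply/cvg_ballP => eps eps0.
near=> m; split=> // i k; rewrite ord1 /= mxE.
have /andP[h1 h2] := grid_floor_itv m z k.
have m0 : 0 < m.+1%:R :> R by rewrite ltr0n.
rewrite /ball/= ger0_norm; last by rewrite subr_ge0 ler_pdivrMr.
apply: (@lt_trans _ _ m.+1%:R^-1); last by near: m; exact: near_infty_natSinv_lt (PosNum eps0).
rewrite -(@ltr_pM2r _ m.+1%:R)// mulrBl divfK ?gt_eqF// mulVf ?gt_eqF//.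
by rewrite ltrBlDl.
Unshelve. all: by end_near. Qed.

Lemma measurable_grid n m (f : 'rV[R]_n -> R) :
  measurable_fun [set: 'rV[R]_n] (fun z => f (grid_point m (grid_floor m z))).
Proof.
move=> _ Y mY; rewrite setTI.
pose cell (t : 'rV[int]_n) := box (fun k => (t ord0 k)%:~R / m.+1%:R)
   (fun k => ((t ord0 k)%:~R + 1) / m.+1%:R).
have m0 : 0 < m.+1%:R :> R by rewrite ltr0n.
rewrite (_ : _ @^-1` Y = \bigcup_(t : 'rV[int]_n)
    (if `[<Y (f (grid_point m (t ord0)))>] then cell t else set0)).
  apply: countable_bigcupT_measurable; first exact: countableP.
  by move=> t; case: ifP => _; [exact: measurable_box|exact: measurable0].
apply/seteqP; split => z /=.
  move=> Yz; exists (\row_k grid_floor m z k) => //=.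
  rewrite ifT; last first.
    apply/asboolP; rewrite (_ : (\row_k _) ord0 = grid_floor m z)//.
    by apply/funext => k; rewrite mxE.
  by move=> k; rewrite mxE ler_pdivrMr// ltr_pdivlMr// grid_floor_itv.
move=> [t _]; case: ifP => // /asboolP Yt zt; rewrite (_ : grid_floor m z = t ord0)//; apply/funext => k.
apply: floor_def; rewrite intrD.
by have := zt k; rewrite ler_pdivrMr// ltr_pdivlMr.
Qed.

(** The sigma-algebra on row vectors is generated by the coordinates, not by the open sets. A
    continuous function is therefore exhibited as a limit of its values at grid points, which are
    constant on countably many boxes. *)
Lemma continuous_measurable_rV n (f : 'rV[R]_n -> R) :
  continuous f -> measurable_fun [set: 'rV[R]_n] f.
Proof.
move=> cf; apply: (@measurable_fun_cvg _ _ _ _ (fun m z => f (grid_point m (grid_floor m z)))).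
  by move=> m; exact: measurable_grid.
move=> z _; apply: continuous_cvg; [exact: cf|exact: grid_cvg].
Qed.

Lemma compact_in_box n (K : set 'rV[R]_n) : compact K ->
  exists2 r, 0 < r & forall z, K z -> forall k, `|z ord0 k| < r.
Proof.
move=> /compact_bounded[M [Mreal HM]].
exists (`|M| + 1 + 1) => [|z Kz k]; first by rewrite !ltr_pwDr.
have H := HM (`|M| + 1) _ z Kz.
apply: (@le_lt_trans _ _ (`|M| + 1)); last by rewrite ltrDl.
apply: le_trans (H _); last by rewrite (le_lt_trans (ler_norm _))// ltrDl.
rewrite [leRHS]mx_normrE.
by rewrite (le_trans _ (le_bigmax _ _ (ord0, k))).
Qed.

End boxes.

Lemma le_sum_term (R : realType) n (F : 'I_n -> R) k :
  (forall i, 0 <= F i) -> F k <= \sum_i F i.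
Proof. by move=> F0; rewrite (bigD1 k)//= lerDl sumr_ge0. Qed.

Section smooth_functions.
Context {R : realType}.
Variable n : nat.
Implicit Types (f g : 'rV[R]_n -> R) (z : 'rV[R]_n).

Lemma smooth_partial f k : smooth f -> smooth (partial k f).
Proof. by move=> sf s; have := sf (rcons s k); rewrite foldr_rcons. Qed.

Lemma smooth_continuous f : smooth f -> continuous f.
Proof. by move=> /(_ [::]) []. Qed.

Lemma smooth_derivable f k z : smooth f -> derivable f z (delta_mx ord0 k).
Proof. by move=> /(_ [::]) [_]; exact. Qed.

Lemma partial_lin f g k (a b : R) z :
  derivable f z (delta_mx ord0 k) -> derivable g z (delta_mx ord0 k) ->
  partial k (fun y => a * f y + b * g y) z = a * partial k f z + b * partial k g z.
Proof.
move=> df dg; rewrite /partial.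
have -> : (fun y => a * f y + b * g y) = (a \*: f) + (b \*: g) by [].
rewrite deriveD; [|exact: derivableZ|exact: derivableZ].
by rewrite (deriveZ a df) (deriveZ b dg).
Qed.

Lemma smooth_lin f g (a b : R) : smooth f -> smooth g ->
  smooth (fun y => a * f y + b * g y).
Proof.
move=> sf sg s.
have -> : foldr (@partial R n) (fun y => a * f y + b * g y) s =
    fun y => a * foldr (@partial R n) f s y + b * foldr (@partial R n) g s y.
  elim: s => [//|k s IH] /=; rewrite IH; apply/funext => z.
  by apply: partial_lin; [case: (sf s) => _; exact|case: (sg s) => _; exact].
have [cf df] := sf s; have [cg dg] := sg s; split => /=.
  move=> z; apply: (@continuousD _ _ _ (fun y => a * foldr (@partial R n) f s y)
    (fun y => b * foldr (@partial R n) g s y));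
    apply: continuousM; [exact: cst_continuous|exact: cf|
                         exact: cst_continuous|exact: cg].
move=> k z; have -> : (fun y => a * foldr (@partial R n) f s y +
    b * foldr (@partial R n) g s y) =
   (a \*: foldr (@partial R n) f s) + (b \*: foldr (@partial R n) g s) by [].
by apply: derivableD; apply: derivableZ; [exact: df|exact: dg].
Qed.

Definition vanish_off (K : set 'rV[R]_n) f := forall z, ~ K z -> f z = 0.

Lemma partial_vanish (K : set 'rV[R]_n) f k : closed K ->
  vanish_off K f -> vanish_off K (partial k f).
Proof.
move=> cK fK z Kz; rewrite /partial.
rewrite (@near_eq_derive _ _ _ f (cst 0)) ?derive_cst//.
have : open (~` K) by rewrite openC.
rewrite openE => /(_ z Kz); apply: filterS => y /= Ky.
by rewrite fK.
Qed.

Lemma vanish_bounded (K : set 'rV[R]_n) f : compact K -> continuous f ->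
  vanish_off K f -> exists2 B, 0 <= B & forall z, `|f z| <= B.
Proof.
move=> cK cf fK.
have /compact_bounded[M [_ HM]] : compact (f @` K).
  by apply: continuous_compact => //; exact: continuous_subspaceT.
exists (`|M| + 1) => [|z]; first by rewrite addr_ge0.
have [Kz|nKz] := pselect (K z); last by rewrite fK// normr0 addr_ge0.
by apply: (HM (`|M| + 1)); [rewrite (le_lt_trans (ler_norm _))// ltrDl|exists z].
Qed.

Definition coord_close (h : R) z z' := forall k, `|z' ord0 k - z ord0 k| <= h.

Lemma line_mvt f z k (t : R) : smooth f -> exists2 xi : R, `|xi| <= `|t| &
  f (z + t *: delta_mx ord0 k) - f z = t * partial k f (z + xi *: delta_mx ord0 k).
Proof.
move=> sf; pose phi (x : R) := f (z + x *: delta_mx ord0 k).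
have dphi (x : R) : is_derive x (1 : R) phi (partial k f (z + x *: delta_mx ord0 k)).
  have E : (fun h : R => h^-1 *: ((phi \o shift x) (h *: 1) - phi x)) =
     (fun h : R => h^-1 *: ((f \o shift (z + x *: delta_mx ord0 k))
       (h *: delta_mx ord0 k) - f (z + x *: delta_mx ord0 k))).
    apply/funext => h; rewrite /= /phi; congr (_ *: (f _ - _)).
    by rewrite scalerDl [h *: 1]mulr1 addrCA.
  apply: DeriveDef; rewrite /derivable /derive E//.
  exact: smooth_derivable.
have mvt a b : a <= b -> exists2 c, a <= c <= b &
    phi b - phi a = partial k f (z + c *: delta_mx ord0 k) * (b - a).
  move=> ab.
  have [c] := @MVT_segment R phi (fun x => partial k f (z + x *: delta_mx ord0 k)) a b ab
    (fun x _ => dphi x) (derivable_within_continuous (fun x _ => @ex_derive _ _ _ _ _ _ _ (dphi x))).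
  by rewrite in_itv /= => abc cE; exists c.
have phi0 : phi 0 = f z by rewrite /phi scale0r addr0.
have [t0|t0] := leP 0 t.
  have [c /andP[c0 ct] cE] := mvt _ _ t0.
  exists c; first by rewrite !ger0_norm.
  by rewrite -phi0 -[f _]/(phi t) cE subr0 mulrC.
have [c /andP[tc c0] cE] := mvt _ _ (ltW t0).
exists c; first by rewrite !ler0_norm ?lerN2// ltW.
by rewrite -phi0 -[f _]/(phi t) -opprB cE sub0r mulrN opprK mulrC.
Qed.

(** [smooth] speaks of partial derivatives only, so the path from z to z' follows the axes, with the
    mean value theorem on each segment. The intermediate points stay within h of z in every
    coordinate. *)
Lemma coord_mvt f (h : R) z z' : smooth f -> 0 <= h -> coord_close h z z' ->
  exists p : 'I_n -> 'rV[R]_n, (forall k, coord_close h z (p k)) /\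
    f z' - f z = \sum_k (z' ord0 k - z ord0 k) * partial k f (p k).
Proof.
move=> sf h0 zz'.
pose w (m : nat) : 'rV[R]_n := \row_k (if (k < m)%N then z' ord0 k else z ord0 k).
have wS (m : 'I_n) : w m.+1 = w m + (z' ord0 m - z ord0 m) *: delta_mx ord0 m.
  apply/rowP => k; rewrite !mxE /= ltnS leq_eqVlt -(inj_eq val_inj) /=.
  case: eqVneq => [/val_inj ->|km] /=; first by rewrite ltnn mulr1 subrKC.
  by rewrite mulr0 addr0.
have step (m : 'I_n) : exists p : 'rV[R]_n, coord_close h z p /\
    f (w m.+1) - f (w m) = (z' ord0 m - z ord0 m) * partial m f p.
  have [xi xit xiE] := line_mvt (w m) m (z' ord0 m - z ord0 m) sf.
  exists (w m + xi *: delta_mx ord0 m); split; last by rewrite wS.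
  move=> k; rewrite !mxE /=.
  have [->|km] := eqVneq k m.
    by rewrite ltnn mulr1 addrAC subrr add0r (le_trans xit).
  by rewrite mulr0 addr0; case: ifP => _; rewrite ?subrr ?normr0.
have [p pP] := choice step.
exists p; split; first by move=> k; exact: (pP k).1.
have -> : f z' - f z = (f \o w) n - (f \o w) 0%N.
  by congr (f _ - f _); apply/rowP => k; rewrite mxE ?ltn_ord.
rewrite -(telescope_sumr (f \o w) (leq0n n)) big_mkord; apply: eq_bigr => m _.
exact: (pP m).2.
Qed.

Lemma smooth_bounds (K : set 'rV[R]_n) f : compact K -> closed K -> smooth f ->
  vanish_off K f -> exists2 B, 0 <= B &
  [/\ forall z, `|f z| <= B, forall k z, `|partial k f z| <= B &
   forall h z z', 0 <= h -> coord_close h z z' ->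
    [/\ `|f z' - f z| <= B * h,
     forall k, `|partial k f z' - partial k f z| <= B * h &
     `|f z' - f z - \sum_k (z' ord0 k - z ord0 k) * partial k f z| <= B * h ^+ 2]].
Proof.
move=> cK clK sf fK.
have [B0 B00 HB0] := vanish_bounded cK (smooth_continuous sf) fK.
have ex1 k : exists2 B, 0 <= B & forall z, `|partial k f z| <= B.
  apply: (vanish_bounded cK); first by apply: smooth_continuous; exact: smooth_partial.
  exact: partial_vanish.
have ex2 k l : exists2 B, 0 <= B & forall z, `|partial l (partial k f) z| <= B.
  apply: (vanish_bounded cK).
    by apply: smooth_continuous; do 2! apply: smooth_partial.
  by do 2! apply: partial_vanish => //.
pose B1 k := projT1 (cid2 (ex1 k)).
have B1P k : 0 <= B1 k /\ forall z, `|partial k f z| <= B1 k by rewrite /B1; case: cid2.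
pose B2 k l := projT1 (cid2 (ex2 k l)).
have B2P k l : 0 <= B2 k l /\ forall z, `|partial l (partial k f) z| <= B2 k l.
  by rewrite /B2; case: cid2.
pose S1 := \sum_k B1 k; pose S2 := \sum_k \sum_l B2 k l.
have S10 : 0 <= S1 by apply: sumr_ge0 => k _; case: (B1P k).
have S2k k : 0 <= \sum_l B2 k l by apply: sumr_ge0 => l _; case: (B2P k l).
have S20 : 0 <= S2 by apply: sumr_ge0 => k _.
have lip g (b : 'I_n -> R) h z z' : smooth g -> (forall k y, `|partial k g y| <= b k) ->
    0 <= h -> coord_close h z z' -> `|g z' - g z| <= (\sum_k b k) * h.
  move=> sg gb h0 zz'; have [p [_ ->]] := coord_mvt sg h0 zz'.
  rewrite (le_trans (ler_norm_sum _ _ _))// mulr_suml; apply: ler_sum => k _.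
  by rewrite normrM mulrC ler_pM.
have lip2 k h z z' : 0 <= h -> coord_close h z z' ->
    `|partial k f z' - partial k f z| <= (\sum_l B2 k l) * h.
  by move=> h0; apply: lip => //; [exact: smooth_partial|move=> l y; case: (B2P k l)].
have S1k k : B1 k <= S1 by apply: le_sum_term => i; case: (B1P i).
have S2kS k : \sum_l B2 k l <= S2.
  exact: (@le_sum_term R n (fun k => \sum_l B2 k l)).
have S1E : \sum_k B1 k = S1 by [].
have S2E : \sum_k \sum_l B2 k l = S2 by [].
clearbody S1 S2.
exists (B0 + S1 + S2); first by rewrite !addr_ge0.
split=> [z|k z|h z z' h0 zz'].
- by apply: (le_trans (HB0 z)); lra.
- by apply: (le_trans ((B1P k).2 z)); have := S1k k; lra.
- split=> [|k|].
  + apply: (le_trans (lip f B1 h z z' sf (fun k => (B1P k).2) h0 zz')).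
    by rewrite ler_wpM2r// S1E; lra.
  + apply: (le_trans (lip2 k h z z' h0 zz')); rewrite ler_wpM2r//.
    by have := S2kS k; lra.
  + have [p [pz ->]] := coord_mvt sf h0 zz'.
    rewrite -sumrB (le_trans (ler_norm_sum _ _ _))//.
    apply: (@le_trans _ _ (\sum_k (\sum_l B2 k l) * h ^+ 2)).
      apply: ler_sum => k _; rewrite -mulrBr normrM expr2 mulrA mulrC.
      by rewrite ler_pM//; exact: lip2.
    by rewrite -mulr_suml ler_wpM2r ?exprn_ge0// S2E; lra.
Qed.

End smooth_functions.

(** * Bounds for families of test functions, uniform in the coefficients *)

Section test_functions.
Context {R : realType}.
Local Notation C := (cplx R).

Lemma cauchy_sum (I : finType) (a b : I -> R) :
  (\sum_i a i * b i) ^+ 2 <= (\sum_i a i ^+ 2) * (\sum_i b i ^+ 2).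
Proof.
have : 0 <= \sum_i \sum_j (a i * b j - a j * b i) ^+ 2.
  by apply: sumr_ge0 => i _; apply: sumr_ge0 => j _; exact: sqr_ge0.
have -> : \sum_i \sum_j (a i * b j - a j * b i) ^+ 2 =
    \sum_i \sum_j (a i ^+ 2 * b j ^+ 2 + a j ^+ 2 * b i ^+ 2
       - 2 * ((a i * b i) * (a j * b j))).
  by apply: eq_bigr => i _; apply: eq_bigr => j _; ring.
under eq_bigr do rewrite sumrB big_split/= -!mulr_sumr -mulr_suml.
rewrite sumrB big_split/= -!mulr_suml -!mulr_sumr -mulr_suml expr2; lra.
Qed.

Lemma csq_sum_le (I : finType) (c w : I -> C) :
  csq (\sum_i c i * w i) <= (\sum_i csq (c i)) * \sum_i csq (w i).
Proof.
apply: (@le_trans _ _ ((\sum_i cmod (c i) * cmod (w i)) ^+ 2)).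
  rewrite -cmod_sq lerXn2r ?nnegrE ?cmod_ge0//.
    by apply: sumr_ge0 => i _; rewrite mulr_ge0 ?cmod_ge0.
  by apply: (le_trans (cmod_sum _ _ _)); apply: ler_sum => i _; rewrite cmodM.
apply: (le_trans (cauchy_sum _ _)).
by rewrite le_eqVlt; apply/orP; left; apply/eqP; congr (_ * _);
  apply: eq_bigr => i _; rewrite cmod_sq.
Qed.

Definition ci : C := 'i%C.
Lemma re_ci : re ci = 0. Proof. by []. Qed.
Lemma im_ci : im ci = 1. Proof. by []. Qed.
Lemma csq_ci : csq ci = 1. Proof. by rewrite /csq re_ci im_ci expr0n expr1n add0r. Qed.

Section dim.
Variable n : nat.
Implicit Types (u w : 'rV[R]_n -> C).

Definition cgrad u (k : 'I_n) z : C :=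
  (partial k (re \o u) z +i* partial k (im \o u) z)%C.

(** The factor -i of the momentum is pulled out, so that the covariant derivative becomes grad u - i
    A u. *)
Lemma momentum_csq u (k : 'I_n) z (a : R) :
  normc (momentum u k z - (a%:C)%C * u z) ^+ 2 =
  csq (cgrad u k z - ci * rc a * u z).
Proof.
rewrite (_ : normc _ ^+ 2 =
    csq (- ci * cgrad u k z - rc a * u z)); last by rewrite -cmod_sq.
have -> : - ci * cgrad u k z - rc a * u z = - ci * (cgrad u k z - ci * rc a * u z).
  by apply: cplx_eq; rewrite !reimE re_ci im_ci; ring.
by rewrite csqM csqN csq_ci mul1r.
Qed.

Let test_smooth u : @test_function R n u -> smooth (re \o u) /\ smooth (im \o u).
Proof. by case. Qed.

Let partial_lin_smooth (f g : 'rV[R]_n -> R) k (a b : R) z : smooth f -> smooth g ->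
  partial k (fun y => a * f y + b * g y) z = a * partial k f z + b * partial k g z.
Proof. by move=> sf sg; apply: partial_lin; exact: smooth_derivable. Qed.

Lemma cgrad_lin u w (a b : C) k z : test_function u -> test_function w ->
  cgrad (fun z => a * u z + b * w z) k z = a * cgrad u k z + b * cgrad w k z.
Proof.
move=> /test_smooth[su1 su2] /test_smooth[sw1 sw2].
have l1 := smooth_lin (re a) (- im a) su1 su2.
have l2 := smooth_lin (re b) (- im b) sw1 sw2.
have l3 := smooth_lin (re a) (im a) su2 su1.
have l4 := smooth_lin (re b) (im b) sw2 sw1.
have -> : a * cgrad u k z + b * cgrad w k z =
  ((1 * (re a * partial k (re \o u) z + - im a * partial k (im \o u) z) +
   1 * (re b * partial k (re \o w) z + - im b * partial k (im \o w) z)) +i*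
  (1 * (re a * partial k (im \o u) z + im a * partial k (re \o u) z) +
   1 * (re b * partial k (im \o w) z + im b * partial k (re \o w) z)))%C.
  apply: cplx_eq; rewrite !reimE /cgrad /re/= /im/=; ring.
rewrite /cgrad; congr (_ +i* _)%C.
  rewrite (_ : re \o _ = fun z => 1 * (re a * re (u z) + - im a * im (u z)) +
     1 * (re b * re (w z) + - im b * im (w z))); last first.
    by apply/funext => y /=; rewrite !reimE; ring.
  by have := @partial_lin_smooth _ _ k 1 1 z l1 l2; rewrite (@partial_lin_smooth _ _ k _ _ z su1 su2) (@partial_lin_smooth _ _ k _ _ z sw1 sw2).
rewrite (_ : im \o _ = fun z => 1 * (re a * im (u z) + im a * re (u z)) +
   1 * (re b * im (w z) + im b * re (w z))); last first.
  by apply/funext => y /=; rewrite !reimE; ring.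
by have := @partial_lin_smooth _ _ k 1 1 z l3 l4; rewrite (@partial_lin_smooth _ _ k _ _ z su2 su1) (@partial_lin_smooth _ _ k _ _ z sw2 sw1).
Qed.

Lemma test_function_lin u w (a b : C) : test_function u -> test_function w ->
  @test_function R n (fun z => a * u z + b * w z).
Proof.
move=> /[dup] tu /test_smooth[su1 su2] /[dup] tw /test_smooth[sw1 sw2].
have l1 := smooth_lin (re a) (- im a) su1 su2.
have l2 := smooth_lin (re b) (- im b) sw1 sw2.
have l3 := smooth_lin (re a) (im a) su2 su1.
have l4 := smooth_lin (re b) (im b) sw2 sw1.
split.
- have := smooth_lin 1 1 l1 l2; congr smooth; apply/funext => y /=.
  by rewrite -[LHS]/(_ : R) -[RHS]/(re _) !reimE; ring.
- have := smooth_lin 1 1 l3 l4; congr smooth; apply/funext => y /=.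
  by rewrite -[RHS]/(im _) !reimE; ring.
- case: tu => _ _ cu; case: tw => _ _ cw.
  have := compactU cu cw; rewrite -closureU => cuw.
  apply: (subclosed_compact _ cuw); first exact: closed_closure.
  apply: closureS => z /=.
  apply: contraPP => /not_orP[/negP/negPn/eqP -> /negP/negPn/eqP ->].
  by apply/negP/negPn/eqP; exact: (etrans (congr2 _ (mulr0 a) (mulr0 b)) (addr0 _)).
Qed.

Lemma test_function0 : @test_function R n (fun _ => 0).
Proof.
have sm0 : smooth (fun _ : 'rV[R]_n => 0 : R).
  move=> s; have -> : foldr (@partial R n) (fun=> 0) s = cst 0.
    by elim: s => //= k s ->; apply/funext => z; rewrite /partial derive_cst.
  by split; [move=> z; exact: cst_continuous|move=> k z; exact: derivable_cst].
split; [exact: sm0|exact: sm0|].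
rewrite (_ : [set x | _] = set0) ?closure0; first exact: compact0.
by apply/seteqP; split => z //=; rewrite eqxx.
Qed.

Lemma test_function_sum N (u : 'I_N -> 'rV[R]_n -> C) (c : 'I_N -> C) :
  (forall j, test_function (u j)) ->
  @test_function R n (fun z => \sum_j c j * u j z) /\
  forall k z, cgrad (fun z => \sum_j c j * u j z) k z = \sum_j c j * cgrad (u j) k z.
Proof.
elim: N u c => [|N IH] u c tu.
  have E : (fun z : 'rV[R]_n => \sum_(j < 0) c j * u j z) = fun=> 0.
    by apply/funext => z; rewrite big_ord0.
  rewrite E; split; first exact: test_function0.
  by move=> k z; rewrite big_ord0 /cgrad /partial -!/(cst _) !derive_cst.
pose u' j := u (lift ord0 j); pose c' j := c (lift ord0 j).
have [t1 g1] := IH u' c' (fun j => tu _).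
have E : (fun z => \sum_j c j * u j z) =
   fun z => c ord0 * u ord0 z + 1 * \sum_j c' j * u' j z.
  by apply/funext => z; rewrite big_ord_recl mul1r.
rewrite E; split; first exact: test_function_lin.
by move=> k z; rewrite cgrad_lin// g1 big_ord_recl mul1r.
Qed.

(** The bounds are for squared moduli: in this form they scale by the sum of [csq (c j)] when
    functions are combined, which is the quantity multiplied by [delta] in the counting theorems. *)
Definition taylor_bound (B h : R) u := forall z z', coord_close h z z' ->
  [/\ csq (u z' - u z) <= B * h ^+ 2,
     forall k, csq (cgrad u k z' - cgrad u k z) <= B * h ^+ 2 &
     csq (u z' - u z - \sum_k rc (z' ord0 k - z ord0 k) * cgrad u k z)
       <= B * h ^+ 4].

Definition test_bound (B : R) u := [/\ forall z, csq (u z) <= B,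
  forall k z, csq (cgrad u k z) <= B & forall h, 0 <= h -> taylor_bound B h u].

Lemma test_function_bounds u : test_function u -> exists2 B, 0 <= B & test_bound B u.
Proof.
move=> /[dup] tu /test_smooth[su1 su2]; case: tu => _ _ cu.
set K := closure _ in cu.
have cK : closed K by exact: closed_closure.
have uK z : ~ K z -> u z = 0.
  by move=> nK; apply/eqP/negPn/negP => uz; apply: nK; exact: subset_closure.
have v1 : vanish_off K (re \o u) by move=> z /uK /= ->.
have v2 : vanish_off K (im \o u) by move=> z /uK /= ->.
have [B1 B10 [a1 b1 c1]] := smooth_bounds cu cK su1 v1.
have [B2 B20 [a2 b2 c2]] := smooth_bounds cu cK su2 v2.
have sqb (x B : R) : `|x| <= B -> x ^+ 2 <= B ^+ 2.
  by move=> xB; rewrite -real_normK ?num_real// lerXn2r ?nnegrE ?(le_trans _ xB).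
have sqh (x B h : R) j : `|x| <= B * h ^+ j -> x ^+ 2 <= B ^+ 2 * h ^+ j.*2.
  by move=> /sqb; rewrite exprMn -exprM muln2.
exists (B1 ^+ 2 + B2 ^+ 2); first by rewrite addr_ge0 ?sqr_ge0.
split=> [z|k z|h h0 z z' zz'].
- by apply: lerD; apply: sqb; [exact: a1|exact: a2].
- by apply: lerD; apply: sqb; [exact: b1|exact: b2].
- have [x1 y1 t1] := c1 h z z' h0 zz'; have [x2 y2 t2] := c2 h z z' h0 zz'.
  split=> [|k|].
  + by rewrite mulrDl; apply: lerD; rewrite !reimE; apply: (@sqh _ _ _ 1%N);
      rewrite expr1; [exact: x1|exact: x2].
  + by rewrite mulrDl; apply: lerD; rewrite !reimE; apply: (@sqh _ _ _ 1%N);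
      rewrite expr1; [exact: y1|exact: y2].
  + rewrite mulrDl; apply: lerD; rewrite !reimE ?re_sum ?im_sum;
      apply: (@sqh _ _ _ 2%N).
      move: t1; congr (`| _ - _ | <= _); apply: eq_bigr => k _.
      by rewrite re_rcM.
    move: t2; congr (`| _ - _ | <= _); apply: eq_bigr => k _.
    by rewrite im_rcM.
Qed.

(** One mesh must serve all coefficient vectors at once, hence a single [B] chosen before [c]. *)
Lemma test_family_bounds N (u : 'I_N -> 'rV[R]_n -> C) :
  (forall j, test_function (u j)) -> exists2 B, 0 <= B &
  forall c : 'I_N -> C,
    test_bound (B * \sum_j csq (c j)) (fun z => \sum_j c j * u j z).
Proof.
move=> tu.
have [B HB] := choice (fun j => (let: ex_intro2 B B0 BP := test_function_bounds (tu j)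
   in ex_intro _ B (conj B0 BP))).
have B0 j : 0 <= B j by case: (HB j).
exists (\sum_j B j); first exact: sumr_ge0.
move=> c; have [_ gE] := test_function_sum c tu.
have S0 : 0 <= \sum_j csq (c j) by apply: sumr_ge0 => j _; exact: csq_ge0.
have key (w : 'I_N -> C) (x : R) : (forall j, csq (w j) <= B j * x) ->
    csq (\sum_j c j * w j) <= (\sum_j B j) * (\sum_j csq (c j)) * x.
  move=> wB; apply: (le_trans (csq_sum_le _ _)).
  rewrite mulrAC mulrC ler_wpM2r// mulr_suml; exact: ler_sum.
split=> [z|k z|h h0 z z' zz'].
- by rewrite -[leRHS]mulr1; apply: key => j; rewrite mulr1; case: (HB j) => _ [].
- by rewrite -[leRHS]mulr1 gE; apply: key => j; rewrite mulr1; case: (HB j) => _ [].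
- have H j : taylor_bound (B j) h (u j) by case: (HB j) => _ [_ _]; apply.
  split=> [|k|].
  + rewrite -sumrB; under eq_bigr do rewrite -mulrBr.
    by apply: key => j; case: (H j _ _ zz').
  + rewrite !gE -sumrB; under eq_bigr do rewrite -mulrBr.
    by apply: key => j; case: (H j _ _ zz').
  + have -> : \sum_j c j * u j z' - \sum_j c j * u j z -
        \sum_k rc (z' ord0 k - z ord0 k) * cgrad (fun z => \sum_j c j * u j z) k z =
      \sum_j c j * (u j z' - u j z -
        \sum_k rc (z' ord0 k - z ord0 k) * cgrad (u j) k z).
      under [RHS]eq_bigr do rewrite !mulrBr mulr_sumr.
      rewrite !sumrB; congr (_ - _).
      rewrite exchange_big/=; apply: eq_bigr => k _.
      by rewrite gE mulr_sumr; apply: eq_bigr => j _; ring.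
    by apply: key => j; case: (H j _ _ zz').
Qed.

Lemma test_function_support u : test_function u -> exists2 r, 0 < r &
  forall z : 'rV[R]_n, (exists k, r <= `|z ord0 k|) -> u z = 0 /\ forall k, cgrad u k z = 0.
Proof.
move=> /[dup] tu /test_smooth[su1 su2]; case: tu => _ _ cu.
set K := closure _ in cu.
have cK : closed K by exact: closed_closure.
have uK z : ~ K z -> u z = 0.
  by move=> nK; apply/eqP/negPn/negP => uz; apply: nK; exact: subset_closure.
have v1 : vanish_off K (re \o u) by move=> z /uK /= ->.
have v2 : vanish_off K (im \o u) by move=> z /uK /= ->.
have [r r0 rK] := compact_in_box cu.
exists r => // z [k rz]; have nK : ~ K z.
  by move=> Kz; have := rK _ Kz k; rewrite ltNge rz.
split; first exact: uK.
by move=> l; apply: cplx_eq; [exact: (partial_vanish l cK v1)|exact: (partial_vanish l cK v2)].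
Qed.

Lemma test_family_support N (u : 'I_N -> 'rV[R]_n -> C) :
  (forall j, test_function (u j)) -> exists2 r, 0 < r &
  forall (c : 'I_N -> C) (z : 'rV[R]_n), (exists k, r <= `|z ord0 k|) ->
    \sum_j c j * u j z = 0 /\ forall k, cgrad (fun z => \sum_j c j * u j z) k z = 0.
Proof.
move=> tu.
have [r Hr] := choice (fun j => (let: ex_intro2 r r0 rP := test_function_support (tu j)
   in ex_intro _ r (conj r0 rP))).
exists (1 + \sum_j r j).
  by rewrite ltr_pwDl// sumr_ge0// => j _; case: (Hr j) => /ltW.
move=> c z [k rz]; have [_ gE] := test_function_sum c tu.
have z0 j : u j z = 0 /\ forall k, cgrad (u j) k z = 0.
  apply: (Hr j).2; exists k; apply: le_trans rz.
  rewrite (bigD1 j)//= addrCA lerDl addr_ge0// sumr_ge0// => i _.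
  by case: (Hr i) => /ltW.
split; first by rewrite big1// => j _; rewrite (z0 j).1 mulr0.
by move=> l; rewrite gE big1// => j _; rewrite (z0 j).2 mulr0.
Qed.

End dim.
End test_functions.

(** * Lattice links and covariant derivatives *)

Section link_variables.
Context {R : realType}.
Local Notation C := (cplx R).

(* Cayley transform: a unimodular substitute for [exp (- i theta)] *)
Definition phase (theta : R) : C :=
  let t := theta / 2 in ((1 - t ^+ 2) / (1 + t ^+ 2) +i* (- (2 * t) / (1 + t ^+ 2)))%C.

Let den (t : R) : 0 < 1 + t ^+ 2.
Proof. by rewrite ltr_pwDl// sqr_ge0. Qed.

Lemma csq_phase theta : csq (phase theta) = 1.
Proof.
rewrite /csq /re /im /=; move: (theta / 2) => t.
by field; rewrite gt_eqF// den.
Qed.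

Lemma phaseN theta : phase (- theta) = (phase theta)^*.
Proof.
have e : - theta / 2 = - (theta / 2) by field.
apply: cplx_eq; rewrite !reimE /phase /re /im /= e; move: (theta / 2) => t.
  by rewrite sqrrN.
by field; rewrite gt_eqF// den.
Qed.

Lemma csq_phase_err theta :
  csq (phase theta - 1 + ci * rc theta) <= theta ^+ 4.
Proof.
have -> : theta = 2 * (theta / 2) by field.
rewrite /csq !reimE re_ci im_ci /phase /re /im /= (_ : 2 * (theta / 2) / 2 = theta / 2); last by field.
move: (theta / 2) => t; have d0 := den t.
rewrite (_ : _ + _ ^+ 2 = 4 * t ^+ 4 / (1 + t ^+ 2)); last by field; rewrite gt_eqF.
rewrite ler_pdivrMr// exprMn.
have t0 : 0 <= t ^+ 2 by exact: sqr_ge0.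
have -> : t ^+ 4 = (t ^+ 2) ^+ 2 by rewrite -exprM.
move: (t ^+ 2) t0 => x x0; have -> : 2 ^+ 4 = 16 :> R by rewrite -natrX.
have := sqr_ge0 x; nra.
Qed.

Lemma csq_split (tau : R) (z w : C) : 0 < tau ->
  csq (z + w) <= (1 + tau) * csq z + (1 + tau^-1) * csq w.
Proof.
move=> t0; rewrite -subr_ge0 /csq !reimE.
have -> : (1 + tau) * (re z ^+ 2 + im z ^+ 2) + (1 + tau^-1) * (re w ^+ 2 + im w ^+ 2)
   - ((re z + re w) ^+ 2 + (im z + im w) ^+ 2) =
   tau * ((re z - re w / tau) ^+ 2 + (im z - im w / tau) ^+ 2).
  by field; rewrite gt_eqF.
by rewrite mulr_ge0 ?addr_ge0 ?sqr_ge0// ltW.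
Qed.

(** [csq_split] with weight h: a perturbation of squared size h^2 costs a relative error h and an
    absolute error of order h, both of which vanish with the mesh. *)
Lemma csq_split_small (h E : R) (z w : C) : 0 < h -> h <= 1 ->
  csq w <= E * h ^+ 2 -> csq (z + w) <= (1 + h) * csq z + 2 * E * h.
Proof.
move=> h0 h1 wE; apply: (le_trans (csq_split z w h0)); rewrite lerD2l.
have E0 : 0 <= E.
  by have := le_trans (csq_ge0 w) wE; rewrite pmulr_lge0// exprn_gt0.
apply: (@le_trans _ _ ((1 + h^-1) * (E * h ^+ 2))).
  by rewrite ler_wpM2l// addr_ge0// invr_ge0 ltW.
have -> : (1 + h^-1) * (E * h ^+ 2) = E * h * (h + 1) by field; rewrite gt_eqF.
have : 0 <= E * h by rewrite mulr_ge0// ltW.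
nra.
Qed.

Lemma csq_avg (z w : C) :
  csq (rc 2^-1 * (z + w)) <= 2^-1 * (csq z + csq w).
Proof.
rewrite csqM csq_rc; have := csqD_le z w.
have -> : 2^-1 ^+ 2 = 4^-1 :> R by rewrite exprVn -natrX.
lra.
Qed.

Lemma csqD3_le (x y z : C) : csq (x + y + z) <= 3 * (csq x + csq y + csq z).
Proof.
rewrite /csq !reimE.
have := sqr_ge0 (re x - re y); have := sqr_ge0 (re x - re z); have := sqr_ge0 (re y - re z).
have := sqr_ge0 (im x - im y); have := sqr_ge0 (im x - im z); have := sqr_ge0 (im y - im z).
nra.
Qed.

Definition link_const (n : nat) (a : R) : R :=
  let N2 := (n%:R * a) ^+ 2 in
  6 * (N2 ^+ 2 + 1 + N2) + 4 * (n%:R ^+ 2 * (2 + 2 * a ^+ 2)).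

(** The potentials at the two ends are bounded but need not be close to each other, as A is merely
    measurable. The angle uses their mean, and convexity of the square splits it into a term with
    the potential of x and one with the potential of y. In the second one the function and its
    gradient, which do vary slowly, are moved from x to y, so that each end carries its own
    potential. *)
Lemma link_estimate (n : nat) (gx gy : C) (Dx Dy : 'I_n -> C) (ax ay sigma : 'I_n -> R)
    (a B h theta : R) :
  0 < h -> h <= 1 -> 0 <= B -> 0 <= a ->
  (forall k, sigma k ^+ 2 = 1) -> (forall k, `|ax k| <= a) -> (forall k, `|ay k| <= a) ->
  csq gy <= B -> csq (gy - gx) <= B * h ^+ 2 ->
  (forall k, csq (Dy k - Dx k) <= B * h ^+ 2) ->
  csq (gy - gx - \sum_k rc (h * sigma k) * Dx k) <= B * h ^+ 4 ->
  theta = \sum_k h * sigma k * ((ax k + ay k) / 2) ->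
  csq (gx - phase theta * gy) <=
    h ^+ 2 * (1 + h) ^+ 2 * 2^-1 *
      (csq (\sum_k rc (sigma k) * (Dx k - ci * rc (ax k) * gx)) +
       csq (\sum_k rc (sigma k) * (Dy k - ci * rc (ay k) * gy)))
    + B * h ^+ 3 * link_const n a.
Proof.
move=> h0 h1 B0 a0 sig2 axa aya gyB gB DB TB thetaE.
pose m k := (ax k + ay k) / 2.
have ma k : m k ^+ 2 <= a ^+ 2.
  rewrite -real_normK ?num_real// lerXn2r ?nnegrE//.
  rewrite /m normrM [`|2^-1|]gtr0_norm ?invr_gt0// ler_pdivrMr//.
  by apply: (le_trans (ler_normD _ _)); have := axa k; have := aya k; lra.
pose N2 := (n%:R * a) ^+ 2.
have N20 : 0 <= N2 by exact: sqr_ge0.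
have th2 : theta ^+ 2 <= h ^+ 2 * N2.
  have -> : theta = h * \sum_k sigma k * m k.
    by rewrite thetaE mulr_sumr; apply: eq_bigr => k _; rewrite -mulrA.
  rewrite exprMn ler_wpM2l ?sqr_ge0//; apply: (le_trans (cauchy_sum _ _)).
  under eq_bigr do rewrite sig2.
  rewrite sumr_const card_ord /N2 exprMn expr2 -mulrA ler_wpM2l//.
  apply: (@le_trans _ _ (\sum_(k < n) a ^+ 2)); first exact: ler_sum.
  by rewrite sumr_const card_ord mulr_natl.
pose Zm k := Dx k - ci * rc (m k) * gx.
pose Zx k := Dx k - ci * rc (ax k) * gx.
pose Zy k := Dy k - ci * rc (ay k) * gy.
(* The mixed term: data at x with the potential at y. [Zm] is the mean of [Zx] and [Zp], and [Zp]
   differs from [Zy] by Taylor errors only. *)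
pose Zp k := Dx k - ci * rc (ay k) * gx.
pose S (Z : 'I_n -> C) := \sum_k rc (sigma k) * Z k.
have SE (Z : 'I_n -> C) : csq (S Z) <= n%:R * \sum_k csq (Z k).
  apply: (le_trans (csq_sum_le _ _)); rewrite ler_wpM2r ?sumr_ge0// => [k _|].
    exact: csq_ge0.
  by under eq_bigr do rewrite csq_rc sig2; rewrite sumr_const card_ord.
(* [err] collects the terms of order [h ^ 2] *)
pose err := (phase theta - 1 + ci * rc theta) * gy +
   (gy - gx - \sum_k rc (h * sigma k) * Dx k) + (- (ci * rc theta) * (gy - gx)).
have e1 : phase theta * gy - gx = rc h * S Zm + err.
  have -> : rc h * S Zm = \sum_k rc (h * sigma k) * Dx k - ci * rc theta * gx.
    rewrite /S /Zm thetaE rc_sum mulr_sumr [ci * _]mulr_sumr mulr_suml -sumrB.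
    by apply: eq_bigr => k _; rewrite -/(m k) !rcM; ring.
  rewrite /err; ring.
pose K1 := 3 * (N2 ^+ 2 + 1 + N2).
have errB : csq err <= B * K1 * h ^+ 2 * h ^+ 2.
  apply: (le_trans (csqD3_le _ _ _)); rewrite !csqM csqN csqM csq_ci csq_rc mul1r.
  have t4 : theta ^+ 4 <= (h ^+ 2 * N2) ^+ 2.
    have -> : theta ^+ 4 = (theta ^+ 2) ^+ 2 by rewrite -exprM.
    apply: lerXn2r => //; rewrite nnegrE; first exact: sqr_ge0.
    by apply: mulr_ge0 => //; exact: sqr_ge0.
  have q1 : csq (phase theta - 1 + ci * rc theta) * csq gy <= (h ^+ 2 * N2) ^+ 2 * B.
    by apply: ler_pM; rewrite ?csq_ge0// (le_trans (csq_phase_err _)).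
  have q3 : theta ^+ 2 * csq (gy - gx) <= (h ^+ 2 * N2) * (B * h ^+ 2).
    by apply: ler_pM; rewrite ?csq_ge0 ?sqr_ge0.
  have -> : B * K1 * h ^+ 2 * h ^+ 2 = 3 * ((h ^+ 2 * N2) ^+ 2 * B + B * h ^+ 4 +
     (h ^+ 2 * N2) * (B * h ^+ 2)) by rewrite /K1; ring.
  by rewrite ler_pM2l// lerD// lerD.
have K10 : 0 <= K1 by rewrite /K1 mulr_ge0// !addr_ge0// sqr_ge0.
have st1 : csq (gx - phase theta * gy) <=
    (1 + h) * (h ^+ 2 * csq (S Zm)) + 2 * (B * K1 * h ^+ 2) * h.
  have := @csq_split_small h (B * K1 * h ^+ 2) (rc h * S Zm) err h0 h1 errB.
  by rewrite csqM csq_rc -e1 -csqN opprB.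
have ZmE : S Zm = rc 2^-1 * (S Zx + S Zp).
  rewrite /S -big_split/= mulr_sumr; apply: eq_bigr => k _.
  rewrite /Zm /Zx /Zp /m !rcM rcD.
  have -> : rc 2^-1 * (rc (sigma k) * (Dx k - ci * rc (ax k) * gx) +
     rc (sigma k) * (Dx k - ci * rc (ay k) * gx)) = (rc 2^-1 + rc 2^-1) * (rc (sigma k) * Dx k)
     - rc 2^-1 * (rc (sigma k) * (ci * (rc (ax k) + rc (ay k)) * gx)) by ring.
  have -> : rc 2^-1 + rc 2^-1 = 1 :> C.
    by rewrite -rcD (_ : 2^-1 + 2^-1 = 1 :> R) ?rc1//; field.
  ring.
pose K2 := n%:R ^+ 2 * (2 + 2 * a ^+ 2).
have K20 : 0 <= K2 by rewrite mulr_ge0 ?sqr_ge0// addr_ge0// mulr_ge0 ?sqr_ge0.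
have st2 : csq (S Zp) <= (1 + h) * csq (S Zy) + 2 * (B * K2) * h.
  have -> : S Zp = S Zy + S (fun k => Zp k - Zy k).
    by rewrite /S -big_split/=; apply: eq_bigr => k _; ring.
  apply: csq_split_small => //; apply: (le_trans (SE _)).
  have -> : B * K2 * h ^+ 2 = n%:R * \sum_(k < n) (2 + 2 * a ^+ 2) * (B * h ^+ 2).
    by rewrite sumr_const card_ord -mulr_natl /K2; ring.
  rewrite ler_wpM2l//; apply: ler_sum => k _.
  have -> : Zp k - Zy k = - (Dy k - Dx k) + ci * rc (ay k) * (gy - gx).
    by rewrite /Zp /Zy; ring.
  apply: (le_trans (csqD_le _ _)); rewrite csqN !csqM csq_ci csq_rc mul1r [leRHS]mulrDl.
  apply: lerD; first by rewrite ler_pM2l.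
  rewrite -mulrA ler_pM2l//; apply: ler_pM; rewrite ?csq_ge0 ?sqr_ge0//.
  by rewrite -real_normK ?num_real// lerXn2r ?nnegrE.
have st3 : csq (S Zm) <= 2^-1 * ((1 + h) * (csq (S Zx) + csq (S Zy)) + 2 * (B * K2) * h).
  rewrite ZmE; apply: (le_trans (csq_avg _ _)); rewrite ler_pM2l ?invr_gt0//.
  have := csq_ge0 (S Zx); move: st2; nra.
apply: (le_trans st1).
rewrite -/(S Zx) -/(S Zy).
have hh : (1 + h) * (h ^+ 2 * csq (S Zm)) <= (1 + h) * (h ^+ 2 *
   (2^-1 * ((1 + h) * (csq (S Zx) + csq (S Zy)) + 2 * (B * K2) * h))).
  by rewrite ler_wpM2l ?addr_ge0 ?(ltW h0)// ler_wpM2l ?sqr_ge0.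
apply: (le_trans (lerD hh (lexx _))).
rewrite /link_const -/N2 -/K2.
have -> : 6 * (N2 ^+ 2 + 1 + N2) = 2 * K1 by rewrite /K1; ring.
rewrite -subr_ge0.
have -> : h ^+ 2 * (1 + h) ^+ 2 / 2 * (csq (S Zx) + csq (S Zy)) +
  B * h ^+ 3 * (2 * K1 + 4 * K2) -
  ((1 + h) * (h ^+ 2 * (2^-1 * ((1 + h) * (csq (S Zx) + csq (S Zy)) + 2 * (B * K2) * h)))
   + 2 * (B * K1 * h ^+ 2) * h) = B * K2 * h ^+ 3 * (3 - h) by field.
apply: mulr_ge0; last lra.
by apply: mulr_ge0; [exact: mulr_ge0|rewrite exprn_ge0// ltW].
Qed.

End link_variables.

Section lattice_form.
Context {R : realType}.
Local Notation C := (cplx R).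
Variables (n M : nat).
Local Notation X := {ffun 'I_n -> 'I_M}.
Implicit Types (x y : X) (g : X -> C).

(** Expanding the square gives the Dirichlet form of the magnetic walk: |U| = 1 removes the phase
    from the diagonal terms, and the symmetry of [hop] makes these equal. *)
Lemma qf_phase_identity (U : X -> X -> C) g : (forall x y, csq (U x y) = 1) ->
  \sum_x csq (g x) * (\sum_y hop x y) - qf (fun x y => rc (hop x y) * U x y) g =
  2^-1 * \sum_x \sum_y hop x y * csq (g x - U x y * g y).
Proof.
move=> U1.
have E : \sum_x \sum_y hop x y * csq (g x - U x y * g y) =
   \sum_x \sum_y hop x y * csq (g x) + \sum_x \sum_y hop x y * csq (g y) -
   2 * qf (fun x y => rc (hop x y) * U x y) g.
  rewrite /qf re_sum mulr_sumr -big_split/= -sumrB; apply: eq_bigr => x _.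
  rewrite re_sum mulr_sumr -big_split/= -sumrB; apply: eq_bigr => y _.
  rewrite csqB csqM U1 mul1r -2!mulrA re_rcM mulrBr mulrDr.
  congr (_ + _ - _); rewrite mulrCA; congr (_ * (_ * _)).
  by rewrite mulrA -re_conj conjM conjCK mulrC.
rewrite E [X in _ + X - _]exchange_big/=.
under [X in _ + X - _]eq_bigr do under eq_bigr do rewrite hopC.
have -> : \sum_x csq (g x) * (\sum_y hop x y) = \sum_x \sum_y hop x y * csq (g x).
  by apply: eq_bigr => x _; rewrite mulr_sumr; apply: eq_bigr => y _; rewrite mulrC.
by field.
Qed.

Lemma step_sum_eq (i : 'I_M) (phi : int -> R) : (0 < i)%N -> (i.+1 < M)%N ->
  \sum_(j < M) step i j * phi j%:Z = 2^-1 * (phi ((i : nat)%:Z - 1) + phi ((i : nat)%:Z + 1)).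
Proof.
move=> i0 iM; have i1M : (i.-1 < M)%N by lia.
pose j1 := Ordinal i1M; pose j2 := Ordinal iM.
have j12 : j2 != j1 by rewrite -val_eqE /=; lia.
rewrite (bigD1 j1)//= (bigD1 j2)//= big1 ?addr0; last first.
  move=> j /andP[jj1 jj2]; move: jj1 jj2; rewrite -!val_eqE /= => jj1 jj2.
  by rewrite /step ifF ?mul0r//; apply/negbTE/norP; split; apply/eqP; lia.
rewrite /step !ifT ?eqxx ?orbT//=; last by apply/orP; left; apply/eqP; lia.
by rewrite -mulrDr; congr (_ * (phi _ + phi _)); lia.
Qed.

Definition interior x := forall k, (0 < x k)%N /\ ((x k).+1 < M)%N.

Lemma hop_sum_eq x (phi : 'I_n -> int -> R) : interior x ->
  \sum_y hop x y * \prod_k phi k (y k : nat)%:Z =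
  \prod_k (2^-1 * (phi k ((x k : nat)%:Z - 1) + phi k ((x k : nat)%:Z + 1))).
Proof.
move=> xi.
have -> : \sum_y hop x y * \prod_k phi k (y k : nat)%:Z =
    \sum_(y : X) \prod_k (step (x k) (y k) * phi k (y k : nat)%:Z).
  by apply: eq_bigr => y _; rewrite big_split.
rewrite -(bigA_distr_bigA (fun k (j : 'I_M) => step (x k) j * phi k (j : nat)%:Z))/=.
by apply: eq_bigr => k _; case: (xi k) => ? ?; exact: step_sum_eq.
Qed.

Lemma hop_sum1 x : interior x -> \sum_y hop x y = 1 :> R.
Proof.
move=> xi; have := @hop_sum_eq x (fun _ _ => 1) xi.
have -> : \prod_(k < n) (2^-1 * (1 + 1)) = 1 :> R.
  by rewrite big1// => k _; field.
move=> <-; apply: eq_bigr => y _; by rewrite big1 ?mulr1.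
Qed.

Lemma hop_neighbour x y k : hop x y != 0 :> R ->
  ((y k)%:R - (x k)%:R : R) ^+ 2 = 1.
Proof.
rewrite /hop => /prodf_neq0 /(_ k isT); rewrite /step.
case: ifP => [|_]; last by rewrite eqxx.
by case/orP => /eqP -> _; rewrite -natr1; ring.
Qed.

(** At an interior point the increments of distinct coordinates are independent with mean 0 and
    variance 1. Their covariance is the identity, so the diagonal moves still reproduce the sum of
    the squared components. *)
Lemma hop_isotropic x (Z : 'I_n -> C) : interior x ->
  \sum_y hop x y * csq (\sum_k rc ((y k)%:R - (x k)%:R) * Z k) = \sum_k csq (Z k).
Proof.
move=> xi.
have E y : csq (\sum_k rc ((y k)%:R - (x k)%:R) * Z k) =
   \sum_k \sum_l re (Z k * (Z l)^*) * (((y k)%:R - (x k)%:R) * ((y l)%:R - (x l)%:R)).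
  rewrite -[LHS]re_rc -mul_conj conj_sum mulr_suml re_sum; apply: eq_bigr => k _.
  rewrite mulr_sumr re_sum; apply: eq_bigr => l _.
  by rewrite conjM rc_conj mulrACA -rcM re_rcM mulrC.
have cov k l : \sum_y hop x y * (((y k)%:R - (x k)%:R) * ((y l)%:R - (x l)%:R))
    = (k == l)%:R :> R.
  pose phi k m (j : int) : R := if m == k then j%:~R - (x k)%:R else 1.
  have := @hop_sum_eq x (fun m j => phi k m j * phi l m j) xi.
  have -> : \sum_y hop x y * \prod_m (phi k m (y m : nat)%:Z * phi l m (y m : nat)%:Z) =
     \sum_y hop x y * (((y k)%:R - (x k)%:R) * ((y l)%:R - (x l)%:R)) :> R.
    apply: eq_bigr => y _; congr (_ * _); rewrite big_split/=; congr (_ * _).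
      by rewrite /phi (@prod_single _ _ k (fun m => (y m : nat)%:~R - (x k)%:R)).
    by rewrite /phi (@prod_single _ _ l (fun m => (y m : nat)%:~R - (x l)%:R)).
  move=> ->.
  have xpm m : (((x m : nat)%:Z - 1)%:~R - (x m)%:R = -1 :> R) /\
     (((x m : nat)%:Z + 1)%:~R - (x m)%:R = 1 :> R).
    by rewrite intrB intrD /=; split; ring.
  have [<-|kl] := eqVneq k l.
    rewrite big1// => m _; rewrite /phi; case: eqP => [->|_]; last by field.
    by case: (xpm k) => -> ->; field.
  rewrite (bigD1 k)//= /phi eqxx (negbTE kl) !mulr1.
  by case: (xpm k) => -> ->; rewrite addNr mulr0 mul0r.
under eq_bigr do rewrite E mulr_sumr.
rewrite exchange_big/=; apply: eq_bigr => k _.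
under eq_bigr do rewrite mulr_sumr.
rewrite exchange_big/=.
under eq_bigr do under eq_bigr do rewrite mulrCA.
under eq_bigr do rewrite -mulr_sumr cov.
rewrite (bigD1 k)//= eqxx mulr1 big1 ?addr0 ?mul_conj ?re_rc// => l lk.
by rewrite eq_sym (negbTE lk) mulr0.
Qed.

End lattice_form.

(** * Integrals of real functions and Jensen's inequality *)

Section real_integrals.
Context d (T : measurableType d) (R : realType).
Variable mu : {measure set T -> \bar R}.
Implicit Types (D : set T) (f g : T -> R).

Definition rint D f := mu.-integrable D (EFin \o f).

Lemma rintD D f g : measurable D -> rint D f -> rint D g -> rint D (fun x => f x + g x).
Proof. by move=> mD If Ig; have := integrableD mD If Ig. Qed.

Lemma rintZ D k f : measurable D -> rint D f -> rint D (fun x => k * f x).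
Proof. by move=> mD If; have := integrableZl mD k If. Qed.

Lemma rintB D f g : measurable D -> rint D f -> rint D g -> rint D (fun x => f x - g x).
Proof. by move=> mD If Ig; have := integrableB mD If Ig. Qed.

Lemma rint_bounded D f (B : R) : measurable D -> (mu D < +oo)%E ->
  measurable_fun D f -> (forall x, D x -> `|f x| <= B) -> rint D f.
Proof.
move=> mD fD mf fB; apply: measurable_bounded_integrable => //.
exists B; split; first exact: num_real.
by move=> M BM x Dx /=; rewrite (le_trans (fB x Dx))// ltW.
Qed.

Lemma rint_cst D (c : R) : measurable D -> (mu D < +oo)%E -> rint D (fun=> c).
Proof. by move=> mD fD; apply: (@rint_bounded _ _ `|c|). Qed.

Lemma rint_mul_bounded D f g (B : R) : measurable D -> rint D f ->
  measurable_fun D g -> (forall x, D x -> `|g x| <= B) -> rint D (fun x => f x * g x).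
Proof.
move=> mD If mg gB; have mf : measurable_fun D f.
  by apply/measurable_EFinP; exact: measurable_int If.
have := integrableZl mD B If; apply: le_integrable => //.
  by apply/measurable_EFinP; exact: measurable_funM.
move=> x Dx /=; rewrite lee_fin !normrM mulrC ler_wpM2r//.
by rewrite (le_trans (gB x Dx))// ler_norm.
Qed.

Lemma rint_sum D (I : Type) (s : seq I) (F : I -> T -> R) : measurable D ->
  (forall i, rint D (F i)) -> rint D (fun x => \sum_(i <- s) F i x).
Proof.
move=> mD IF; elim: s => [|i s IH].
  apply: (eq_integrable mD (cst 0%E)); first by move=> x _; rewrite /= big_nil.
  exact: integrable0.
have -> : (fun x => \sum_(i <- i :: s) F i x) = fun x => F i x + \sum_(i <- s) F i x.
  by apply/funext => x; rewrite big_cons.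
exact: rintD.
Qed.

Lemma Rintegral_sum D (I : Type) (s : seq I) (F : I -> T -> R) : measurable D ->
  (forall i, rint D (F i)) ->
  \int[mu]_(x in D) (\sum_(i <- s) F i x) = \sum_(i <- s) \int[mu]_(x in D) F i x.
Proof.
move=> mD IF; elim: s => [|i s IH].
  rewrite big_nil; under eq_Rintegral do rewrite big_nil.
  by rewrite Rintegral_cst// mul0r.
rewrite big_cons -IH -RintegralD//; [|exact: IF|exact: rint_sum].
by apply: eq_Rintegral => x _; rewrite big_cons.
Qed.

Lemma Rintegral_cells (I : finType) (F : I -> set T) D f :
  (forall i, measurable (F i)) -> (forall i j, i != j -> F i `&` F j = set0) ->
  D = \bigcup_(i in [set: I]) F i -> rint D f ->
  \int[mu]_(x in D) f x = \sum_i \int[mu]_(x in F i) f x.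
Proof.
move=> mF tF DE If.
have DE' : D = \big[setU/set0]_(i <- index_enum I) F i.
  rewrite DE -bigcup_seq; apply: eq_bigcupl; split => i //= _.
  by rewrite mem_index_enum.
have FD i : F i `<=` D by rewrite DE => x Fx; exists i.
have mD : measurable D.
  by rewrite DE' ; apply: bigsetU_measurable => i _.
have Ifi i : rint (F i) f by apply: integrableS If => //; exact: FD.
rewrite /Rintegral {1}DE' integral_bigsetU_EFin//=.
- transitivity (fine (\sum_i (\int[mu]_(x in F i) f x)%:E)%E).
    congr fine; apply: eq_bigr => i _; rewrite /Rintegral fineK//.
    by apply: integrable_fin_num => //; exact: Ifi.
  by rewrite sumEFin.
- exact: index_enum_uniq.
- by apply/trivIsetP => i j _ _ /tF.
- by rewrite -DE'; exact: measurable_int If.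
Qed.

Lemma avg_sqr_le D f (m : R) : measurable D -> mu D = m%:E -> 0 < m ->
  rint D f -> rint D (fun x => f x ^+ 2) ->
  m * (m^-1 * \int[mu]_(x in D) f x) ^+ 2 <= \int[mu]_(x in D) (f x ^+ 2).
Proof.
move=> mD muD m0 If If2; set c := m^-1 * _.
have fD : (mu D < +oo)%E by rewrite muD ltry.
have : 0 <= \int[mu]_(x in D) (f x ^+ 2 - (2 * c) * f x + c ^+ 2).
  apply: Rintegral_ge0 => x _.
  by rewrite (_ : _ + _ = (f x - c) ^+ 2) ?sqr_ge0//; ring.
rewrite RintegralD//; last 2 first.
  exact: rintB (rintZ _ _ _).
  exact: rint_cst.
rewrite RintegralB//; last exact: rintZ.
rewrite RintegralZl// Rintegral_cst// muD/=.
have -> : \int[mu]_(x in D) f x = m * c by rewrite /c mulrA divff ?mul1r// gt_eqF.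
set I2 := \int[mu]_(x in D) _; lra.
Qed.

Lemma avg_csq_le D f (m : R) (z w : cplx R) : measurable D -> mu D = m%:E -> 0 < m ->
  rint D f -> rint D (fun x => f x ^+ 2) ->
  m * csq (z - ci * rc (m^-1 * \int[mu]_(x in D) f x) * w) <=
    \int[mu]_(x in D) csq (z - ci * rc (f x) * w).
Proof.
move=> mD muD m0 If If2.
have fD : (mu D < +oo)%E by rewrite muD ltry.
have E a : csq (z - ci * rc a * w) = csq w * a ^+ 2 - (2 * re (z * (ci * w)^*)) * a + csq z.
  rewrite csqB !csqM csq_ci csq_rc mul1r.
  have -> : z * (ci * rc a * w)^* = rc a * (z * (ci * w)^*).
    by rewrite !conjM rc_conj; ring.
  by rewrite re_rcM; ring.
have -> : (fun x => csq (z - ci * rc (f x) * w)) =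
   fun x => csq w * f x ^+ 2 - (2 * re (z * (ci * w)^*)) * f x + csq z.
  by apply/funext => x; rewrite E.
rewrite E RintegralD//; last 2 first.
  by apply: rintB => //; exact: rintZ.
  exact: rint_cst.
rewrite RintegralB//; [|exact: rintZ|exact: rintZ].
rewrite !RintegralZl// Rintegral_cst// muD/=.
have := avg_sqr_le mD muD m0 If If2; set c := m^-1 * _.
have -> : \int[mu]_(x in D) f x = m * c by rewrite /c mulrA divff ?mul1r// gt_eqF.
move=> /(ler_wpM2l (csq_ge0 w)); lra.
Qed.

(** Jensen's inequality, from integrating Young's inequality for f and the constant c^(p-1), where c
    is the average of f. *)
Lemma avg_powR_le D f (m p : R) : measurable D -> mu D = m%:E -> 0 < m -> 1 < p ->
  (forall x, 0 <= f x) -> rint D f -> rint D (fun x => f x `^ p) ->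
  m * (m^-1 * \int[mu]_(x in D) f x) `^ p <= \int[mu]_(x in D) (f x `^ p).
Proof.
move=> mD muD m0 p1 f0 If Ifp; set c := m^-1 * _.
have p0 : 0 < p by rewrite (lt_trans ltr01).
have IE : \int[mu]_(x in D) f x = m * c by rewrite /c mulrA divff ?mul1r// gt_eqF.
have c0 : 0 <= c.
  by rewrite /c mulr_ge0 ?invr_ge0 ?(ltW m0)//; apply: Rintegral_ge0 => x _.
pose q := p / (p - 1).
have q0 : 0 < q by rewrite divr_gt0// subr_gt0.
have pq : p^-1 + q^-1 = 1 by rewrite /q; field; rewrite subr_eq0 !gt_eqF.
have cq : (c `^ (p - 1)) `^ q = c `^ p.
  by rewrite -powRrM; congr (_ `^ _); rewrite /q; field; rewrite subr_eq0 gt_eqF.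
have cc : c * c `^ (p - 1) = c `^ p by rewrite mulr_powRB1// ?(lt_trans ltr01).
have fD : (mu D < +oo)%E by rewrite muD ltry.
have : \int[mu]_(x in D) (c `^ (p - 1) * f x) <=
    \int[mu]_(x in D) (p^-1 * f x `^ p + c `^ p / q).
  apply: le_Rintegral => //.
  - exact: rintZ.
  - by apply: rintD => //; [exact: rintZ|exact: rint_cst].
  - move=> x _; rewrite mulrC [p^-1 * _]mulrC -cq.
    by apply: conjugate_powR => //; exact: powR_ge0.
rewrite RintegralD//; last 2 first.
  exact: rintZ.
  exact: rint_cst.
rewrite RintegralZl// [X in _ <= X + _]RintegralZl// Rintegral_cst// muD/= IE.
have -> : c `^ (p - 1) * (m * c) = m * c `^ p by rewrite -cc; ring.
set I := \int[mu]_(x in D) _; set cp := c `^ p.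
have -> : cp / q * m = m * cp - p^-1 * (m * cp).
  by rewrite (_ : q^-1 = 1 - p^-1); [ring|rewrite -pq; ring].
move=> H; rewrite -(@ler_pM2l _ p^-1) ?invr_gt0//; lra.
Qed.

End real_integrals.

(** * Lattice nodes and cells *)

Section cells.
Context {R : realType}.
Variables (n : nat) (h : R) (Lam : nat).
Hypothesis h0 : 0 < h.
Local Notation M := (Lam.*2).
Local Notation X := {ffun 'I_n -> 'I_M}.
Local Notation mu := (lebesgue_rV n).
Implicit Types (x y : X).

(** The index [Lam] corresponds to the coordinate 0, so that the hyperplane y = 0 consists of
    lattice nodes for every mesh. A node is the lower corner of its cell. *)
Definition node x : 'rV[R]_n := \row_k (h * ((x k)%:R - Lam%:R)).

Definition cell x : set 'rV[R]_n :=
  box (fun k => h * ((x k)%:R - Lam%:R)) (fun k => h * ((x k)%:R - Lam%:R) + h).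

Definition window : set 'rV[R]_n :=
  box (fun _ => - (h * Lam%:R)) (fun _ => h * Lam%:R).

Lemma measurable_cell x : measurable (cell x).
Proof. exact: measurable_box. Qed.

Lemma measurable_window : measurable window.
Proof. exact: measurable_box. Qed.

Lemma lebesgue_cell x : mu (cell x) = (h ^+ n)%:E.
Proof.
rewrite lebesgue_box; last by move=> k; rewrite lerDl ltW.
by under eq_bigr do rewrite addrAC subrr add0r; rewrite prodr_const card_ord.
Qed.

Lemma cell_close x z : cell x z -> coord_close h (node x) z.
Proof.
move=> xz k; rewrite mxE; have /andP[z1 z2] := xz k.
by rewrite ger0_norm ?subr_ge0// lerBlDl ltW.
Qed.

Lemma node_close x y : (forall k, ((y k)%:R - (x k)%:R : R) ^+ 2 = 1) ->
  coord_close h (node x) (node y).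
Proof.
move=> xy k; rewrite !mxE -mulrBr.
rewrite (_ : (_ - _ - (_ - _)) = (y k)%:R - (x k)%:R); last by ring.
rewrite normrM gtr0_norm// ler_piMr ?(ltW h0)//.
rewrite -(@ler_pXn2r _ 2) ?nnegrE// expr1n real_normK ?num_real// xy//.
Qed.

Lemma cell_disjoint x y : x != y -> cell x `&` cell y = set0.
Proof.
move=> xy; apply/seteqP; split => z //= [xz yz].
move/eqP: xy; apply; apply/ffunP => k; apply/val_inj => /=.
have /andP[x1 x2] := xz k; have /andP[y1 y2] := yz k.
have lt_ (i j : nat) : h * (i%:R - Lam%:R) <= z ord0 k -> z ord0 k < h * (j%:R - Lam%:R) + h ->
    (i <= j)%N.
  move=> a b; rewrite -ltnS -(ltr_nat R) -natr1.
  have := le_lt_trans a b; rewrite -[X in _ < _ + X]mulr1 -mulrDr ltr_pM2l//; lra.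
by apply/eqP; rewrite eqn_leq (lt_ _ _ x1 y2) (lt_ _ _ y1 x2).
Qed.

Lemma window_cells : window = \bigcup_(x in [set: X]) cell x.
Proof.
apply/seteqP; split => z /=.
  move=> Wz.
  have ex k : exists i : 'I_M, h * (i%:R - Lam%:R) <= z ord0 k < h * (i%:R - Lam%:R) + h.
    have /andP[z1 z2] := Wz k.
    pose f := Num.floor (z ord0 k / h + Lam%:R).
    have /andP[f1 f2] := real_floor_itv (num_real (z ord0 k / h + Lam%:R)).
    rewrite -/f in f1 f2.
    have zh : - Lam%:R <= z ord0 k / h by rewrite ler_pdivlMr// mulNr mulrC.
    have zh2 : z ord0 k / h < Lam%:R by rewrite ltr_pdivrMr// mulrC.
    have f0 : 0 <= f.
      rewrite floor_ge_int; lra.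
    have fM : (`|f| < M)%N.
      rewrite -(ltr_nat R) natr_absz ger0_norm// -addnn natrD.
      by apply: le_lt_trans f1 _; lra.
    exists (Ordinal fM) => /=; rewrite natr_absz ger0_norm//.
    move: f1 f2; rewrite intrD.
    set fr := f%:~R => f1 f2.
    have -> : h * (fr - Lam%:R) + h = h * (fr - Lam%:R + 1) by ring.
    have -> : z ord0 k = h * (z ord0 k / h) by rewrite mulrC divfK// gt_eqF.
    by rewrite ler_pM2l// ltr_pM2l//; apply/andP; split; lra.
  have [x xP] := choice ex; exists [ffun k => x k] => // k.
  by rewrite ffunE.
move=> [x _ xz] k; have /andP[x1 x2] := xz k.
have lx : 0 <= (x k)%:R :> R by [].
have lM : (x k)%:R + 1 <= Lam%:R + Lam%:R :> R by rewrite natr1 -natrD addnn ler_nat.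
apply/andP; split.
  by apply: le_trans x1; rewrite -mulrN ler_pM2l//; lra.
apply: (lt_le_trans x2); rewrite -[X in _ + X]mulr1 -mulrDr ler_pM2l//; lra.
Qed.

Lemma fin_window : (mu window < +oo)%E. Proof. exact: fin_box. Qed.

Lemma fin_cell x : (mu (cell x) < +oo)%E. Proof. exact: fin_box. Qed.

Lemma cell_window x : cell x `<=` window.
Proof. by rewrite window_cells => z xz; exists x. Qed.

Lemma Rintegral_window f : rint mu window f ->
  \int[mu]_(z in window) f z = \sum_x \int[mu]_(z in cell x) f z.
Proof.
apply: Rintegral_cells; first exact: measurable_cell.
  exact: cell_disjoint.
exact: window_cells.
Qed.

Lemma rint_cell f x : rint mu window f -> rint mu (cell x) f.
Proof.
move=> If; apply: integrableS If; [exact: measurable_window|exact: measurable_cell|].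
exact: cell_window.
Qed.

Definition cell_avg (f : 'rV[R]_n -> R) x : R :=
  (h ^+ n)^-1 * \int[mu]_(z in cell x) f z.

Lemma card_cells : (#|X|%:R : R) * h ^+ n = (2 * (h * Lam%:R)) ^+ n.
Proof.
rewrite card_ffun !card_ord natrX -exprMn; congr (_ ^+ _).
by rewrite -addnn natrD; ring.
Qed.

Lemma lebesgue_window : mu window = ((2 * (h * Lam%:R)) ^+ n)%:E.
Proof.
have hL : 0 <= h * Lam%:R by rewrite mulr_ge0// ltW.
rewrite lebesgue_box; last by move=> k; rewrite (le_trans _ hL)// oppr_le0.
rewrite prodr_const card_ord; congr (_ ^+ _)%:E; ring.
Qed.

Lemma Rintegral_cell_cst x (c : R) : \int[mu]_(z in cell x) c = h ^+ n * c.
Proof.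
rewrite Rintegral_cst; last exact: measurable_cell.
by rewrite mulrC; congr (_ * _); exact: (congr1 fine (lebesgue_cell x)).
Qed.

End cells.

(** * Comparison of the lattice form with the magnetic form *)

Section discretisation.
Context {R : realType}.
Local Notation C := (cplx R).

Section measurability.
Variables (n : nat) (u : 'rV[R]_n -> C).
Hypothesis tu : test_function u.

Lemma measurable_re_test : measurable_fun [set: 'rV[R]_n] (re \o u).
Proof. by apply: continuous_measurable_rV; apply: smooth_continuous; case: tu. Qed.

Lemma measurable_im_test : measurable_fun [set: 'rV[R]_n] (im \o u).
Proof. by apply: continuous_measurable_rV; apply: smooth_continuous; case: tu. Qed.

Lemma measurable_re_cgrad k : measurable_fun [set: 'rV[R]_n] (re \o cgrad u k).
Proof.
apply: (@continuous_measurable_rV _ _ (partial k (re \o u))).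
by apply: smooth_continuous; apply: smooth_partial; case: tu.
Qed.

Lemma measurable_im_cgrad k : measurable_fun [set: 'rV[R]_n] (im \o cgrad u k).
Proof.
apply: (@continuous_measurable_rV _ _ (partial k (im \o u))).
by apply: smooth_continuous; apply: smooth_partial; case: tu.
Qed.

Lemma measurable_csq_test : measurable_fun [set: 'rV[R]_n] (fun z => csq (u z)).
Proof.
apply: measurable_funD; apply: measurable_funX.
  exact: measurable_re_test.
exact: measurable_im_test.
Qed.

Lemma measurable_csq_kinetic (A : 'rV[R]_n -> R) k : measurable_fun [set: 'rV[R]_n] A ->
  measurable_fun [set: 'rV[R]_n] (fun z => csq (cgrad u k z - ci * rc (A z) * u z)).
Proof.
move=> mA.
have -> : (fun z => csq (cgrad u k z - ci * rc (A z) * u z)) =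
  fun z => (re (cgrad u k z) + A z * im (u z)) ^+ 2 + (im (cgrad u k z) - A z * re (u z)) ^+ 2.
  by apply/funext => z; rewrite /csq !reimE re_ci im_ci; congr (_ ^+ _ + _ ^+ _); ring.
apply: measurable_funD; apply: measurable_funX.
  apply: measurable_funD; first exact: measurable_re_cgrad.
  by apply: measurable_funM => //; exact: measurable_im_test.
apply: measurable_funB; first exact: measurable_im_cgrad.
by apply: measurable_funM => //; exact: measurable_re_test.
Qed.

Lemma measurable_csq_cst_kinetic (A : 'rV[R]_n -> R) (z w : C) :
  measurable_fun [set: 'rV[R]_n] A ->
  measurable_fun [set: 'rV[R]_n] (fun x => csq (z - ci * rc (A x) * w)).
Proof.
move=> mA.
have -> : (fun x => csq (z - ci * rc (A x) * w)) =
  fun x => (re z + A x * im w) ^+ 2 + (im z - A x * re w) ^+ 2.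
  by apply/funext => x; rewrite /csq !reimE re_ci im_ci; congr (_ ^+ _ + _ ^+ _); ring.
apply: measurable_funD; apply: measurable_funX.
  apply: measurable_funD; first exact: measurable_cst.
  by apply: measurable_funM => //; exact: measurable_cst.
apply: measurable_funB; first exact: measurable_cst.
by apply: measurable_funM => //; exact: measurable_cst.
Qed.

End measurability.

Lemma csq_kinetic_le (z w : C) (x a B : R) : csq z <= B -> csq w <= B -> `|x| <= a ->
  csq (z - ci * rc x * w) <= (2 + 2 * a ^+ 2) * B.
Proof.
move=> zB wB xa; apply: (le_trans (csqD_le _ _)); rewrite csqN !csqM csq_ci csq_rc mul1r.
rewrite [leRHS]mulrDl -mulrA; apply: lerD; rewrite ler_pM2l//.
apply: ler_pM; rewrite ?csq_ge0 ?sqr_ge0//.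
by rewrite -real_normK ?num_real// lerXn2r ?nnegrE// (le_trans _ xa).
Qed.

Variables (n : nat) (h : R) (Lam : nat).
Hypotheses (h0 : 0 < h) (h1 : h <= 1).
Local Notation M := (Lam.*2).
Local Notation X := {ffun 'I_n -> 'I_M}.
Local Notation mu := (lebesgue_rV n).
Local Notation node := (@node R n h Lam).
Local Notation cell := (@cell R n h Lam).
Local Notation window := (@window R n h Lam).

(** Values of A along a link carry no information, so its line integral is replaced by cell
    averages. Taking the mean over both ends makes the angle antisymmetric, hence [magnetic_hop]
    Hermitian. *)
Definition link_angle (A : 'rV[R]_n -> 'rV[R]_n) (x y : X) : R :=
  \sum_k h * ((y k)%:R - (x k)%:R) *
    ((cell_avg h (fun z => A z ord0 k) x + cell_avg h (fun z => A z ord0 k) y) / 2).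

Definition magnetic_hop (A : 'rV[R]_n -> 'rV[R]_n) (x y : X) : C :=
  rc (hop x y) * phase (link_angle A x y).

Lemma magnetic_hop_herm A x y : magnetic_hop A y x = (magnetic_hop A x y)^*.
Proof.
rewrite /magnetic_hop conjM rc_conj hopC -phaseN; congr (_ * phase _).
rewrite /link_angle -sumrN; apply: eq_bigr => k _.
by rewrite [X in _ * (X / 2)]addrC; ring.
Qed.

Lemma magnetic_hop_bound A x y : cmod (magnetic_hop A x y) <= hop x y.
Proof.
rewrite /magnetic_hop cmodM cmod_rc ger0_norm ?hop_ge0//.
rewrite (_ : cmod (phase _) = 1) ?mulr1//.
apply/eqP; rewrite -(@eqrXn2 _ 2) ?cmod_ge0// cmod_sq csq_phase expr1n//.
Qed.

Variables (A : 'rV[R]_n -> 'rV[R]_n) (u : 'rV[R]_n -> C) (a B r : R).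
Hypotheses (a0 : 0 <= a) (B0 : 0 <= B).
Hypothesis mA : forall k, measurable_fun [set: 'rV[R]_n] (fun z => A z ord0 k).
Hypothesis Aa : forall z k, `|A z ord0 k| <= a.
Hypotheses (tu : test_function u) (uB : test_bound B u).
Hypothesis ur : forall z : 'rV[R]_n, (exists k, r <= `|z ord0 k|) ->
  u z = 0 /\ forall k, cgrad u k z = 0.
Hypothesis rLam : r + 2 * h <= h * Lam%:R.

Let vol : R := (2 * (h * Lam%:R)) ^+ n.

(** A node that is not interior has a coordinate of modulus at least h * Lam - h; the margin 2 h in
    [rLam] places it outside the support. *)
Lemma node_boundary x : ~ interior x ->
  u (node x) = 0 /\ forall k, cgrad u k (node x) = 0.
Proof.
move=> /existsNP[k nk]; apply: ur; exists k; rewrite mxE normrM gtr0_norm//.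
have [xk0|xk0] := posnP (x k).
  rewrite xk0 sub0r normrN normr_nat; have := rLam; have := h0; lra.
have : ~~ ((x k).+1 < M)%N by apply/negP => ?; apply: nk.
rewrite -leqNgt => Mx; have xM := ltn_ord (x k).
have e : (x k)%:R = Lam%:R + Lam%:R - 1 :> R.
  have ee (i : nat) : (i.+1 = M)%N -> i%:R = Lam%:R + Lam%:R - 1 :> R.
    by rewrite -natrD addnn => <-; rewrite -natr1 addrK.
  by apply: ee; lia.
have Lam1 : 1 <= Lam%:R :> R by rewrite ler1n; lia.
rewrite e (_ : _ - _ = Lam%:R - 1); last by ring.
rewrite ger0_norm ?subr_ge0// mulrBr mulr1; have := rLam; have := h0; lra.
Qed.

Let rintA k : rint mu window (fun z => A z ord0 k).
Proof.
apply: (@rint_bounded _ _ _ _ _ _ a); rewrite ?fin_window//.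
- exact: measurable_window.
- exact: measurable_funTS.
Qed.

Let rintA2 k : rint mu window (fun z => A z ord0 k ^+ 2).
Proof.
apply: (@rint_bounded _ _ _ _ _ _ (a ^+ 2)); rewrite ?fin_window//.
- exact: measurable_window.
- by apply: measurable_funTS; exact: measurable_funX.
- by move=> z _; rewrite normrX lerXn2r ?nnegrE.
Qed.

Let avg_bound k (x : X) : `|cell_avg h (fun z => A z ord0 k) x| <= a.
Proof.
have hn0 : 0 < h ^+ n by rewrite exprn_gt0.
rewrite /cell_avg normrM gtr0_norm ?invr_gt0// ler_pdivrMl//.
apply: (le_trans (le_normr_Rintegral _ _)).
- exact: measurable_cell.
- by apply: rint_cell.
have -> : h ^+ n * a = \int[mu]_(z in cell x) a.
  by rewrite Rintegral_cell_cst.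
apply: le_Rintegral; first exact: measurable_cell.
- apply: (@rint_bounded _ _ _ _ _ _ a); rewrite ?fin_cell//.
  + exact: measurable_cell.
  + by apply: measurableT_comp => //; exact: measurable_funTS.
  + by move=> z _; rewrite normr_id.
- by apply: rint_cst; [exact: measurable_cell|exact: fin_cell].
- by move=> z _.
Qed.

Let kin k z := csq (cgrad u k z - ci * rc (A z ord0 k) * u z).

Let rint_kin k : rint mu window (kin k).
Proof.
case: uB => b1 b2 _.
apply: (@rint_bounded _ _ _ _ _ _ ((2 + 2 * a ^+ 2) * B)); rewrite ?fin_window//.
- exact: measurable_window.
- by apply: measurable_funTS; exact: measurable_csq_kinetic.
- by move=> z _; rewrite ger0_norm ?csq_ge0// csq_kinetic_le.
Qed.

Let Z (x : X) k := cgrad u k (node x) - ci * rc (cell_avg h (fun z => A z ord0 k) x) * u (node x).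

Let Z_boundary x : ~ interior x -> forall k, Z x k = 0.
Proof.
by move=> /node_boundary[ux Dx] k; rewrite /Z ux Dx mulr0 subr0.
Qed.

(** The square is convex in the potential, so averaging A over the cell can only lower it; Taylor
    bounds then move u and its gradient from the node to the points of the cell. *)
Let cell_kinetic (x : X) k :
  h ^+ n * csq (Z x k) <= (1 + h) * \int[mu]_(z in cell x) kin k z
     + h ^+ n * (2 * ((2 + 2 * a ^+ 2) * B) * h).
Proof.
case: uB => b1 b2 b3.
have hn0 : 0 < h ^+ n by rewrite exprn_gt0.
have mc := @measurable_cell R n h Lam x.
have fc := @fin_cell R n h Lam x.
have Q1 := avg_csq_le (cgrad u k (node x)) (u (node x)) mc (lebesgue_cell h0 x) hn0
  (rint_cell h0 x (rintA k)) (rint_cell h0 x (rintA2 k)).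
apply: (le_trans Q1).
have -> : h ^+ n * (2 * ((2 + 2 * a ^+ 2) * B) * h) =
   \int[mu]_(z in cell x) (2 * ((2 + 2 * a ^+ 2) * B) * h).
  by rewrite Rintegral_cell_cst.
rewrite -RintegralZl//; last exact: rint_cell.
rewrite -RintegralD//; last 2 first.
  by apply: rintZ => //; exact: rint_cell.
  exact: rint_cst.
apply: le_Rintegral => //.
- apply: (@rint_bounded _ _ _ _ _ _ ((2 + 2 * a ^+ 2) * B)) => //.
  + by apply: measurable_funTS; exact: measurable_csq_cst_kinetic.
  + by move=> z _; rewrite ger0_norm ?csq_ge0// csq_kinetic_le.
- apply: rintD => //; last exact: rint_cst.
  by apply: rintZ => //; exact: rint_cell.
- move=> z xz; have := b3 h (ltW h0) _ _ (cell_close xz); case=> c1 c2 _.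
  have -> : cgrad u k (node x) - ci * rc (A z ord0 k) * u (node x) =
    (cgrad u k z - ci * rc (A z ord0 k) * u z) +
    (- ((cgrad u k z - cgrad u k (node x)) - ci * rc (A z ord0 k) * (u z - u (node x)))).
    ring.
  apply: csq_split_small => //; rewrite csqN -[leRHS]mulrA; exact: csq_kinetic_le.
Qed.

(** Only an upper bound on the lattice form is needed, and this is the direction in which convexity
    works for an irregular A. The factor 2 / h^2 reflects that 1 - P approximates - h^2 / 2 times
    the Laplacian, the steps having variance h^2 in each coordinate. *)
Lemma kinetic_discretise : 2 * h ^+ n / h ^+ 2 *
    (\sum_x csq (u (node x)) - qf (magnetic_hop A) (u \o node)) <=
  \int[mu]_(z in window) \sum_k kin k z +
    h * (B * vol * (15 * n%:R * (2 + 2 * a ^+ 2) + link_const n a)).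
Proof.
case: uB => b1 b2 b3.
have hn0 : 0 < h ^+ n by rewrite exprn_gt0.
have K0 : 0 <= link_const n a.
  by rewrite /link_const !addr_ge0 ?mulr_ge0 ?addr_ge0 ?sqr_ge0// mulr_ge0 ?sqr_ge0.
have hop_le (x : X) : \sum_y hop x y <= 1 :> R.
  have [xi|xi] := pselect (interior x); first by rewrite hop_sum1.
  exact: hop_le1.
have st1 : \sum_x csq (u (node x)) - qf (magnetic_hop A) (u \o node) =
   2^-1 * \sum_x \sum_y hop x y * csq (u (node x) - phase (link_angle A x y) * u (node y)).
  rewrite -(@qf_phase_identity _ _ _ (fun x y => phase (link_angle A x y)) (u \o node)).
    congr (_ - _); apply: eq_bigr => x _ /=.
    have [xi|xi] := pselect (interior x); first by rewrite hop_sum1// mulr1.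
    by rewrite (node_boundary xi).1 csq0 mul0r.
  by move=> x y; exact: csq_phase.
pose SZ (x y z : X) := csq (\sum_k rc ((y k)%:R - (x k)%:R) * Z z k).
have link x y : hop x y * csq (u (node x) - phase (link_angle A x y) * u (node y)) <=
   hop x y * (h ^+ 2 * (1 + h) ^+ 2 * 2^-1 * (SZ x y x + SZ x y y) + B * h ^+ 3 * link_const n a).
  have [->|hxy] := eqVneq (hop x y : R) 0; first by rewrite !mul0r.
  rewrite ler_wpM2l ?hop_ge0//.
  have sig := fun k => hop_neighbour k hxy.
  have [c1 c2 c3] := b3 h (ltW h0) _ _ (node_close h0 sig).
  have c3' : csq (u (node y) - u (node x) -
      \sum_k rc (h * ((y k)%:R - (x k)%:R)) * cgrad u k (node x)) <= B * h ^+ 4.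
    move: c3; congr (csq (_ - _) <= _); apply: eq_bigr => k _; congr (rc _ * _).
    by rewrite !mxE; ring.
  exact: (link_estimate h0 h1 B0 a0 sig (fun k => avg_bound k x) (fun k => avg_bound k y)
    (b1 _) c1 c2 c3').
have iso (x : X) : \sum_y hop x y * SZ x y x = \sum_k csq (Z x k).
  have [xi|xi] := pselect (interior x); first exact: hop_isotropic.
  rewrite !big1// => [k _|y _]; first by rewrite Z_boundary// csq0.
  by rewrite /SZ big1 ?csq0 ?mulr0// => k _; rewrite Z_boundary// mulr0.
have sum2 : \sum_x \sum_y hop x y * SZ x y y = \sum_x \sum_k csq (Z x k).
  rewrite exchange_big/=; apply: eq_bigr => y _; rewrite -iso; apply: eq_bigr => x _.
  rewrite hopC; congr (_ * _); rewrite /SZ -csqN -sumrN; congr csq.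
  by apply: eq_bigr => k _; rewrite -mulNr -rcN opprB.
pose T := \sum_x \sum_k csq (Z x k).
have T0 : 0 <= T by apply: sumr_ge0 => x _; apply: sumr_ge0 => k _; exact: csq_ge0.
have st2 : \sum_x csq (u (node x)) - qf (magnetic_hop A) (u \o node) <=
   2^-1 * (h ^+ 2 * (1 + h) ^+ 2 * T + #|X|%:R * (B * h ^+ 3 * link_const n a)).
  rewrite st1 ler_pM2l ?invr_gt0//.
  apply: (@le_trans _ _ (\sum_x \sum_y hop x y * (h ^+ 2 * (1 + h) ^+ 2 * 2^-1 *
     (SZ x y x + SZ x y y) + B * h ^+ 3 * link_const n a))).
    by apply: ler_sum => x _; apply: ler_sum.
  have -> : \sum_x \sum_y hop x y * (h ^+ 2 * (1 + h) ^+ 2 * 2^-1 *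
     (SZ x y x + SZ x y y) + B * h ^+ 3 * link_const n a) =
     h ^+ 2 * (1 + h) ^+ 2 * 2^-1 * (\sum_x \sum_y hop x y * SZ x y x +
       \sum_x \sum_y hop x y * SZ x y y) +
     (\sum_(x : X) \sum_(y : X) hop x y) * (B * h ^+ 3 * link_const n a).
    rewrite -big_split/= mulr_sumr mulr_suml -big_split/=; apply: eq_bigr => x _.
    rewrite -big_split/= mulr_sumr mulr_suml -big_split/=; apply: eq_bigr => y _.
    ring.
  rewrite sum2; under eq_bigr do rewrite iso.
  rewrite -/T; apply: lerD.
    by rewrite le_eqVlt; apply/orP; left; apply/eqP; field.
  rewrite ler_wpM2r ?mulr_ge0 ?exprn_ge0 ?(ltW h0)//.
  apply: (@le_trans _ _ (\sum_(x : X) 1)); first by apply: ler_sum => x _.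
  by rewrite sumr_const.
have cards : #|X|%:R * h ^+ n = vol by exact: card_cells.
pose I := \int[mu]_(z in window) \sum_k kin k z.
have IE : I = \sum_k \int[mu]_(z in window) kin k z.
  by apply: Rintegral_sum => //; exact: measurable_window.
have st3 : h ^+ n * T <= (1 + h) * I + n%:R * (vol * (2 * ((2 + 2 * a ^+ 2) * B) * h)).
  have -> : I = \sum_x \sum_k \int[mu]_(z in cell x) kin k z.
    rewrite IE exchange_big/=; apply: eq_bigr => k _; exact: Rintegral_window.
  apply: (@le_trans _ _ (\sum_(x : X) \sum_k ((1 + h) * \int[mu]_(z in cell x) kin k z
     + h ^+ n * (2 * ((2 + 2 * a ^+ 2) * B) * h)))).
    rewrite /T mulr_sumr; apply: ler_sum => x _; rewrite mulr_sumr.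
    by apply: ler_sum => k _; exact: cell_kinetic.
  under eq_bigr do rewrite big_split/= -mulr_sumr sumr_const card_ord.
  rewrite big_split/= -mulr_sumr lerD2l sumr_const -cards.
  by rewrite -[X in X <= _]mulr_natl -mulr_natl le_eqVlt; apply/orP; left; apply/eqP; ring.
have volE : 0 <= vol by rewrite exprn_ge0// mulr_ge0// mulr_ge0// ltW.
have IB : I <= n%:R * ((2 + 2 * a ^+ 2) * B * vol).
  rewrite IE; apply: (@le_trans _ _ (\sum_(k < n) (2 + 2 * a ^+ 2) * B * vol)); last first.
    by rewrite sumr_const card_ord -[leLHS]mulr_natl.
  apply: ler_sum => k _.
  have -> : (2 + 2 * a ^+ 2) * B * vol = \int[mu]_(z in window) ((2 + 2 * a ^+ 2) * B).
    rewrite Rintegral_cst; last exact: measurable_window.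
    by congr (_ * _); exact: (esym (congr1 fine (@lebesgue_window R n h Lam h0))).
  apply: le_Rintegral; first exact: measurable_window.
  - exact: rint_kin.
  - by apply: rint_cst; [exact: measurable_window|exact: fin_window].
  - by move=> z _; exact: csq_kinetic_le.
have I0 : 0 <= I.
  by apply: Rintegral_ge0 => z _; apply: sumr_ge0 => k _; exact: csq_ge0.
apply: (@le_trans _ _ ((1 + h) ^+ 2 * (h ^+ n * T) + vol * (B * h * link_const n a))).
  apply: (@le_trans _ _ (2 * h ^+ n / h ^+ 2 *
    (2^-1 * (h ^+ 2 * (1 + h) ^+ 2 * T + #|X|%:R * (B * h ^+ 3 * link_const n a))))).
    by rewrite ler_wpM2l// divr_ge0 ?mulr_ge0 ?exprn_ge0 ?(ltW h0).
  rewrite -cards le_eqVlt; apply/orP; left; apply/eqP; field.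
  by rewrite gt_eqF.
have hp := h0; have hq := h1.
have h12 : (1 + h) ^+ 2 <= 4 by nra.
apply: (@le_trans _ _ ((1 + h) ^+ 2 * ((1 + h) * I + n%:R * (vol * (2 * ((2 + 2 * a ^+ 2) * B) * h)))
   + vol * (B * h * link_const n a))).
  by rewrite lerD2r ler_wpM2l ?sqr_ge0.
rewrite -/I; set E := (2 + 2 * a ^+ 2) * B in IB *.
(* Here 15 = 7 + 8: the 7 comes from (1 + h)^3 <= 1 + 7 h, and 8 = 4 * 2 is (1 + h)^2 <= 4 times the
   2 in the error of [cell_kinetic]. *)
have -> : h * (B * vol * (15 * n%:R * (2 + 2 * a ^+ 2) + link_const n a)) =
  7 * h * (n%:R * (E * vol)) + 4 * (n%:R * (vol * (2 * E * h))) + vol * (B * h * link_const n a).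
  by rewrite /E; ring.
rewrite addrA lerD2r mulrDr addrA; apply: lerD; last first.
  by rewrite ler_wpM2r// !mulr_ge0// ?(ltW h0)// addr_ge0// mulr_ge0// sqr_ge0.
apply: (@le_trans _ _ (I + 7 * h * I)); last by rewrite lerD2l ler_wpM2l// mulr_ge0// ltW.
rewrite mulrA -subr_ge0.
have -> : I + 7 * h * I - (1 + h) ^+ 2 * (1 + h) * I = h * (4 - 3 * h - h ^+ 2) * I by ring.
by rewrite !mulr_ge0 ?(ltW h0)//; nra.
Qed.

Lemma mass_discretise : h ^+ n * \sum_x csq (u (node x)) <=
  \int[mu]_(z in window) csq (u z) + h * (3 * B * vol).
Proof.
case: uB => b1 b2 b3.
have hn0 : 0 < h ^+ n by rewrite exprn_gt0.
have mw := @measurable_window R n h Lam; have fw := @fin_window R n h Lam.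
have Iu : rint mu window (fun z => csq (u z)).
  apply: (@rint_bounded _ _ _ _ _ _ B) => //.
  - by apply: measurable_funTS; exact: measurable_csq_test.
  - by move=> z _; rewrite ger0_norm ?csq_ge0.
rewrite (Rintegral_window h0 Iu) /vol -(@card_cells R n h Lam).
apply: (@le_trans _ _ (\sum_(x : X) (\int[mu]_(z in cell x) csq (u z) + h ^+ n * (3 * B * h)))).
  rewrite mulr_sumr; apply: ler_sum => x _.
  have mc := @measurable_cell R n h Lam x; have fc := @fin_cell R n h Lam x.
  rewrite -!(Rintegral_cell_cst h0 x) -RintegralD//; last 2 first.
    exact: rint_cell.
    exact: rint_cst.
  apply: le_Rintegral => //; first exact: rint_cst.
    by apply: rintD => //; [exact: rint_cell|exact: rint_cst].
  move=> z xz; have := b3 h (ltW h0) _ _ (cell_close xz); case=> c1 _ _.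
  have -> : u (node x) = u z + (- (u z - u (node x))) by ring.
  apply: (@le_trans _ _ ((1 + h) * csq (u z) + 2 * B * h)).
    by apply: csq_split_small => //; rewrite csqN.
  have := ler_wpM2l (ltW h0) (b1 z); lra.
rewrite big_split/= lerD2l sumr_const -mulr_natl.
by rewrite le_eqVlt; apply/orP; left; apply/eqP; ring.
Qed.

End discretisation.

Definition cube (R : realType) n (L : R) : set 'rV[R]_n :=
  box (fun _ => - L) (fun _ => L).
Arguments cube {R} n L _.

(** * From the lattice to test functions *)

Section hyperplane.
Context {R : realType}.
Local Notation C := (cplx R).

Definition embed d (z : 'rV[R]_d) : 'rV[R]_(d + 1) := row_mx z (0 : 'rV_1).

Lemma measurable_embed d : measurable_fun [set: 'rV[R]_d] (@embed d).
Proof.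
apply: measurable_fun_rV => k; case: (split_ordP k) => j ->.
- under eq_fun do rewrite row_mxEl; exact: measurable_coord.
- under eq_fun do rewrite row_mxEr mxE; exact: measurable_cst.
Qed.

Lemma embed_close d (h : R) (z z' : 'rV[R]_d) : 0 <= h ->
  coord_close h z z' -> coord_close h (embed z) (embed z').
Proof.
move=> h0 zz' k; case: (split_ordP k) => j ->; first by rewrite !row_mxEl.
by rewrite !row_mxEr mxE subrr normr0.
Qed.

Variables (d : nat) (h L : R) (Lam : nat).
Hypotheses (h0 : 0 < h) (h1 : h <= 1) (hL : h * Lam%:R = L).
Local Notation M := (Lam.*2).
Local Notation X := {ffun 'I_(d + 1) -> 'I_M}.
Local Notation Y := {ffun 'I_d -> 'I_M}.
Local Notation mu := (lebesgue_rV d).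

Definition last_coord : 'I_(d + 1) := rshift d ord0.

Definition shadow (x : X) : Y := [ffun j => x (lshift 1 j)].

Lemma sum_hyperplane (F : X -> R) (G : Y -> R) : (0 < Lam)%N ->
  (forall x : X, (x last_coord : nat) = Lam -> F x = G (shadow x)) ->
  \sum_(x : X | (x last_coord : nat) == Lam) F x = \sum_y G y.
Proof.
move=> L0 FG; have LM : (Lam < M)%N by rewrite -addnn -addn1 leq_add2l.
pose ext (y : Y) : X := [ffun k : 'I_(d + 1) =>
  match fintype.split k with inl j => y j | inr _ => Ordinal LM end].
have extl y j : ext y (lshift 1 j) = y j.
  by rewrite ffunE; case: splitP => i /=; [move=> /val_inj ->|move=> ij; have := ltn_ord j; lia].
have extr y : ext y last_coord = Ordinal LM.
  by rewrite ffunE; case: splitP => i //= ij; have := ltn_ord i; rewrite -ij addn0 ltnn.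
rewrite (reindex_onto ext shadow) /=; last first.
  move=> x /eqP xL; apply/ffunP => k; case: (split_ordP k) => j ->.
    by rewrite extl ffunE.
  by rewrite (ord1 j) extr; apply/val_inj.
have shext y : shadow (ext y) = y by apply/ffunP => j; rewrite ffunE extl.
rewrite (eq_bigl xpredT); last by move=> y; rewrite extr shext !eqxx.
by apply: eq_bigr => y _; rewrite FG ?shext// extr.
Qed.

Lemma node_hyperplane (x : X) : (x last_coord : nat) = Lam ->
  node h x = embed (node h (shadow x)).
Proof.
move=> xL; apply/rowP => k; rewrite mxE; case: (split_ordP k) => j ->.
  by rewrite row_mxEl !mxE ffunE.
by rewrite row_mxEr mxE (ord1 j) xL subrr mulr0.
Qed.

(** The opposite direction to the kinetic term, as the potential energy stands on the larger side of
    the inequality. W is only integrable and is never evaluated at a node: it enters through cell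
    averages, and only u is moved. *)
Lemma potential_discretise (W : 'rV[R]_d -> R) (u : 'rV[R]_(d + 1) -> C) (B : R) :
  0 <= B -> (forall z, 0 <= W z) -> rint mu (cube d L) W ->
  test_function u -> test_bound B u ->
  \int[mu]_(z in cube d L) (W z * csq (u (embed z))) <=
    h ^+ d * \sum_(y : Y) cell_avg h W y * csq (u (embed (node h y)))
    + h * (3 * B * \int[mu]_(z in cube d L) W z).
Proof.
move=> B0 W0 IW tu [b1 b2 b3].
have hd0 : 0 < h ^+ d by rewrite exprn_gt0.
have cubeE : cube d L = @window R d h Lam by rewrite /window hL.
have mw := @measurable_window R d h Lam.
have mu' : measurable_fun [set: 'rV[R]_d] (fun z => csq (u (embed z))).
  apply: (@measurableT_comp _ _ _ _ _ _ (fun z => csq (u z))).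
    exact: measurable_csq_test.
  exact: measurable_embed.
rewrite cubeE in IW *.
have IWu : rint mu (@window R d h Lam) (fun z => W z * csq (u (embed z))).
  apply: (rint_mul_bounded (B := B)) => //; first exact: measurable_funTS.
  by move=> z _; rewrite ger0_norm ?csq_ge0.
rewrite (Rintegral_window h0 IWu) (Rintegral_window h0 IW).
rewrite !mulr_sumr -big_split/=; apply: ler_sum => y _.
have mc := @measurable_cell R d h Lam y.
have IWc := rint_cell h0 y IW.
have -> : h ^+ d * (cell_avg h W y * csq (u (embed (node h y)))) +
   h * (3 * B * \int[mu]_(z in cell h y) W z) =
   (csq (u (embed (node h y))) + h * (3 * B)) * \int[mu]_(z in cell h y) W z.
  by rewrite /cell_avg; field; rewrite gt_eqF.
rewrite -RintegralZl//; apply: le_Rintegral => //.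
- exact: rint_cell.
- exact: rintZ.
- move=> z yz; rewrite mulrC ler_wpM2r//.
  have := b3 h (ltW h0) _ _ (embed_close (ltW h0) (cell_close yz)); case=> c1 _ _.
  have -> : u (embed z) = u (embed (node h y)) + (u (embed z) - u (embed (node h y))).
    by ring.
  apply: (@le_trans _ _ ((1 + h) * csq (u (embed (node h y))) + 2 * B * h)).
    exact: csq_split_small.
  have := ler_wpM2l (ltW h0) (b1 (embed (node h y))); lra.
Qed.

End hyperplane.

Section count_bounded.
Context {R : realType}.
Local Notation C := (cplx R).

Lemma small_mesh (L K delta E : R) : 0 < L -> 0 < delta -> 0 < E ->
  exists Lam : nat, [/\ (0 < Lam)%N, L / Lam%:R <= 1, L / Lam%:R * K <= delta &
    E * (L / Lam%:R) ^+ 2 <= 2^-1].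
Proof.
move=> L0 d0 E0.
pose Lam := (Num.trunc (L + L * `|K| / delta + 2 * E * L ^+ 2 + L)).+1.
have LamP : L + L * `|K| / delta + 2 * E * L ^+ 2 + L < Lam%:R.
  exact: truncnS_gt.
have t1 : 0 <= L * `|K| / delta by rewrite divr_ge0 ?mulr_ge0 ?(ltW L0)// ltW.
have t2 : 0 <= 2 * E * L ^+ 2 by rewrite !mulr_ge0 ?sqr_ge0// ltW.
have L1 : 1 <= Lam%:R :> R by rewrite ler1n.
have Lam0 : 0 < Lam%:R :> R by rewrite (lt_le_trans ltr01).
exists Lam; split => //.
- by rewrite ler_pdivrMr// mul1r; lra.
- apply: (@le_trans _ _ (L / Lam%:R * `|K|)); first by rewrite ler_wpM2l ?divr_ge0 ?ler_norm ?(ltW L0).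
  rewrite mulrAC ler_pdivrMr// -ler_pdivrMl// mulrC; lra.
- rewrite expr_div_n mulrA ler_pdivrMr ?exprn_gt0//.
  have : Lam%:R <= Lam%:R ^+ 2 :> R by rewrite expr2 ler_peMl// ltW.
  lra.
Qed.

Lemma lattice_const_ge0 n (beta : R) : 0 <= beta -> 0 <= lattice_const n beta.
Proof.
move=> b0; apply: mulr_ge0; last exact: powR_ge0.
apply: mulr_ge0 => //; apply: divr_ge0; first by rewrite mulr_ge0 ?exprn_ge0.
rewrite subr_ge0 powRN invf_le1 ?powR_gt0//.
by rewrite -[leLHS](powRr0 2) ler_powR ?ler1n.
Qed.

(** The factor 2^(s/2) comes from the lattice energy e = E h^2 / 2. *)
Definition count_const (d : nat) (s : R) : R :=
  lattice_const (d + 1) (d%:R - 1 + s) * 2 `^ (s / 2).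

(** The powers of the mesh cancel: the weights h * avg contribute h^s and e^(-s/2) contributes
    h^(-s). It is therefore enough to take one mesh so fine that the discretisation errors stay
    below half of the margin [delta]. *)
Theorem count_bounded (d N : nat) (u : 'I_N -> 'rV[R]_(d + 1) -> C)
    (A : 'rV[R]_(d + 1) -> 'rV[R]_(d + 1)) (W : 'rV[R]_d -> R) (a r L E s delta : R) :
  let uc c z := \sum_j c j * u j z in
  0 <= a -> 0 < E -> 0 <= s -> 0 < d%:R - 1 + s -> 0 < delta ->
  (forall j, test_function (u j)) ->
  (forall (c : 'I_N -> C) (z : 'rV[R]_(d + 1)), (exists k, r <= `|z ord0 k|) ->
    uc c z = 0 /\ forall k, cgrad (uc c) k z = 0) ->
  0 < L -> r + 2 <= L ->
  (forall k, measurable_fun [set: 'rV[R]_(d + 1)] (fun z => A z ord0 k)) ->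
  (forall z k, `|A z ord0 k| <= a) ->
  (forall z, 0 <= W z) -> rint (lebesgue_rV d) (cube d L) W ->
  rint (lebesgue_rV d) (cube d L) (fun z => W z `^ (d%:R + s)) ->
  (forall c : 'I_N -> C,
    \int[lebesgue_rV (d + 1)]_(z in cube (d + 1) L)
      (\sum_k csq (cgrad (uc c) k z - ci * rc (A z ord0 k) * uc c z)) +
    E * \int[lebesgue_rV (d + 1)]_(z in cube (d + 1) L) csq (uc c z) <=
    \int[lebesgue_rV d]_(z in cube d L) ((W z + Num.sqrt E / 2) * csq (uc c (embed z)))
    - delta * \sum_j csq (c j)) ->
  N%:R <= count_const d s * E `^ (- s / 2) *
    \int[lebesgue_rV d]_(z in cube d L) (W z `^ (d%:R + s)).
Proof.
move=> uc a0 E0 s0 beta0 delta0 tu ur L0 rL mA Aa W0 IW IWp ineq.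
set n := (d + 1)%N in u A uc tu ur mA Aa ineq *.
have [B B0 uB] := test_family_bounds tu.
pose vol : R := (2 * L) ^+ n.
pose Wm z := W z + Num.sqrt E / 2.
have sE0 : 0 <= Num.sqrt E by exact: sqrtr_ge0.
have mcube : measurable (cube d L : set 'rV[R]_d) by exact: measurable_box.
have fcube : (lebesgue_rV d (cube d L : set 'rV[R]_d) < +oo)%E by exact: fin_box.
have IWm : rint (lebesgue_rV d) (cube d L) Wm.
  by apply: rintD => //; exact: rint_cst.
(* The sum of the three discretisation errors, kinetic, mass and potential, per unit of h and of the
   sum of [csq (c j)]. *)
pose K := B * vol * (15 * n%:R * (2 + 2 * a ^+ 2) + link_const n a) + E * (3 * B * vol)
  + 3 * B * \int[lebesgue_rV d]_(z in cube d L) Wm z.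
have [Lam [Lam0 h1 hK eh]] := small_mesh K L0 (divr_gt0 delta0 (ltr0n R 2)) E0.
set h := L / Lam%:R in h1 hK eh.
have LamR : 0 < Lam%:R :> R by rewrite ltr0n.
have h0 : 0 < h by rewrite divr_gt0.
have hL : h * Lam%:R = L by rewrite divfK// gt_eqF.
clearbody h.
(* The energy E in units of 1 - P. *)
pose e : R := E * h ^+ 2 / 2.
have e0 : 0 < e by rewrite divr_gt0// mulr_gt0// exprn_gt0.
have e14 : e <= 4^-1 by rewrite /e; lra.
have hn0 : 0 < h ^+ n by rewrite exprn_gt0.
have hd0 : 0 < h ^+ d by rewrite exprn_gt0.
have hnE : h ^+ n = h ^+ d * h by rewrite /n exprD expr1.
pose avg (y : {ffun 'I_d -> 'I_Lam.*2}) := cell_avg h W y.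
have avg0 y : 0 <= avg y.
  rewrite /avg /cell_avg mulr_ge0 ?invr_ge0 ?(ltW hd0)//.
  by apply: Rintegral_ge0 => z _.
pose F (c : 'I_N -> C) := (1 + e) * \sum_(x : {ffun 'I_n -> 'I_Lam.*2}) csq (uc c (node h x))
   - qf (@magnetic_hop R n h Lam A) (uc c \o @node R n h Lam).
pose T (c : 'I_N -> C) := \sum_(x : {ffun 'I_n -> 'I_Lam.*2} | (x (last_coord d) : nat) == Lam)
   csq (uc c (node h x)).
have key (c : 'I_N -> C) : F c <=
   \sum_(x : {ffun 'I_n -> 'I_Lam.*2} | (x (last_coord d) : nat) == Lam)
      (h / 2 * (avg (shadow x) + Num.sqrt E / 2)) * csq (uc c (node h x))
   - delta * h ^+ 2 / (4 * h ^+ n) * \sum_j csq (c j).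
  set S := \sum_j csq (c j).
  have S0 : 0 <= S by apply: sumr_ge0 => j _; exact: csq_ge0.
  have BS0 : 0 <= B * S by rewrite mulr_ge0.
  have [tuc _] := test_function_sum c tu.
  have rL' : r + 2 * h <= h * Lam%:R by rewrite hL; lra.
  have q1 := kinetic_discretise h0 h1 a0 BS0 mA Aa tuc (uB c) (ur c) rL'.
  have q2 := @mass_discretise R n h Lam h0 h1 _ _ tuc (uB c).
  have Wm0 z : 0 <= Wm z by rewrite addr_ge0// divr_ge0.
  have q3 := potential_discretise h0 h1 hL BS0 Wm0 IWm tuc (uB c).
  have q0 := ineq c.
  have winE : @window R n h Lam = cube n L by rewrite /window hL.
  rewrite winE hL -/vol in q1 q2.
  rewrite -/S in q0.
  have avgE y : cell_avg h Wm y = avg y + Num.sqrt E / 2.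
    rewrite /cell_avg RintegralD//; last 3 first.
      exact: measurable_cell.
      by apply: rint_cell => //; rewrite /window hL.
      by apply: rint_cst; [exact: measurable_cell|exact: fin_cell].
    by rewrite Rintegral_cell_cst// mulrDr mulKf// gt_eqF.
  have q4 : \sum_(x : {ffun 'I_n -> 'I_Lam.*2} | (x (last_coord d) : nat) == Lam)
      (h / 2 * (avg (shadow x) + Num.sqrt E / 2)) * csq (uc c (node h x)) =
      h / 2 * \sum_(y : {ffun 'I_d -> 'I_Lam.*2}) cell_avg h Wm y * csq (uc c (embed (node h y))).
    rewrite mulr_sumr; apply: sum_hyperplane => // x xL.
    by rewrite avgE node_hyperplane// mulrA.
  rewrite q4.
  pose m := 2 * h ^+ n / h ^+ 2.
  have m0 : 0 < m by exact: (divr_gt0 (mulr_gt0 (ltr0n R 2) hn0) (exprn_gt0 2 h0)).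
  rewrite -(@ler_pM2l _ m)//.
  have -> : m * F c = m * (\sum_(x : {ffun 'I_n -> 'I_Lam.*2}) csq (uc c (node h x)) - qf (@magnetic_hop R n h Lam A) (uc c \o @node R n h Lam))
     + E * (h ^+ n * \sum_(x : {ffun 'I_n -> 'I_Lam.*2}) csq (uc c (node h x))).
    by rewrite /F /m /e; field; rewrite gt_eqF.
  set P := \sum_y _ in q3 *.
  have -> : m * (h / 2 * P - delta * h ^+ 2 / (4 * h ^+ n) * S) = h ^+ d * P - delta / 2 * S.
    rewrite /m hnE; field; rewrite !gt_eqF//.
  have hKS := ler_wpM2r S0 hK.
  have q2E := ler_wpM2l (ltW E0) q2.
  rewrite -/m in q1; rewrite /K in hKS.
  rewrite -/S in q2E; move: q0 q1 q2E q3 hKS; rewrite /Wm -/uc.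
  set I1 := \int[_]_(z in _) _; set I2 := \int[_]_(z in _) _; set I3 := \int[_]_(z in _) _;
  set I4 := \int[_]_(z in _) _.
  set Q := m * (_ - _).
  set V := h ^+ n * _.
  set L1 := link_const n a; clearbody L1 Q V I1 I2 I3 I4 P S.
  move: (15 * _ * _) => G q0 q1 q2E q3 hKS; lra.
have trace c : h / 2 * (Num.sqrt E / 2) * T c <= 2^-1 * F c.
  (* Since kap^2 = e, multiplying [trace_inequality] by kap turns its right-hand side into exactly
     [F c]. Half of [F c] thus pays for the term with sqrt E / 2, and the other half is left for
     W. *)
  pose kap := h * Num.sqrt E / Num.sqrt 2.
  have s20 : 0 < Num.sqrt 2 :> R by rewrite sqrtr_gt0.
  have s22 : Num.sqrt 2 ^+ 2 = 2 :> R by rewrite sqr_sqrtr.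
  have kap0 : 0 < kap.
    by apply: divr_gt0 s20; apply: mulr_gt0 => //; rewrite sqrtr_gt0.
  have kap2 : kap ^+ 2 = e.
    by rewrite /kap expr_div_n exprMn s22 sqr_sqrtr ?(ltW E0)// /e; ring.
  have kap1 : kap <= 2^-1.
    rewrite -(@ler_pXn2r _ 2) ?nnegrE ?invr_ge0 ?(ltW kap0)// kap2.
    by rewrite exprVn -natrX.
  have := @trace_inequality R n Lam.*2 (@magnetic_hop R n h Lam A) (last_coord d) Lam kap
    (uc c \o @node R n h Lam) (@magnetic_hop_bound R n h Lam A) kap0 kap1.
  rewrite -/(T c) -(@ler_pM2l _ kap)// mulrDr mulrCA mulfV ?gt_eqF// mulr1 mulrA -expr2 kap2.
  have -> : \sum_x csq ((uc c \o @node R n h Lam) x) - qf (@magnetic_hop R n h Lam A) (uc c \o @node R n h Lam) +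
    e * \sum_x csq ((uc c \o @node R n h Lam) x) = F c by rewrite /F; ring.
  move=> H; apply: (@le_trans _ _ (2^-1 * (kap * T c))); last by rewrite ler_pM2l ?invr_gt0.
  have T0 : 0 <= T c by apply: sumr_ge0 => x _; exact: csq_ge0.
  rewrite [leRHS]mulrA; apply: ler_wpM2r => //.
  have s2 : Num.sqrt 2 <= 2 :> R by rewrite -(@ler_pXn2r _ 2) ?nnegrE ?(ltW s20)// s22 -natrX ler_nat.
  have -> : h / 2 * (Num.sqrt E / 2) = 2^-1 * (h * Num.sqrt E / 2) by ring.
  apply: ler_wpM2l; first by rewrite invr_ge0.
  apply: ler_wpM2l; first by rewrite mulr_ge0// ltW.
  by rewrite lef_pV2 ?posrE.
pose delta' := 2 * (delta * h ^+ 2 / (4 * h ^+ n)).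
have delta'0 : 0 < delta'.
  apply: mulr_gt0 => //; apply: divr_gt0; first exact: (mulr_gt0 delta0 (exprn_gt0 2 h0)).
  exact: mulr_gt0.
have main (c : 'I_N -> C) :
    let g (x : {ffun 'I_n -> 'I_Lam.*2}) := \sum_j c j * u j (node h x) in
    (1 + e) * \sum_x csq (g x) - qf (@magnetic_hop R n h Lam A) g <=
    \sum_(x : {ffun 'I_n -> 'I_Lam.*2} | (x (last_coord d) : nat) == Lam)
       (h * avg (shadow x)) * csq (g x) - delta' * \sum_j csq (c j).
  rewrite /=; have := key c; have := trace c.
  have -> : \sum_(x : {ffun 'I_n -> 'I_Lam.*2} | (x (last_coord d) : nat) == Lam)
      (h / 2 * (avg (shadow x) + Num.sqrt E / 2)) * csq (uc c (node h x)) =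
     2^-1 * (\sum_(x : {ffun 'I_n -> 'I_Lam.*2} | (x (last_coord d) : nat) == Lam)
      (h * avg (shadow x)) * csq (uc c (node h x))) + h / 2 * (Num.sqrt E / 2) * T c.
    rewrite /T !mulr_sumr -big_split/=; apply: eq_bigr => x _; ring.
  rewrite /delta' /F /uc -/n.
  set Q := \sum_(x | _) _; set S := \sum_j csq (c j).
  set DS := delta * h ^+ 2 / (4 * h ^+ n); rewrite -[2 * DS * S]mulrA.
  set G := _ - qf _ _.
  lra.
have W'0 (x : {ffun 'I_n -> 'I_Lam.*2}) : 0 <= h * avg (shadow x) by rewrite mulr_ge0// ltW.
have betaE : d%:R - 1 + s = n%:R - 2 + s by rewrite /n natrD; ring.
have e1 : e <= 1 by lra.
have := lattice_count (@magnetic_hop_herm R n h Lam A) (@magnetic_hop_bound R n h Lam A)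
   e0 e1 s0 beta0 betaE delta'0 W'0 main.
move/le_trans; apply.
have pE : 1 + (d%:R - 1 + s) = d%:R + s by ring.
have sumE : \sum_(x : {ffun 'I_n -> 'I_Lam.*2} | (x (last_coord d) : nat) == Lam)
    (h * avg (shadow x)) `^ (d%:R + s) = \sum_y (h * avg y) `^ (d%:R + s).
  by apply: sum_hyperplane.
rewrite pE sumE.
have p1 : 1 < d%:R + s by have := beta0; lra.
have lc0 := lattice_const_ge0 n (ltW beta0).
(* Of the power h^(d + s), the part h^d is the volume of a cell and is used up by Jensen's
   inequality; h^s remains. *)
have sumW : \sum_(y : {ffun 'I_d -> 'I_Lam.*2}) (h * avg y) `^ (d%:R + s) <=
   h `^ s * \int[lebesgue_rV d]_(z in cube d L) W z `^ (d%:R + s).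
  have winE : cube d L = @window R d h Lam by rewrite /window hL.
  rewrite winE (Rintegral_window h0); last by rewrite -winE.
  rewrite mulr_sumr; apply: ler_sum => y _.
  rewrite powRM ?(ltW h0)// addrC powRD; last by rewrite (gt_eqF h0) implybT.
  rewrite powR_mulrn ?(ltW h0)// [s + _]addrC -mulrA ler_wpM2l ?powR_ge0//.
  apply: avg_powR_le => //.
  - exact: measurable_cell.
  - exact: lebesgue_cell.
  - by apply: rint_cell => //; rewrite -winE.
  - by apply: rint_cell => //; rewrite -winE.
rewrite /count_const -/n.
set I := \int[_]_(z in _) _ in sumW *.
apply: (@le_trans _ _ (lattice_const n (d%:R - 1 + s) * e `^ (- s / 2) * (h `^ s * I))).
  by rewrite ler_wpM2l// mulr_ge0// powR_ge0.
rewrite le_eqVlt; apply/orP; left; apply/eqP.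
have eE : e `^ (- s / 2) * h `^ s = E `^ (- s / 2) * 2 `^ (s / 2).
  rewrite /e powRM ?mulr_ge0 ?invr_ge0 ?exprn_ge0 ?(ltW E0) ?(ltW h0)//.
  rewrite powRM ?exprn_ge0 ?(ltW E0) ?(ltW h0)//.
  have -> : (h ^+ 2) `^ (- s / 2) = h `^ (- s).
    by rewrite -powR_mulrn ?(ltW h0)// -powRrM; congr (_ `^ _); field.
  have -> : 2^-1 `^ (- s / 2) = 2 `^ (s / 2) :> R.
    by rewrite -powR_inv1// -powRrM; congr (_ `^ _); field.
  by rewrite powRN; field; rewrite powR_eq0 (gt_eqF h0).
have -> : lattice_const n (d%:R - 1 + s) * e `^ (- s / 2) * (h `^ s * I) =
  lattice_const n (d%:R - 1 + s) * (e `^ (- s / 2) * h `^ s) * I by ring.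
by rewrite eE; ring.
Qed.

End count_bounded.

Section tails.
Context d (T : measurableType d) (R : realType) (mu : {measure set T -> \bar R}).

Lemma rint_tail (D : set T) (f g : T -> R) (eps : R) : measurable D -> rint mu D f ->
  measurable_fun D g -> (forall x, D x -> 0 <= f x) -> 0 < eps ->
  exists m0 : nat, forall m, (m0 <= m)%N ->
    rint mu D (fun x => if `|g x| <= m%:R then 0 else f x) /\
    \int[mu]_(x in D) (if `|g x| <= m%:R then 0 else f x) < eps.
Proof.
move=> mD If mg f0 eps0.
pose F (m : nat) x := if `|g x| <= m%:R then 0 else f x.
have mf : measurable_fun D f by apply/measurable_EFinP; exact: measurable_int If.
have mF m : measurable_fun D (F m).
  apply: measurable_fun_if => //.
  - apply: measurable_fun_ler => //; exact: measurableT_comp.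
  - by apply: measurable_funS mf => // x [].
have Fle m x : D x -> `|F m x| <= f x.
  move=> Dx; rewrite /F; case: ifP => _; first by rewrite normr0 f0.
  by rewrite ger0_norm ?f0.
have IF m : rint mu D (F m).
  apply: (le_integrable mD _ _ If); first exact/measurable_EFinP.
  by move=> x Dx; rewrite /= lee_fin (le_trans (Fle m x Dx))// ler_norm.
have cv : (\int[mu]_(x in D) (F m x)%:E)%E @[m --> \oo] --> (\int[mu]_(x in D) (0%:E : \bar R))%E.
  apply: (@dominated_cvg _ _ _ mu D mD (fun m x => (F m x)%:E) _ (EFin \o f)) => //.
  - by move=> m; apply/measurable_EFinP.
  - move=> x Dx; apply: cvg_near_cst.
    exists (Num.trunc `|g x|).+1 => // m /= lem.
    by rewrite /F (le_trans (ltW (truncnS_gt _)))// ler_nat.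
have I0 : (\int[mu]_(x in D) (0%:E : \bar R))%E = 0%:E by apply: integral0_eq.
rewrite I0 in cv; have [m0 _ H] := cvgr_lt _ (fine_cvg cv) _ eps0.
by exists m0 => m m0m; split; [exact: IF|exact: H].
Qed.

Lemma rint_le (D : set T) (f g : T -> R) : measurable D -> rint mu D g ->
  measurable_fun D f -> (forall x, D x -> `|f x| <= g x) -> rint mu D f.
Proof.
move=> mD Ig mf fg; apply: (le_integrable mD _ _ Ig); first exact/measurable_EFinP.
by move=> x Dx; rewrite /= lee_fin (le_trans (fg x Dx))// ler_norm.
Qed.

Lemma Rintegral_support (D : set T) (f : T -> R) :
  (forall x, ~ D x -> f x = 0) -> \int[mu]_(x in setT) f x = \int[mu]_(x in D) f x.
Proof.
move=> f0; rewrite [RHS]Rintegral_mkcond; apply: eq_Rintegral => x _.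
by rewrite patchE; case: ifPn => // /negP; rewrite inE => /f0.
Qed.

Lemma rint_support (D : set T) (f : T -> R) : measurable D ->
  (forall x, ~ D x -> f x = 0) -> rint mu D f -> rint mu setT f.
Proof.
move=> mD f0; rewrite /rint => /(integrable_mkcond _ mD).1.
congr (integrable _ _ _); apply/funext => x /=.
by rewrite patchE; case: ifPn => // /negP; rewrite inE => /f0 ->.
Qed.

End tails.

Section count_cube.
Context {R : realType}.
Local Notation C := (cplx R).

Definition kinetic n (A : 'rV[R]_n -> 'rV[R]_n) (u : 'rV[R]_n -> C) z : R :=
  \sum_k csq (cgrad u k z - ci * rc (A z ord0 k) * u z).

Lemma rint_kinetic n (A : 'rV[R]_n -> 'rV[R]_n) u (D : set 'rV[R]_n) : measurable D ->
  (lebesgue_rV n D < +oo)%E ->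
  (forall k, measurable_fun [set: 'rV[R]_n] (fun z => A z ord0 k)) ->
  (forall k, rint (lebesgue_rV n) D (fun z => A z ord0 k ^+ 2)) ->
  test_function u -> rint (lebesgue_rV n) D (kinetic A u).
Proof.
move=> mD fD mA IA tu; have [B B0 [b1 b2 _]] := test_function_bounds tu.
apply: rint_sum => // k.
apply: (@rint_le _ _ _ _ _ _ (fun z => 2 * B + 2 * B * A z ord0 k ^+ 2)) => //.
- by apply: rintD => //; [exact: rint_cst|exact: rintZ].
- by apply: measurable_funTS; exact: measurable_csq_kinetic.
- move=> z _; rewrite ger0_norm ?csq_ge0//.
  apply: (@le_trans _ _ ((2 + 2 * `|A z ord0 k| ^+ 2) * B)).
    exact: csq_kinetic_le.
  by rewrite real_normK ?num_real//; lra.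
Qed.

(* The truncation of A at a high level costs an arbitrarily small multiple of
   [\sum_j csq (c j)], which half of [delta] absorbs. *)
Theorem count_cube (d N : nat) (u : 'I_N -> 'rV[R]_(d + 1) -> C)
    (A : 'rV[R]_(d + 1) -> 'rV[R]_(d + 1)) (W : 'rV[R]_d -> R) (r L E s delta : R) :
  let uc c z := \sum_j c j * u j z in
  0 < E -> 0 <= s -> 0 < d%:R - 1 + s -> 0 < delta ->
  (forall j, test_function (u j)) ->
  (forall (c : 'I_N -> C) (z : 'rV[R]_(d + 1)), (exists k, r <= `|z ord0 k|) ->
    uc c z = 0 /\ forall k, cgrad (uc c) k z = 0) ->
  0 < L -> r + 2 <= L ->
  (forall k, measurable_fun [set: 'rV[R]_(d + 1)] (fun z => A z ord0 k)) ->
  (forall k, rint (lebesgue_rV (d + 1)) (cube (d + 1) L) (fun z => A z ord0 k ^+ 2)) ->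
  (forall z, 0 <= W z) -> rint (lebesgue_rV d) (cube d L) W ->
  rint (lebesgue_rV d) (cube d L) (fun z => W z `^ (d%:R + s)) ->
  (forall c : 'I_N -> C,
    \int[lebesgue_rV (d + 1)]_(z in cube (d + 1) L) kinetic A (uc c) z +
    E * \int[lebesgue_rV (d + 1)]_(z in cube (d + 1) L) csq (uc c z) <=
    \int[lebesgue_rV d]_(z in cube d L) ((W z + Num.sqrt E / 2) * csq (uc c (embed z)))
    - delta * \sum_j csq (c j)) ->
  N%:R <= count_const d s * E `^ (- s / 2) *
    \int[lebesgue_rV d]_(z in cube d L) (W z `^ (d%:R + s)).
Proof.
move=> uc E0 s0 beta0 delta0 tu ur L0 rL mA IA W0 IW IWp ineq.
set n := (d + 1)%N in u A uc tu ur mA IA ineq *.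
have [B B0 uB] := test_family_bounds tu.
have mcube m : measurable (cube m L : set 'rV[R]_m) by exact: measurable_box.
have fcube m : (lebesgue_rV m (cube m L : set 'rV[R]_m) < +oo)%E by exact: fin_box.
pose Wm z := W z + Num.sqrt E / 2.
have sE0 : 0 <= Num.sqrt E by exact: sqrtr_ge0.
have Wm0 z : 0 <= Wm z by rewrite addr_ge0// divr_ge0.
have IWm : rint (lebesgue_rV d) (cube d L) Wm.
  exact: (rintD (mcube d) IW (rint_cst _ (mcube d) (fcube d))).
pose K := \int[lebesgue_rV d]_(z in cube d L) Wm z.
have K0 : 0 <= K by apply: Rintegral_ge0 => z _.
(* [tau] multiplies the kinetic energy for A, which the hypothesis bounds by the potential energy,
   at most B K times the sum of [csq (c j)]. [eps] is chosen afterwards because the truncation error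
   carries the weight 1 + tau^-1. Each of the two errors takes a quarter of [delta]. *)
pose tau := delta / (4 * (B * K + 1)).
have BK0 : 0 < B * K + 1 by rewrite ltr_wpDl// mulr_ge0.
have tau0 : 0 < tau by rewrite divr_gt0// mulr_gt0.
have tauBK : tau * (B * K) <= delta / 4.
  rewrite /tau mulrAC ler_pdivrMr ?mulr_gt0//; nra.
pose eps := delta / (4 * ((1 + tau^-1) * B * n%:R + 1)).
have t0 : 0 <= (1 + tau^-1) * B * n%:R.
  by rewrite mulr_ge0// mulr_ge0// addr_ge0// invr_ge0 ltW.
have eps0 : 0 < eps by rewrite divr_gt0// mulr_gt0// ltr_wpDl.
have epsB : (1 + tau^-1) * B * n%:R * eps <= delta / 4.
  rewrite /eps mulrCA ler_pM2l// ler_pdivrMr ?mulr_gt0 ?ltr_wpDl//; nra.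
have [m Hm] : exists m : nat, forall k : 'I_n,
    rint (lebesgue_rV n) (cube n L) (fun z => if `|A z ord0 k| <= m%:R then 0 else A z ord0 k ^+ 2) /\
    \int[lebesgue_rV n]_(z in cube n L) (if `|A z ord0 k| <= m%:R then 0 else A z ord0 k ^+ 2) < eps.
  have H (k : 'I_n) : exists m0 : nat, forall m, (m0 <= m)%N ->
     rint (lebesgue_rV n) (cube n L) (fun z => if `|A z ord0 k| <= m%:R then 0 else A z ord0 k ^+ 2) /\
    \int[lebesgue_rV n]_(z in cube n L) (if `|A z ord0 k| <= m%:R then 0 else A z ord0 k ^+ 2) < eps.
    apply: (rint_tail (mcube n) (IA k)) => //; first exact: measurable_funTS.
    by move=> z _; exact: sqr_ge0.
  have [f fH] := choice H.
  exists (\max_k f k)%N => k; apply: fH; exact: leq_bigmax.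
pose A' z : 'rV[R]_n := \row_k (if `|A z ord0 k| <= m%:R then A z ord0 k else 0).
have mA' k : measurable_fun [set: 'rV[R]_n] (fun z => A' z ord0 k).
  under eq_fun do rewrite mxE.
  apply: measurable_fun_if => //.
  - by apply: measurable_fun_ler => //; exact: measurableT_comp.
  - exact: measurable_funTS.
have A'm z k : `|A' z ord0 k| <= m%:R.
  by rewrite mxE; case: ifP => //; rewrite normr0.
apply: (@count_bounded _ d N u A' W m%:R r L E s (delta / 2)) => //; first exact: divr_gt0.
move=> c; set S := \sum_j csq (c j).
have S0 : 0 <= S by apply: sumr_ge0 => j _; exact: csq_ge0.
have BS0 : 0 <= B * S by rewrite mulr_ge0.
have [tuc _] := test_function_sum c tu.
have [b1 b2 _] := uB c; rewrite -/S in b1 b2.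
have q0 := ineq c; rewrite -/S in q0; clearbody S.
have Ik := rint_kinetic (mcube n) (fcube n) mA IA tuc.
have IA' k : rint (lebesgue_rV n) (cube n L) (fun z => A' z ord0 k ^+ 2).
  apply: (rint_bounded (B := m%:R ^+ 2) (mcube n) (fcube n)).
    by apply: measurable_funTS; exact: measurable_funX.
  move=> z _; rewrite ger0_norm ?sqr_ge0// -[leLHS]real_normK ?num_real//.
  by rewrite ler_pXn2r ?nnegrE.
have Ik' := rint_kinetic (mcube n) (fcube n) mA' IA' tuc.
pose G k z := if `|A z ord0 k| <= m%:R then 0 else A z ord0 k ^+ 2.
have IG k : rint (lebesgue_rV n) (cube n L) (G k) by case: (Hm k).
have step1 : \int[lebesgue_rV n]_(z in cube n L) kinetic A' (uc c) z <=
    (1 + tau) * \int[lebesgue_rV n]_(z in cube n L) kinetic A (uc c) z + delta / 4 * S.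
  apply: (@le_trans _ _ ((1 + tau) * \int[lebesgue_rV n]_(z in cube n L) kinetic A (uc c) z +
     (1 + tau^-1) * (B * S) * \sum_k \int[lebesgue_rV n]_(z in cube n L) G k z)).
    have IsG := rint_sum (index_enum 'I_n) (mcube n) IG.
    have I1 := rintZ (1 + tau) (mcube n) Ik.
    have I2 := rintZ ((1 + tau^-1) * (B * S)) (mcube n) IsG.
    rewrite -(RintegralZl _ (mcube n) Ik) -(Rintegral_sum _ (mcube n) IG).
    rewrite -(RintegralZl _ (mcube n) IsG) -(RintegralD (mcube n) I1 I2).
    apply: (le_Rintegral (mcube n) Ik' (rintD (mcube n) I1 I2)).
    move=> z _; rewrite /kinetic !mulr_sumr -big_split/=; apply: ler_sum => k _.
    have -> : cgrad (uc c) k z - ci * rc (A' z ord0 k) * uc c z =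
       (cgrad (uc c) k z - ci * rc (A z ord0 k) * uc c z) +
       ci * rc (A z ord0 k - A' z ord0 k) * uc c z by rewrite rcD rcN; ring.
    apply: (le_trans (csq_split _ _ tau0)); rewrite lerD2l -[leRHS]mulrA ler_pM2l; last first.
      by rewrite ltr_wpDr// invr_ge0 ltW.
    rewrite !csqM csq_ci csq_rc mul1r mulrC /G mxE.
    case: ifP => _; first by rewrite subrr expr0n/= !mulr0.
    by rewrite subr0; apply: ler_wpM2r; [exact: sqr_ge0|exact: b1].
  rewrite lerD2l.
  have : \sum_k \int[lebesgue_rV n]_(z in cube n L) G k z <= n%:R * eps.
    apply: (@le_trans _ _ (\sum_(k < n) eps)).
      by apply: ler_sum => k _; apply: ltW; case: (Hm k).
    by rewrite sumr_const card_ord [leRHS]mulr_natl.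
  have a0 : 0 <= (1 + tau^-1) * (B * S).
    by rewrite mulr_ge0// addr_ge0// invr_ge0 ltW.
  move=> /(ler_wpM2l a0)/le_trans; apply.
  have := ler_wpM2r S0 epsB; lra.
move: q0.
have st2 : \int[lebesgue_rV d]_(z in cube d L) ((W z + Num.sqrt E / 2) * csq (uc c (embed z)))
   <= (B * S) * K.
  have mu' : measurable_fun [set: 'rV[R]_d] (fun z => csq (uc c (embed z))).
    apply: (@measurableT_comp _ _ _ _ _ _ (fun z => csq (uc c z))).
      exact: measurable_csq_test.
    exact: measurable_embed.
  rewrite -(RintegralZl _ (mcube d) IWm).
  apply: (le_Rintegral (mcube d) _ (rintZ _ (mcube d) IWm)).
    apply: (rint_mul_bounded (B := B * S) (mcube d) IWm); first exact: measurable_funTS.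
    by move=> z _; rewrite (ger0_norm (csq_ge0 _)); exact: b1.
  by move=> z _; rewrite mulrC; apply: ler_wpM2r; [exact: Wm0|exact: b1].
have M0 : 0 <= \int[lebesgue_rV n]_(z in cube n L) csq (uc c z).
  by apply: Rintegral_ge0 => z _; exact: csq_ge0.
move: step1 st2 M0; set I1 := \int[_]_(z in _) _; set I2 := \int[_]_(z in _) _;
set I3 := \int[_]_(z in _) _; set I4 := \int[_]_(z in _) _.
move=> q1 q2 q3 q4; apply: (le_trans (lerD q1 (lexx _))).
have := ler_wpM2r S0 tauBK; have := ler_wpM2l (ltW tau0) q2; have := ler_wpM2l (ltW tau0) q4.
have := mulr_ge0 (ltW tau0) (mulr_ge0 (ltW E0) q3).
have := mulr_ge0 (ltW tau0) (mulr_ge0 (ltW delta0) S0); lra.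
Qed.

End count_cube.

Section count_magnetic.
Context {R : realType}.
Local Notation C := (cplx R).

Lemma le1_powR (x p : R) : 0 <= x -> 1 <= p -> x <= 1 + x `^ p.
Proof.
move=> x0 p1; have [x1|x1] := leP x 1.
  by rewrite (le_trans x1)// lerDl powR_ge0.
apply: (@le_trans _ _ (x `^ p)); last by rewrite lerDr.
by rewrite -[leLHS]powRr1// ler_powR// ltW.
Qed.

Lemma notin_cube n (L : R) (z : 'rV[R]_n) : ~ cube n L z -> exists k, L <= `|z ord0 k|.
Proof.
move=> /existsNP[k kz]; exists k; rewrite leNgt; apply/negP => zL; apply: kz.
by move: zL; rewrite ltr_norml => /andP[/ltW -> ->].
Qed.

Lemma cube_compact n (L : R) :
  compact [set z : 'rV[R]_n | forall k, `[- L, L]%classic (z ord0 k)].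
Proof.
apply: (@rV_compact _ _ (fun=> `[- L, L]%classic)) => k; exact: segment_compact.
Qed.

Lemma L2loc_coord n m (A : 'rV[R]_n -> 'rV[R]_m) k : L2loc A ->
  measurable_fun [set: 'rV[R]_n] (fun z => A z ord0 k).
Proof. by move=> [mA _]; exact: (measurableT_comp (measurable_coord k)). Qed.

Lemma L2loc_cube n m (A : 'rV[R]_n -> 'rV[R]_m) (L : R) k : L2loc A ->
  rint (lebesgue_rV n) (cube n L) (fun z => A z ord0 k ^+ 2).
Proof.
move=> LA; have mAk := L2loc_coord k LA; have [mA IA] := LA.
have mc : measurable (cube n L : set 'rV[R]_n) by exact: measurable_box.
apply/integrableP; split.
  by apply/measurable_EFinP; apply: measurable_funTS; exact: measurable_funX.
have fin := IA _ k (@cube_compact n L).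
apply: le_lt_trans fin.
under eq_integral do rewrite /= ger0_norm ?sqr_ge0//.
apply: ge0_subset_integral => //.
- have -> : [set z : 'rV[R]_n | forall k, `[- L, L]%classic (z ord0 k)] =
     \bigcap_(k in [set: 'I_n]) ((fun z : 'rV[R]_n => z ord0 k) @^-1` `[- L, L]%classic).
    apply/seteqP; split => z H; first by move=> j _; exact: (H j).
    by move=> j; exact: (H j I).
  apply: fin_bigcap_measurable; first exact: finite_finset.
  move=> j _.
  by rewrite -[X in measurable X]setTI; apply: measurable_coord.
- by apply/measurable_EFinP; apply: measurable_funTS; exact: measurable_funX.
- by move=> z _; rewrite lee_fin sqr_ge0.
- by move=> z zL j /=; rewrite in_itv/=; have /andP[-> /ltW ->] := zL j.
Qed.

Lemma magnetic_formE d A (v : 'rV[R]_d -> R) (u : 'rV[R]_(d + 1) -> C) :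
  magnetic_form A v u = \int[lebesgue_rV (d + 1)]_z kinetic A u z +
    \int[lebesgue_rV d]_x (v x * csq (u (embed x))).
Proof.
rewrite /magnetic_form; congr (_ + _); apply: eq_Rintegral => z _.
  by apply: eq_bigr => k _; rewrite momentum_csq.
by rewrite -cmod_sq.
Qed.

(** Outside a cube containing all supports every integrand built from the family vanishes, so local
    integrability of A^2 and v is enough. W itself is integrable there because it is at most 1 +
    W^(d + s). *)
Theorem count_magnetic (d N : nat) (u : 'I_N -> 'rV[R]_(d + 1) -> C)
    (A : 'rV[R]_(d + 1) -> 'rV[R]_(d + 1)) (v W : 'rV[R]_d -> R) (E s delta : R) :
  0 < E -> 0 <= s -> 0 < d%:R - 1 + s -> 0 < delta ->
  (forall j, test_function (u j)) -> L2loc A ->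
  (forall L, rint (lebesgue_rV d) (cube d L) v) ->
  (forall x, 0 <= W x) -> measurable_fun [set: 'rV[R]_d] W ->
  (forall x, - v x <= W x + Num.sqrt E / 2) ->
  rint (lebesgue_rV d) setT (fun x => W x `^ (d%:R + s)) ->
  (forall c : 'I_N -> C,
    magnetic_form A v (fun z => \sum_j c j * u j z) +
    E * \int[lebesgue_rV (d + 1)]_z csq (\sum_j c j * u j z) <=
    - (delta * \sum_j csq (c j))) ->
  N%:R <= count_const d s * E `^ (- s / 2) *
    \int[lebesgue_rV d]_x (W x `^ (d%:R + s)).
Proof.
move=> E0 s0 beta0 delta0 tu LA Iv W0 mW vW IWp ineq.
have [r r0 ur] := test_family_support tu.
pose L := r + 2.
have L0 : 0 < L by rewrite addr_gt0.
have mc n : measurable (cube n L : set 'rV[R]_n) by exact: measurable_box.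
have fc n : (lebesgue_rV n (cube n L : set 'rV[R]_n) < +oo)%E by exact: fin_box.
have IWc : rint (lebesgue_rV d) (cube d L) (fun x => W x `^ (d%:R + s)).
  by apply: integrableS IWp => //; exact: mc.
have p1 : 1 <= d%:R + s by have := beta0; lra.
have IW : rint (lebesgue_rV d) (cube d L) W.
  apply: (rint_le (mc d) (rintD (mc d) (rint_cst 1 (mc d) (fc d)) IWc)).
    exact: measurable_funTS.
  by move=> x _; rewrite ger0_norm// le1_powR.
have out (c : 'I_N -> C) (z : 'rV[R]_(d + 1)) : ~ cube (d + 1) L z ->
    \sum_j c j * u j z = 0 /\ forall k, cgrad (fun z => \sum_j c j * u j z) k z = 0.
  move=> /notin_cube[k Lk]; apply: ur; exists k; apply: le_trans Lk.
  by rewrite lerDl.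
have outd (x : 'rV[R]_d) : ~ cube d L x -> ~ cube (d + 1) L (embed x).
  by apply: contra_not => H k; have := H (lshift 1 k); rewrite row_mxEl.
apply: (@le_trans _ _ (count_const d s * E `^ (- s / 2) *
    \int[lebesgue_rV d]_(x in cube d L) (W x `^ (d%:R + s)))); last first.
  apply: ler_wpM2l.
    by apply: mulr_ge0; [apply: mulr_ge0; [apply: lattice_const_ge0; exact: ltW|]|];
      exact: powR_ge0.
  rewrite [leLHS]Rintegral_mkcond; apply: le_Rintegral => //.
    apply: (rint_support (mc d)); first by move=> x xD; rewrite patchE memNset.
    apply: (eq_integrable (mc d) _ _ _ IWc) => x xD.
    by rewrite /= patchE xD.
  move=> x _; rewrite patchE; case: ifP => // _; exact: powR_ge0.
apply: (@count_cube _ d N u A W r L E s delta) => //.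
- by move=> k; exact: L2loc_coord.
- by move=> k; exact: L2loc_cube.
move=> c; have := ineq c; rewrite magnetic_formE.
have [tuc _] := test_function_sum c tu.
rewrite (@Rintegral_support _ _ _ _ (cube (d + 1) L) (kinetic _ _)); last first.
  move=> z /(out c)[z0 zk]; rewrite /kinetic big1// => k _.
  by rewrite z0 zk mulr0 subr0 csq0.
rewrite (@Rintegral_support _ _ _ _ (cube (d + 1) L) (fun z => csq _)); last first.
  by move=> z /(out c)[-> _]; rewrite csq0.
rewrite (@Rintegral_support _ _ _ _ (cube d L) (fun z => v z * _)); last first.
  by move=> z /outd/(out c)[-> _]; rewrite csq0 mulr0.
have [B B0 [b1 b2 _]] := test_function_bounds tuc.
have mu' : measurable_fun [set: 'rV[R]_d] (fun z => csq (\sum_j c j * u j (embed z))).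
  apply: (@measurableT_comp _ _ _ _ _ _ (fun z => csq (\sum_j c j * u j z))).
    exact: measurable_csq_test.
  exact: measurable_embed.
have Ivu : rint (lebesgue_rV d) (cube d L) (fun z => v z * csq (\sum_j c j * u j (embed z))).
  apply: (rint_mul_bounded (B := B) (mc d) (Iv L)); first exact: measurable_funTS.
  by move=> z _; rewrite (ger0_norm (csq_ge0 _)); exact: b1.
have IWu : rint (lebesgue_rV d) (cube d L) (fun z => (W z + Num.sqrt E / 2) * csq (\sum_j c j * u j (embed z))).
  apply: (rint_mul_bounded (B := B) (mc d) (rintD (mc d) IW (rint_cst _ (mc d) (fc d)))).
    exact: measurable_funTS.
  by move=> z _; rewrite (ger0_norm (csq_ge0 _)); exact: b1.
have : - (\int[lebesgue_rV d]_(x in cube d L) (v x * csq (\sum_j c j * u j (embed x)))) <=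
   \int[lebesgue_rV d]_(x in cube d L) ((W x + Num.sqrt E / 2) * csq (\sum_j c j * u j (embed x))).
  rewrite -mulN1r -(RintegralZl _ (mc d) Ivu).
  apply: (le_Rintegral (mc d) (rintZ _ (mc d) Ivu) IWu) => x _.
  by rewrite mulN1r -mulNr; apply: ler_wpM2r; [exact: csq_ge0|exact: vW].
lra.
Qed.

End count_magnetic.

(** * Hermitian forms and the closure of a semibounded form *)

Section hermitian_forms.
Context {R : realType} {T : Type}.
Local Notation C := (cplx R).
Implicit Types (D : set (T -> C)) (B : (T -> C) -> (T -> C) -> C) (u w z : T -> C) (a b : C).

Definition lin_closed D := D (fun=> 0) /\
  forall a b u w, D u -> D w -> D (fun x => a * u x + b * w x).

Definition hermitian_form D B :=
  (forall a b u w z, D u -> D w -> D z ->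
     B (fun x => a * u x + b * w x) z = a * B u z + b * B w z) /\
  (forall u w, D u -> D w -> B w u = (B u w)^*).

Section theory.
Variables (D : set (T -> C)) (B : (T -> C) -> (T -> C) -> C).
Hypotheses (Dlin : lin_closed D) (Bherm : hermitian_form D B).

Lemma lin_closedB u w : D u -> D w -> D (fun x => u x - w x).
Proof.
move=> Du Dw; have := Dlin.2 1 (- 1) u w Du Dw.
by under eq_fun do rewrite mul1r mulN1r.
Qed.

Lemma lin_closed_sum n (c : 'I_n -> C) (u : 'I_n -> T -> C) : (forall j, D (u j)) ->
  D (fun x => \sum_j c j * u j x).
Proof.
elim: n c u => [|n IH] c u Du.
  by under eq_fun do rewrite big_ord0; exact: Dlin.1.
under eq_fun do rewrite big_ord_recl -[X in _ + X]mul1r.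
by apply: Dlin.2 => //; exact: (IH (fun j => c (lift ord0 j)) (fun j => u (lift ord0 j))).
Qed.

Lemma form_linr a b u w z : D u -> D w -> D z ->
  B z (fun x => a * u x + b * w x) = a^* * B z u + b^* * B z w.
Proof.
move=> Du Dw Dz; have Dc := Dlin.2 a b u w Du Dw.
by rewrite (Bherm.2 _ _ Dc Dz) Bherm.1// conjD !conjM -!Bherm.2.
Qed.

Lemma formB u w z : D u -> D w -> D z -> B (fun x => u x - w x) z = B u z - B w z.
Proof.
move=> Du Dw Dz; have := Bherm.1 1 (- 1) u w z Du Dw Dz.
by under eq_fun do rewrite mul1r mulN1r; rewrite mul1r mulN1r.
Qed.

Lemma formBr u w z : D u -> D w -> D z -> B z (fun x => u x - w x) = B z u - B z w.
Proof.
move=> Du Dw Dz; rewrite (Bherm.2 _ _ (lin_closedB Du Dw) Dz) formB//.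
by rewrite conjD conjN -!Bherm.2.
Qed.

Lemma form0 z : D z -> B (fun=> 0) z = 0.
Proof.
move=> Dz; have D0 := Dlin.1; have := Bherm.1 0 0 _ _ z D0 D0 Dz.
by under eq_fun do rewrite !mul0r addr0; rewrite !mul0r addr0.
Qed.

Lemma form_suml n (c : 'I_n -> C) (u : 'I_n -> T -> C) z : (forall j, D (u j)) -> D z ->
  B (fun x => \sum_j c j * u j x) z = \sum_j c j * B (u j) z.
Proof.
move=> + Dz; elim: n c u => [|n IH] c u Du.
  by under eq_fun do rewrite big_ord0; rewrite big_ord0 form0.
under eq_fun do rewrite big_ord_recl -[X in _ + X]mul1r.
rewrite Bherm.1//; last exact: lin_closed_sum.
by rewrite big_ord_recl mul1r (IH (fun j => c (lift ord0 j)) (fun j => u (lift ord0 j))).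
Qed.

Lemma form_sum n (c : 'I_n -> C) (u : 'I_n -> T -> C) : (forall j, D (u j)) ->
  B (fun x => \sum_j c j * u j x) (fun x => \sum_j c j * u j x) =
  \sum_j \sum_k c j * (c k)^* * B (u j) (u k).
Proof.
move=> Du; rewrite form_suml//; last exact: lin_closed_sum.
apply: eq_bigr => j _; rewrite (Bherm.2 _ _ (lin_closed_sum _ Du) (Du j)) form_suml//.
rewrite conj_sum mulr_sumr; apply: eq_bigr => k _.
by rewrite conjM -Bherm.2// mulrA.
Qed.

Lemma form_diag u : D u -> B u u = rc (re (B u u)).
Proof.
move=> Du; apply: cplx_eq; rewrite ?im_rc//.
by have /(congr1 im) := Bherm.2 u u Du Du; rewrite im_conj; lra.
Qed.

Lemma form_comb a b u w : D u -> D w ->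
  re (B (fun x => a * u x + b * w x) (fun x => a * u x + b * w x)) =
  csq a * re (B u u) + csq b * re (B w w) + 2 * re (a * b^* * B u w).
Proof.
move=> Du Dw; rewrite Bherm.1//; last exact: Dlin.2.
rewrite !form_linr// (form_diag Du) (form_diag Dw) (Bherm.2 u w Du Dw).
by rewrite /csq !reimE; ring.
Qed.

Hypothesis Bpos : forall u, D u -> 0 <= re (B u u).

(** Positivity of the form at (q + e) u - z w. The additional e > 0 allows a division that q = 0
    would forbid, and is removed at the end. *)
Lemma form_cauchy_schwarz u w : D u -> D w ->
  csq (B u w) <= re (B u u) * re (B w w).
Proof.
move=> Du Dw; set p := re (B u u); set q := re (B w w); set z := B u w.
have p0 : 0 <= p by exact: Bpos.
have q0 : 0 <= q by exact: Bpos.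
have key e : 0 < e -> csq z <= (q + e) * p.
  move=> e0; have := Bpos (Dlin.2 (rc (q + e)) (- z) u w Du Dw).
  rewrite form_comb// csq_rc csqN -/p -/q -/z conjN.
  have -> : re (rc (q + e) * - z^* * z) = - ((q + e) * csq z).
    by rewrite /csq !reimE; ring.
  move=> H; have qe : 0 < q + e by rewrite ltr_wpDl.
  rewrite -(ler_pM2l qe); have := csq_ge0 z; nra.
have [p00|p1] := eqVneq p 0.
  by have := key 1 ltr01; rewrite p00 mulr0 mul0r.
rewrite mulrC; apply/ler_addgt0Pr => e e0; have pp : 0 < p by rewrite lt_def p1.
have := key (e / p) (divr_gt0 e0 pp); rewrite mulrDl divfK//.
Qed.

Lemma form_comb_le a b u w : D u -> D w ->
  re (B (fun x => a * u x + b * w x) (fun x => a * u x + b * w x)) <=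
  2 * csq a * re (B u u) + 2 * csq b * re (B w w).
Proof.
move=> Du Dw; have := Bpos (Dlin.2 a (- b) u w Du Dw).
rewrite !form_comb// csqN conjN mulrN mulNr reN; lra.
Qed.

Lemma csq1 : csq 1 = 1 :> R.
Proof. by rewrite /csq re1 im1 expr1n expr0n addr0. Qed.

Lemma formB_le u w : D u -> D w ->
  re (B (fun x => u x - w x) (fun x => u x - w x)) <= 2 * re (B u u) + 2 * re (B w w).
Proof.
move=> Du Dw; have := @form_comb_le 1 (- 1) u w Du Dw.
under eq_fun do rewrite mul1r mulN1r.
by rewrite csqN csq1 !mulr1.
Qed.

Lemma formD_le u w : D u -> D w ->
  re (B (fun x => u x + w x) (fun x => u x + w x)) <= 2 * re (B u u) + 2 * re (B w w).
Proof.
move=> Du Dw; have := @form_comb_le 1 1 u w Du Dw.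
under eq_fun do rewrite !mul1r.
by rewrite csq1 !mulr1.
Qed.

End theory.
End hermitian_forms.

Section L2_theory.
Context d (T : measurableType d) {R : realType} (mu : {measure set T -> \bar R}).
Local Notation C := (cplx R).
Implicit Types (u w : T -> C).

Lemma Lfun2P (f : T -> R) : f \in Lfun mu 2%:E <->
  measurable_fun setT f /\ rint mu setT (fun x => f x ^+ 2).
Proof.
split => [|[mf If]].
  by move=> /[dup] /Lfun2_integrable_sqr If; rewrite inE => /andP[]; rewrite inE.
rewrite inE; apply/andP; split; first by rewrite inE.
rewrite inE/= /finite_norm unlock poweR_lty//.
have := integrable_lty measurableT If.
by under eq_integral do rewrite /= -real_normK ?num_real// -powR_mulrn//.
Qed.

Lemma L2CP u : L2C mu u <-> [/\ measurable_fun setT (re \o u), measurable_fun setT (im \o u) &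
  rint mu setT (fun x => csq (u x))].
Proof.
split => [[/Lfun2P[m1 I1] /Lfun2P[m2 I2]]|[m1 m2 Iu]].
  by split => //; exact: (rintD measurableT I1 I2).
split; apply/Lfun2P; split => //.
  apply: (rint_le measurableT Iu); first exact: measurable_funX.
  by move=> x _; rewrite ger0_norm ?sqr_ge0// lerDl sqr_ge0.
apply: (rint_le measurableT Iu); first exact: measurable_funX.
by move=> x _; rewrite ger0_norm ?sqr_ge0// lerDr sqr_ge0.
Qed.

Lemma re_dotL2 u w : re (dotL2 mu u w) = \int[mu]_x re (u x * (w x)^*).
Proof. by []. Qed.

Lemma im_dotL2 u w : im (dotL2 mu u w) = \int[mu]_x im (u x * (w x)^*).
Proof. by []. Qed.

Lemma dotL2_diag u : re (dotL2 mu u u) = \int[mu]_x csq (u x).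
Proof. by rewrite re_dotL2; apply: eq_Rintegral => x _; rewrite mul_conj. Qed.

Lemma dotL2_ge0 u : 0 <= re (dotL2 mu u u).
Proof. by rewrite dotL2_diag; apply: Rintegral_ge0 => x _; exact: csq_ge0. Qed.

Lemma rint_dot u w : L2C mu u -> L2C mu w ->
  rint mu setT (fun x => re (u x * (w x)^*)) /\ rint mu setT (fun x => im (u x * (w x)^*)).
Proof.
move=> /L2CP[mu1 mu2 Iu] /L2CP[mw1 mw2 Iw].
have I2 := rintD measurableT Iu Iw.
split; apply: (rint_le measurableT I2).
- have -> : (fun x => re (u x * (w x)^*)) = fun x => re (u x) * re (w x) + im (u x) * im (w x).
    by apply/funext => x; rewrite !reimE; ring.
  by apply: measurable_funD; apply: measurable_funM.
- move=> x _; rewrite /csq !reimE ler_norml.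
  have := sqr_ge0 (re (u x) - re (w x)); have := sqr_ge0 (im (u x) - im (w x)).
  have := sqr_ge0 (re (u x) + re (w x)); have := sqr_ge0 (im (u x) + im (w x)).
  move=> *; apply/andP; split; nra.
- have -> : (fun x => im (u x * (w x)^*)) = fun x => im (u x) * re (w x) - re (u x) * im (w x).
    by apply/funext => x; rewrite !reimE; ring.
  by apply: measurable_funB; apply: measurable_funM.
- move=> x _; rewrite /csq !reimE ler_norml.
  have := sqr_ge0 (re (u x) - im (w x)); have := sqr_ge0 (im (u x) - re (w x)).
  have := sqr_ge0 (re (u x) + im (w x)); have := sqr_ge0 (im (u x) + re (w x)).
  move=> *; apply/andP; split; nra.
Qed.

Lemma L2C_lin : lin_closed (L2C mu).
Proof.
split.
  apply/L2CP; split; try exact: measurable_cst.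
  under eq_fun do rewrite csq0; exact: (integrable0 _).
move=> a b u w /L2CP[mu1 mu2 Iu] /L2CP[mw1 mw2 Iw].
have m1 : measurable_fun setT (re \o (fun x => a * u x + b * w x)).
  have -> : re \o (fun x => a * u x + b * w x) = fun x =>
      (re a * re (u x) - im a * im (u x)) + (re b * re (w x) - im b * im (w x)).
    by apply/funext => x; rewrite /= !reimE.
  by apply: measurable_funD; apply: measurable_funB; apply: measurable_funM.
have m2 : measurable_fun setT (im \o (fun x => a * u x + b * w x)).
  have -> : im \o (fun x => a * u x + b * w x) = fun x =>
      (re a * im (u x) + im a * re (u x)) + (re b * im (w x) + im b * re (w x)).
    by apply/funext => x; rewrite /= !reimE.
  by apply: measurable_funD; apply: measurable_funD; apply: measurable_funM.
apply/L2CP; split => //.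
apply: (rint_le measurableT (rintD measurableT (rintZ (2 * csq a) measurableT Iu)
   (rintZ (2 * csq b) measurableT Iw))).
  by apply: measurable_funD; apply: measurable_funX.
move=> x _; rewrite (ger0_norm (csq_ge0 _)).
by apply: (le_trans (csqD_le _ _)); rewrite !csqM !mulrA.
Qed.

Lemma dotL2_herm : hermitian_form (L2C mu) (dotL2 mu).
Proof.
split.
  move=> a b u w z Lu Lw Lz.
  have [I1 I2] := rint_dot Lu Lz; have [J1 J2] := rint_dot Lw Lz.
  have mT := @measurableT _ T.
  apply: cplx_eq.
    have -> : re (dotL2 mu (fun x => a * u x + b * w x) z) =
      \int[mu]_x ((re a * re (u x * (z x)^*) + (- im a) * im (u x * (z x)^*)) +
       (re b * re (w x * (z x)^*) + (- im b) * im (w x * (z x)^*))).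
      by rewrite re_dotL2; apply: eq_Rintegral => x _; rewrite !reimE; ring.
    have K1 := rintZ (re a) mT I1; have K2 := rintZ (- im a) mT I2.
    have K3 := rintZ (re b) mT J1; have K4 := rintZ (- im b) mT J2.
    rewrite (RintegralD mT (rintD mT K1 K2) (rintD mT K3 K4)) (RintegralD mT K1 K2) (RintegralD mT K3 K4).
    rewrite (RintegralZl _ mT I1) (RintegralZl _ mT I2) (RintegralZl _ mT J1) (RintegralZl _ mT J2).
    by rewrite !reimE !re_dotL2 !im_dotL2; ring.
  have -> : im (dotL2 mu (fun x => a * u x + b * w x) z) =
      \int[mu]_x ((re a * im (u x * (z x)^*) + im a * re (u x * (z x)^*)) +
       (re b * im (w x * (z x)^*) + im b * re (w x * (z x)^*))).
    by rewrite im_dotL2; apply: eq_Rintegral => x _; rewrite !reimE; ring.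
  have K1 := rintZ (re a) mT I2; have K2 := rintZ (im a) mT I1.
  have K3 := rintZ (re b) mT J2; have K4 := rintZ (im b) mT J1.
  rewrite (RintegralD mT (rintD mT K1 K2) (rintD mT K3 K4)) (RintegralD mT K1 K2) (RintegralD mT K3 K4).
  rewrite (RintegralZl _ mT I1) (RintegralZl _ mT I2) (RintegralZl _ mT J1) (RintegralZl _ mT J2).
  by rewrite !reimE !re_dotL2 !im_dotL2; ring.
move=> u w Lu Lw; have [I1 I2] := rint_dot Lu Lw; have mT := @measurableT _ T.
apply: cplx_eq; rewrite ?re_conj ?im_conj ?re_dotL2 ?im_dotL2.
  by apply: eq_Rintegral => x _; rewrite !reimE; ring.
rewrite -mulN1r -(RintegralZl _ mT I2).
by apply: eq_Rintegral => x _; rewrite !reimE; ring.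
Qed.

Lemma dotL2_ae u u' w : L2C mu u -> L2C mu u' -> L2C mu w -> (u = u' %[ae mu]) ->
  dotL2 mu u w = dotL2 mu u' w.
Proof.
move=> Lu Lu' Lw uu'; have [I1 I2] := rint_dot Lu Lw; have [J1 J2] := rint_dot Lu' Lw.
apply: cplx_eq; rewrite ?re_dotL2 ?im_dotL2.
  rewrite /Rintegral; congr fine.
  apply: (ae_eq_integral _ _ measurableT (measurable_int _ I1) (measurable_int _ J1)).
  by apply: filterS uu' => x /= H _; rewrite H.
rewrite /Rintegral; congr fine.
apply: (ae_eq_integral _ _ measurableT (measurable_int _ I2) (measurable_int _ J2)).
by apply: filterS uu' => x /= H _; rewrite H.
Qed.

Lemma sqdistL2E u w : sqdistL2 mu u w =
  re (dotL2 mu (fun x => u x - w x) (fun x => u x - w x)).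
Proof. by []. Qed.

End L2_theory.

(** * Convergence of complex sequences *)

Section complex_sequences.
Context {R : realType}.
Local Notation C := (cplx R).
Implicit Types (x y : nat -> R) (z w : nat -> C).

Lemma seq_cvg0P x : x @ \oo --> (0 : R) <->
  forall eps, 0 < eps -> exists N, forall n, (N <= n)%N -> `|x n| < eps.
Proof.
split => [/cvgrPdist_lt H eps e0|H].
  by have [N _ HN] := H eps e0; exists N => n Nn; have := HN n Nn; rewrite /= sub0r normrN.
apply/cvgrPdist_lt => eps e0; have [N HN] := H eps e0.
by exists N => // n /= Nn; rewrite sub0r normrN; exact: HN.
Qed.

Lemma seq_cvg0_le x y N0 : (forall n, 0 <= x n) -> (forall n, (N0 <= n)%N -> x n <= y n) ->
  y @ \oo --> (0 : R) -> x @ \oo --> (0 : R).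
Proof.
move=> x0 xy /seq_cvg0P y0; apply/seq_cvg0P => eps /y0[N HN].
exists (maxn N0 N) => n; rewrite geq_max => /andP[N0n Nn].
rewrite ger0_norm//; apply: (le_lt_trans (xy n N0n)).
exact: (le_lt_trans (ler_norm _) (HN n Nn)).
Qed.

Lemma seq_cvg0Z (k : R) x : x @ \oo --> (0 : R) -> (fun n => k * x n) @ \oo --> (0 : R).
Proof.
move=> /seq_cvg0P H; apply/seq_cvg0P => eps e0.
have k0 : 0 < `|k| + 1 by rewrite ltr_wpDl.
have [N HN] := H (eps / (`|k| + 1)) (divr_gt0 e0 k0); exists N => n Nn.
have := HN n Nn; rewrite normrM ltr_pdivlMr// mulrC.
by apply: le_lt_trans; rewrite ler_wpM2r// lerDl.
Qed.

Lemma seq_cvg0D x y : x @ \oo --> (0 : R) -> y @ \oo --> (0 : R) ->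
  (fun n => x n + y n) @ \oo --> (0 : R).
Proof.
move=> /seq_cvg0P hx /seq_cvg0P hy; apply/seq_cvg0P => eps e0.
have [N1 H1] := hx (eps / 2) (divr_gt0 e0 (ltr0n _ 2)).
have [N2 H2] := hy (eps / 2) (divr_gt0 e0 (ltr0n _ 2)).
exists (maxn N1 N2) => n; rewrite geq_max => /andP[n1 n2].
apply: (le_lt_trans (ler_normD _ _)); have := H1 n n1; have := H2 n n2; lra.
Qed.

Definition ccv z (l : C) := (fun n => csq (z n - l)) @ \oo --> (0 : R).

Lemma ccvD z w (l m : C) : ccv z l -> ccv w m -> ccv (fun n => z n + w n) (l + m).
Proof.
move=> zl wm; apply: (seq_cvg0_le (N0 := 0) _ _ (seq_cvg0D (seq_cvg0Z 2 zl) (seq_cvg0Z 2 wm))).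
  by move=> n; exact: csq_ge0.
by move=> n _; rewrite opprD addrACA; exact: csqD_le.
Qed.

Lemma ccvZ (a : C) z (l : C) : ccv z l -> ccv (fun n => a * z n) (a * l).
Proof.
move=> /(seq_cvg0Z (csq a)); rewrite /ccv.
by under [X in _ -> X @ _ --> _]eq_fun do rewrite -mulrBr csqM.
Qed.

Lemma ccv_cst (l : C) : ccv (fun=> l) l.
Proof. by rewrite /ccv; under eq_fun do rewrite subrr csq0; exact: cvg_cst. Qed.

Lemma ccv_sum (I : Type) (r : seq I) (z : I -> nat -> C) (l : I -> C) :
  (forall i, ccv (z i) (l i)) -> ccv (fun n => \sum_(i <- r) z i n) (\sum_(i <- r) l i).
Proof.
move=> zl; elim: r => [|i r IH].
  by rewrite big_nil; under eq_fun do rewrite big_nil; exact: ccv_cst.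
by rewrite big_cons; under eq_fun do rewrite big_cons; exact: ccvD.
Qed.

Lemma ccv_trans z w (l : C) : ccv z l -> (fun n => csq (w n - z n)) @ \oo --> (0 : R) -> ccv w l.
Proof.
move=> zl wz; apply: (seq_cvg0_le (N0 := 0) _ _ (seq_cvg0D (seq_cvg0Z 2 zl) (seq_cvg0Z 2 wz))).
  by move=> n; exact: csq_ge0.
move=> n _; have -> : w n - l = (z n - l) + (w n - z n) by ring.
exact: csqD_le.
Qed.

Lemma seq_cvg_sqr x (l : R) : (fun n => (x n - l) ^+ 2) @ \oo --> (0 : R) -> x @ \oo --> l.
Proof.
move=> /seq_cvg0P H; apply/cvgrPdist_lt => eps e0.
have [N HN] := H (eps ^+ 2) (exprn_gt0 2 e0); exists N => // n /= Nn.
rewrite distrC -(@ltr_pXn2r _ 2)// ?nnegrE// ?(ltW e0)// real_normK ?num_real//.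
by have := HN n Nn; rewrite ger0_norm ?sqr_ge0.
Qed.

Lemma seq_sqr_cvg x (l : R) : x @ \oo --> l -> (fun n => (x n - l) ^+ 2) @ \oo --> (0 : R).
Proof.
move=> /cvgrPdist_lt H; apply/seq_cvg0P => eps e0.
have m0 : 0 < Num.min eps 1 by rewrite lt_min e0 ltr01.
have [N _ HN] := H _ m0; exists N => n Nn; have := HN n Nn.
rewrite /= distrC lt_min => /andP[h1 h2]; rewrite normrX.
apply: le_lt_trans h1; rewrite expr2 ler_piMl// ltW//.
Qed.

Lemma ccv_re z (l : C) : ccv z l -> (fun n => re (z n)) @ \oo --> re l.
Proof.
move=> zl; apply: seq_cvg_sqr; apply: (seq_cvg0_le (N0 := 0) _ _ zl).
  by move=> n; exact: sqr_ge0.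
by move=> n _; rewrite /csq !reimE lerDl sqr_ge0.
Qed.

Lemma ccv_im z (l : C) : ccv z l -> (fun n => im (z n)) @ \oo --> im l.
Proof.
move=> zl; apply: seq_cvg_sqr; apply: (seq_cvg0_le (N0 := 0) _ _ zl).
  by move=> n; exact: sqr_ge0.
by move=> n _; rewrite /csq !reimE lerDr sqr_ge0.
Qed.

Lemma ccv_reim z (l : C) : (fun n => re (z n)) @ \oo --> re l ->
  (fun n => im (z n)) @ \oo --> im l -> ccv z l.
Proof.
move=> hr hi.
have h1 := seq_sqr_cvg hr; have h2 := seq_sqr_cvg hi.
rewrite /ccv (_ : (fun n => csq (z n - l)) =
   fun n => (re (z n) - re l) ^+ 2 + (im (z n) - im l) ^+ 2); first exact: seq_cvg0D.
by apply/funext => n; rewrite /csq !reimE.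
Qed.

Lemma real_cauchy_cvg x : (forall eps : R, 0 < eps -> exists N, forall n m, (N <= n)%N -> (N <= m)%N ->
   `|x n - x m| < eps) -> exists l : R, x @ \oo --> l.
Proof.
move=> H; suff /cvg_ex[l xl] : cvgn x by exists l.
apply: cauchy_cvg; apply/cauchy_ballP => eps e0.
have [N HN] := H eps e0.
exists ([set x n | n in [set n | (N <= n)%N]], [set x n | n in [set n | (N <= n)%N]]) => /=.
  by split; exists N => // n /= Nn; exists n.
by move=> [_ _] /= [[n Nn <-] [m Nm <-]]; rewrite /ball/=; exact: HN.
Qed.

Lemma ccauchy_cvg z : (forall eps : R, 0 < eps -> exists N, forall n m, (N <= n)%N -> (N <= m)%N ->
   csq (z n - z m) < eps) -> exists l : C, ccv z l.
Proof.
move=> H.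
have [a za] : exists a : R, (fun n => re (z n)) @ \oo --> a.
  apply: real_cauchy_cvg => eps e0; have [N HN] := H (eps ^+ 2) (exprn_gt0 2 e0).
  exists N => n m Nn Nm; rewrite -(@ltr_pXn2r _ 2)// ?nnegrE ?(ltW e0)//.
  rewrite real_normK ?num_real//; apply: le_lt_trans (HN n m Nn Nm).
  by rewrite /csq !reimE lerDl sqr_ge0.
have [b zb] : exists b : R, (fun n => im (z n)) @ \oo --> b.
  apply: real_cauchy_cvg => eps e0; have [N HN] := H (eps ^+ 2) (exprn_gt0 2 e0).
  exists N => n m Nn Nm; rewrite -(@ltr_pXn2r _ 2)// ?nnegrE ?(ltW e0)//.
  rewrite real_normK ?num_real//; apply: le_lt_trans (HN n m Nn Nm).
  by rewrite /csq !reimE lerDr sqr_ge0.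
by exists (a +i* b)%C; exact: ccv_reim.
Qed.

End complex_sequences.

Section form_sequences.
Context {R : realType} {T : Type}.
Local Notation C := (cplx R).
Variables (D : set (T -> C)) (B : (T -> C) -> (T -> C) -> C).
Hypotheses (Dlin : lin_closed D) (Bherm : hermitian_form D B).
Hypothesis Bpos : forall u, D u -> 0 <= re (B u u).
Local Notation q u := (re (B u u)).

Lemma form_diff_le u u' w w' : D u -> D u' -> D w -> D w' ->
  csq (B u w - B u' w') <=
  2 * (q (fun x => u x - u' x) * q w) + 2 * (q u' * q (fun x => w x - w' x)).
Proof.
move=> Du Du' Dw Dw'.
have DB := lin_closedB Dlin Du Du'; have DB' := lin_closedB Dlin Dw Dw'.
have -> : B u w - B u' w' = B (fun x => u x - u' x) w + B u' (fun x => w x - w' x).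
  by rewrite (formB Bherm)// (formBr Dlin Bherm)//; ring.
apply: (le_trans (csqD_le _ _)); apply: lerD; rewrite ler_pM2l//.
  exact: (form_cauchy_schwarz Dlin Bherm Bpos).
exact: (form_cauchy_schwarz Dlin Bherm Bpos).
Qed.

(** Both arguments may be replaced by sequences at vanishing form distance. After Cauchy-Schwarz the
    factors that remain are the form at g and at f', and these are the ones assumed bounded. *)
Lemma form_seq_diff (f f' g g' : nat -> T -> C) (M : R) (N0 : nat) :
  (forall n, [/\ D (f n), D (f' n), D (g n) & D (g' n)]) ->
  (forall n, (N0 <= n)%N -> q (g n) <= M) -> (forall n, (N0 <= n)%N -> q (f' n) <= M) ->
  (fun n => q (fun x => f n x - f' n x)) @ \oo --> (0 : R) ->
  (fun n => q (fun x => g n x - g' n x)) @ \oo --> (0 : R) ->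
  (fun n => csq (B (f n) (g n) - B (f' n) (g' n))) @ \oo --> (0 : R).
Proof.
move=> DD gM fM ff gg.
apply: (seq_cvg0_le (N0 := N0) _ _ (seq_cvg0D (seq_cvg0Z (2 * M) ff) (seq_cvg0Z (2 * M) gg))).
  by move=> n; exact: csq_ge0.
move=> n Nn; have [Df Df' Dg Dg'] := DD n.
apply: (le_trans (form_diff_le Df Df' Dg Dg')).
have h1 := Bpos (lin_closedB Dlin Df Df'); have h2 := Bpos (lin_closedB Dlin Dg Dg').
have := ler_wpM2l h1 (gM n Nn); have := ler_wpM2r h2 (fM n Nn); lra.
Qed.

Definition qcauchy (f : nat -> T -> C) := (forall n, D (f n)) /\
  forall eps : R, 0 < eps -> exists N0, forall n m, (N0 <= n)%N -> (N0 <= m)%N ->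
    q (fun x => f n x - f m x) < eps.

Lemma qcauchy_bounded f : qcauchy f -> exists M N0, 0 <= M /\ forall n, (N0 <= n)%N -> q (f n) <= M.
Proof.
move=> [Df cf]; have [N0 HN] := cf 1 ltr01.
exists (2 + 2 * q (f N0)), N0; split; first by rewrite addr_ge0// mulr_ge0// Bpos.
move=> n Nn; have DB := lin_closedB Dlin (Df n) (Df N0).
have := formD_le Dlin Bherm Bpos DB (Df N0).
have := HN n N0 Nn (leqnn _).
by under [in X in _ -> X -> _]eq_fun do rewrite subrK; lra.
Qed.

Lemma qcauchy_comb (a b : C) f g : qcauchy f -> qcauchy g ->
  qcauchy (fun n x => a * f n x + b * g n x).
Proof.
move=> [Df cf] [Dg cg]; split; first by move=> n; exact: Dlin.2.
move=> eps e0.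
have a0 : 0 < 4 * (csq a + 1) by rewrite mulr_gt0// ltr_wpDl// csq_ge0.
have b0 : 0 < 4 * (csq b + 1) by rewrite mulr_gt0// ltr_wpDl// csq_ge0.
have [N1 H1] := cf (eps / (4 * (csq a + 1))) (divr_gt0 e0 a0).
have [N2 H2] := cg (eps / (4 * (csq b + 1))) (divr_gt0 e0 b0).
exists (maxn N1 N2) => n m; rewrite !geq_max => /andP[n1 n2] /andP[m1 m2].
have DB := lin_closedB Dlin (Df n) (Df m); have DB' := lin_closedB Dlin (Dg n) (Dg m).
have := form_comb_le Dlin Bherm Bpos a b DB DB'.
have := H1 n m n1 m1; have := H2 n m n2 m2; rewrite !ltr_pdivlMr//.
rewrite (_ : (fun x => a * (f n x - f m x) + b * (g n x - g m x)) =
   (fun x => a * f n x + b * g n x - (a * f m x + b * g m x))); last first.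
  by apply/funext => x; ring.
have := Bpos DB; have := Bpos DB'; have := csq_ge0 a; have := csq_ge0 b; nra.
Qed.

Lemma qcauchy0 : qcauchy (fun n x => 0).
Proof.
split; first by move=> _; exact: Dlin.1.
move=> eps e0; exists 0%N => n m _ _.
under eq_fun do rewrite subr0.
rewrite (form0 Dlin Bherm) //; exact: Dlin.1.
Qed.

Lemma qcauchy_cvg f g : qcauchy f -> qcauchy g -> exists l : C, ccv (fun n => B (f n) (g n)) l.
Proof.
move=> qf qg; have [M1 [N1 [M10 H1]]] := qcauchy_bounded qf.
have [M2 [N2 [M20 H2]]] := qcauchy_bounded qg.
case: qf => Df cf; case: qg => Dg cg; apply: ccauchy_cvg => eps e0.
have p1 : 0 < 4 * (M2 + 1) by rewrite mulr_gt0// ltr_wpDl.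
have p2 : 0 < 4 * (M1 + 1) by rewrite mulr_gt0// ltr_wpDl.
have [K1 J1] := cf (eps / (4 * (M2 + 1))) (divr_gt0 e0 p1).
have [K2 J2] := cg (eps / (4 * (M1 + 1))) (divr_gt0 e0 p2).
exists (maxn (maxn N1 N2) (maxn K1 K2)) => n m; rewrite !geq_max.
move=> /andP[/andP[n1 n2] /andP[n3 n4]] /andP[/andP[m1 m2] /andP[m3 m4]].
apply: (le_lt_trans (form_diff_le (Df n) (Df m) (Dg n) (Dg m))).
have := J1 n m n3 m3; have := J2 n m n4 m4; rewrite !ltr_pdivlMr//.
have := H1 m m1; have := H2 n n2.
have := Bpos (lin_closedB Dlin (Df n) (Df m)); have := Bpos (lin_closedB Dlin (Dg n) (Dg m)).
have := Bpos (Df m); have := Bpos (Dg n).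
set a := q _; set b := q _; set c := q _; set e := q _ => a0 b0 c0 d0 aM bM h1 h2.
have := ler_wpM2l d0 aM; have := ler_wpM2r c0 bM; nra.
Qed.

End form_sequences.

Section polarization.
Context d (T : measurableType d) {R : realType}.
Local Notation C := (cplx R).
Variables (D : set (T -> C)) (B : (T -> C) -> (T -> C) -> C).
Hypotheses (Dlin : lin_closed D) (Bherm : hermitian_form D B).

Lemma polar_form u w : D u -> D w -> polar (fun u : T -> C => re (B u u)) u w = B u w.
Proof.
move=> Du Dw.
have E (c : C) : re (B (fun x => u x + c * w x) (fun x => u x + c * w x)) =
   re (B u u) + csq c * re (B w w) + 2 * re (c^* * B u w).
  have := form_comb Dlin Bherm 1 c Du Dw.
  by under eq_fun do rewrite mul1r; rewrite csq1 !mul1r.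
rewrite /polar; set z := B u w in E *; set p := re (B u u) in E *; set r := re (B w w) in E *.
have -> : (4%:R^-1 : R[i]) = ((4^-1)%:C)%C by rewrite fmorphV rmorph_nat.
rewrite !big_ord_recl big_ord0 /=.
rewrite !(E (_ : R[i])) /=.
have -> : ('i%C : R[i]) = ci by [].
rewrite /bump /= !addn0 /= !(@exprS (cplx R)) !(@expr0 (cplx R)) !mulr1.
clearbody z p r; apply: cplx_eq; rewrite /csq !reimE !re_ci !im_ci.
  rewrite !(mul0r, mulr0, mul1r, mulr1, subr0, sub0r, add0r, addr0, opprK, oppr0, expr0n, expr1n, sqrrN, mulN1r)/=.
  lra.
rewrite !(mul0r, mulr0, mul1r, mulr1, subr0, sub0r, add0r, addr0, opprK, oppr0, expr0n, expr1n, sqrrN, mulN1r)/=.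
lra.
Qed.

End polarization.

(** * Closability and approximation by test functions *)

Section closable_forms.
Context d (T : measurableType d) {R : realType} (mu : {measure set T -> \bar R}).
Local Notation C := (cplx R).
Variables (D : set (T -> C)) (h : (T -> C) -> R) (B : (T -> C) -> (T -> C) -> C) (K : R).
Hypotheses (Dlin : lin_closed D) (DL : D `<=` L2C mu) (Bherm : hermitian_form D B).
Hypothesis hB : forall u, h u = re (B u u).
Local Notation dot := (dotL2 mu).
Local Notation nsq u := (re (dot u u)).
Hypotheses (K0 : 0 <= K) (semib : forall u, D u -> - (K * nsq u) <= h u).

(** With K + 1 in place of K the form is not merely nonnegative but dominates the L2 norm, so its
    square root is the form norm. *)
Definition shifted_form u w := B u w + rc (K + 1) * dot u w.
Local Notation Q := shifted_form.
Local Notation q u := (re (Q u u)).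

Let dot_herm := @dotL2_herm d T R mu.
Let L2lin := @L2C_lin d T R mu.
Let dot_pos u (_ : L2C mu u) := @dotL2_ge0 d T R mu u.

Lemma shifted_herm : hermitian_form D Q.
Proof.
split=> [a b u w z Du Dw Dz|u w Du Dw].
  rewrite /Q Bherm.1// dot_herm.1; [ring| | |]; exact: DL.
rewrite /Q Bherm.2// dot_herm.2; [|exact: DL|exact: DL].
by rewrite conjD conjM rc_conj.
Qed.

Lemma shifted_diag u : q u = h u + (K + 1) * nsq u.
Proof. by rewrite /Q reD re_rcM hB. Qed.

Lemma shifted_ge u : D u -> nsq u <= q u.
Proof. by move=> /semib; rewrite shifted_diag; lra. Qed.

Lemma shifted_pos u : D u -> 0 <= q u.
Proof. by move=> /shifted_ge; apply: le_trans; exact: dotL2_ge0. Qed.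

Definition L2cv (f : nat -> T -> C) (u : T -> C) :=
  (fun n => nsq (fun x => f n x - u x)) @ \oo --> (0 : R).

(** Smallness of h on differences, which may have either sign, is the same as the Cauchy property in
    the form norm once the sequence converges in L2. *)
Lemma form_convergesP f u : form_converges mu D h f u <->
  [/\ qcauchy D Q f, L2C mu u & L2cv f u].
Proof.
split=> [[Df Lu fu hf]|[[Df qf] Lu fu]]; split=> //.
  split=> // eps e0.
  have e1 : 0 < eps / 2 by rewrite divr_gt0.
  have K1 : 0 < 8 * (K + 1) by rewrite mulr_gt0// ltr_wpDl.
  have [N1 H1] := hf _ e1.
  have [N2 H2] := (seq_cvg0P _).1 fu _ (divr_gt0 e0 K1).
  exists (maxn N1 N2) => n m; rewrite !geq_max => /andP[n1 n2] /andP[m1 m2].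
  rewrite shifted_diag; have := H1 n m n1 m1; have := H2 n n2; have := H2 m m2.
  have Ln := lin_closedB L2lin (DL (Df n)) Lu; have Lm := lin_closedB L2lin (DL (Df m)) Lu.
  have := formB_le L2lin dot_herm dot_pos Ln Lm.
  rewrite (_ : (fun x => f n x - u x - (f m x - u x)) = (fun x => f n x - f m x)); last first.
    by apply/funext => x; ring.
  rewrite !sqdistL2E (ger0_norm (dotL2_ge0 mu (fun x => f n x - u x))).
  rewrite (ger0_norm (dotL2_ge0 mu (fun x => f m x - u x))) => k1 k2 k3 /ltr_normlP[_ k4].
  rewrite ltr_pdivlMr// in k2; rewrite ltr_pdivlMr// in k3; have k0 := K0.
  have := ler_wpM2l (addr_ge0 k0 ler01) k1; lra.
move=> eps e0; have K2 : 0 < K + 2 by rewrite ltr_wpDl.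
have [N HN] := qf _ (divr_gt0 e0 K2).
exists N => n m Nn Nm; have := HN n m Nn Nm; rewrite ltr_pdivlMr//.
have DB := lin_closedB Dlin (Df n) (Df m).
have := shifted_ge DB; have := shifted_diag (fun x => f n x - f m x); have := semib DB.
have := dotL2_ge0 mu (fun x => f n x - f m x).
set a := nsq _; set b := q _; set c := h _ => a0 s1 s2 s3 s4.
rewrite ltr_norml; apply/andP; split; have := K0; nra.
Qed.

Lemma L2cv_comb (a b : C) f g u w : (forall n, L2C mu (f n)) -> (forall n, L2C mu (g n)) ->
  L2C mu u -> L2C mu w -> L2cv f u -> L2cv g w ->
  L2cv (fun n x => a * f n x + b * g n x) (fun x => a * u x + b * w x).
Proof.
move=> Lf Lg Lu Lw fu gw.
apply: (seq_cvg0_le (N0 := 0) _ _ (seq_cvg0D (seq_cvg0Z (2 * csq a) fu) (seq_cvg0Z (2 * csq b) gw))).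
  by move=> n; exact: dotL2_ge0.
move=> n _.
rewrite (_ : (fun x => a * f n x + b * g n x - (a * u x + b * w x)) =
   fun x => a * (f n x - u x) + b * (g n x - w x)); last by apply/funext => x; ring.
exact: (form_comb_le L2lin dot_herm dot_pos _ _ (lin_closedB L2lin (Lf n) Lu) (lin_closedB L2lin (Lg n) Lw)).
Qed.

Lemma L2cv_bounded f u : (forall n, L2C mu (f n)) -> L2C mu u -> L2cv f u ->
  exists M N0, forall n, (N0 <= n)%N -> nsq (f n) <= M.
Proof.
move=> Lf Lu /seq_cvg0P /(_ _ ltr01)[N HN]; exists (2 + 2 * nsq u), N => n Nn.
have := formD_le L2lin dot_herm dot_pos (lin_closedB L2lin (Lf n) Lu) Lu.
under [in X in X -> _]eq_fun do rewrite subrK.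
have := HN n Nn; rewrite ger0_norm ?dotL2_ge0//; lra.
Qed.

Lemma dotL2_cvg f g u w : (forall n, L2C mu (f n)) -> (forall n, L2C mu (g n)) ->
  L2C mu u -> L2C mu w -> L2cv f u -> L2cv g w -> ccv (fun n => dot (f n) (g n)) (dot u w).
Proof.
move=> Lf Lg Lu Lw fu gw; have [M [N0 gM]] := L2cv_bounded Lg Lw gw.
apply: (form_seq_diff (M := Num.max M (nsq u)) (N0 := N0) L2lin dot_herm dot_pos
   (f' := fun=> u) (g' := fun=> w)) => //.
  by move=> n Nn; rewrite le_max gM.
by move=> n _; rewrite le_max lexx orbT.
Qed.

Lemma form_converges_comb (a b : C) f g u w :
  form_converges mu D h f u -> form_converges mu D h g w ->
  form_converges mu D h (fun n x => a * f n x + b * g n x) (fun x => a * u x + b * w x).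
Proof.
move=> /form_convergesP[qf Lu fu] /form_convergesP[qg Lw gw]; apply/form_convergesP; split.
- exact: (qcauchy_comb Dlin shifted_herm shifted_pos).
- exact: L2lin.2.
- apply: L2cv_comb => // n; apply: DL; [exact: qf.1|exact: qg.1].
Qed.

Lemma form_converges_sum N (c : 'I_N -> C) (f : 'I_N -> nat -> T -> C) (u : 'I_N -> T -> C) :
  (forall j, form_converges mu D h (f j) (u j)) ->
  form_converges mu D h (fun n x => \sum_j c j * f j n x) (fun x => \sum_j c j * u j x).
Proof.
elim: N c f u => [|N IH] c f u fu.
  apply/form_convergesP; split.
  - under [X in qcauchy _ _ X]funext do under eq_fun do rewrite big_ord0.
    exact: (qcauchy0 Dlin shifted_herm).
  - by under eq_fun do rewrite big_ord0; exact: L2lin.1.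
  - rewrite /L2cv (_ : (fun n => _) = fun=> 0); first exact: cvg_cst.
    apply/funext => n; under eq_fun do rewrite !big_ord0 subr0.
    by rewrite (form0 L2lin dot_herm)//; exact: L2lin.1.
have H := form_converges_comb (c ord0) 1 (fu ord0)
  (IH (fun j => c (lift ord0 j)) (fun j => f (lift ord0 j)) (fun j => u (lift ord0 j))
    (fun j => fu (lift ord0 j))).
rewrite (_ : (fun n x => _) = fun n x => c ord0 * f ord0 n x +
    1 * \sum_(j < N) c (lift ord0 j) * f (lift ord0 j) n x); last first.
  by apply/funext => n; apply/funext => x; rewrite big_ord_recl mul1r.
rewrite [X in form_converges _ _ _ _ X](_ : _ = fun x => c ord0 * u ord0 x +
    1 * \sum_(j < N) c (lift ord0 j) * u (lift ord0 j) x); last first.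
  by apply/funext => x; rewrite big_ord_recl mul1r.
exact: H.
Qed.

Lemma polarB u w : D u -> D w -> polar h u w = B u w.
Proof.
move=> Du Dw; rewrite -(polar_form Dlin Bherm Du Dw); congr (polar _ u w).
by apply/funext.
Qed.

Definition closable := forall f, qcauchy D Q f -> (fun n => nsq (f n)) @ \oo --> (0 : R) ->
  (fun n => q (f n)) @ \oo --> (0 : R).

(* If a form-Cauchy sequence f with L2-limit 0 had a nonzero form limit, adding
   multiples of it to the approximants would make every number a value of the
   closed form, so that the operator would map u to every element of L2. *)
Lemma closable_of_operator u (kappa : C) : closure_dom mu D h u -> 0 < nsq u ->
  (forall f, form_operator mu D h u f -> dot f u = kappa) -> closable.
Proof.
move=> [phi phiu] u0 uniq f qf f0; have Df := qf.1.
have [l fl] := qcauchy_cvg Dlin shifted_herm shifted_pos qf qf.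
have [/eqP l0|l0] := boolP (l == 0).
  by have := ccv_re fl; rewrite l0 re0.
exfalso; have /form_convergesP[qphi Lu phiu'] := phiu.
have f0' : L2cv f (fun=> 0).
  rewrite /L2cv (_ : (fun n => nsq (fun x => f n x - 0)) = fun n => nsq (f n))//.
  by apply/funext => n; congr (re (dot _ _)); apply/funext => x; exact: subr0.
have all z : L2C mu z -> form_operator mu D h u z.
  move=> Lz; split=> //; first by exists phi.
  move=> w [psi psiw]; have /form_convergesP[qpsi Lw psiw'] := psiw.
  have cv := qcauchy_cvg Dlin shifted_herm shifted_pos.
  have [b0 h0] := cv _ _ qphi qpsi; have [b1 h1] := cv _ _ qf qpsi.
  have [b2 h2] := cv _ _ qphi qf.
  (* Adding b^* f to psi makes [Q (f n) (psi' n)] tend to b1 + b l = 1. The multiple a of f added to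
     phi then moves the limit of [Q (phi' n) (psi' n)] to [zeta], the value that represents
     [dot z w]. Since f tends to 0 in L2, the limits u and w are unchanged. *)
  pose b := (1 - b1) / l; pose zeta := dot z w + rc (K + 1) * dot u w.
  pose a := zeta - b0 - b * b2.
  pose phi' n x := 1 * phi n x + a * f n x; pose psi' n x := 1 * psi n x + b^* * f n x.
  have FC (c : C) g v : form_converges mu D h g v ->
      form_converges mu D h (fun n x => 1 * g n x + c * f n x) v.
    move=> /form_convergesP[qg Lv gv]; apply/form_convergesP; split => //.
      exact: (qcauchy_comb Dlin shifted_herm shifted_pos).
    have := L2cv_comb 1 c (fun n => DL (qg.1 n)) (fun n => DL (Df n)) Lv L2lin.1 gv f0'.
    by under [X in L2cv _ X]eq_fun do rewrite mulr0 addr0 mul1r.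
  have FC1 := FC a phi u phiu; have FC2 := FC b^* psi w psiw.
  have /form_convergesP[q1 _ c1] := FC1; have /form_convergesP[q2 _ c2] := FC2.
  have Qcv : ccv (fun n => Q (phi' n) (psi' n)) zeta.
    have -> : zeta = b0 + b * b2 + a * (b1 + b * l).
      have bl : b * l = 1 - b1 by rewrite /b divfK.
      by rewrite bl addrC [b1 + _]addrC subrK mulr1 /a; ring.
    have -> : (fun n => Q (phi' n) (psi' n)) = fun n =>
       (Q (phi n) (psi n) + b * Q (phi n) (f n)) + a * (Q (f n) (psi n) + b * Q (f n) (f n)).
      apply/funext => n; have Dphi := qphi.1 n; have Dpsi := qpsi.1 n.
      have Dc := Dlin.2 1 b^* _ _ Dpsi (Df n).
      rewrite /phi' /psi' shifted_herm.1// !(form_linr Dlin shifted_herm)//.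
      by rewrite conjCK rmorph1 !mul1r.
    by apply: ccvD; [apply: ccvD => //; exact: ccvZ|apply: ccvZ; apply: ccvD => //; exact: ccvZ].
  have Bcv : ccv (fun n => polar h (phi' n) (psi' n)) (dot z w).
    have -> : dot z w = zeta + (- rc (K + 1)) * dot u w by rewrite /zeta; ring.
    have -> : (fun n => polar h (phi' n) (psi' n)) =
       fun n => Q (phi' n) (psi' n) + (- rc (K + 1)) * dot (phi' n) (psi' n).
      apply/funext => n; rewrite polarB; [|exact: q1.1|exact: q2.1].
      by rewrite /Q; ring.
    apply: ccvD => //; apply: ccvZ; apply: dotL2_cvg => // n; apply: DL.
      exact: q1.1.
    exact: q2.1.
  by exists phi', psi'; split => //; [exact: ccv_re|exact: ccv_im].
(* Both u and 0 would be images of u, so that [dot u u] and [dot 0 u] agree, against [nsq u > 0]. *)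
have e1 := uniq _ (all _ Lu); have e2 := uniq _ (all _ L2lin.1).
rewrite (form0 L2lin dot_herm Lu) in e2.
by move: u0; rewrite e1 -e2 re0 ltxx.
Qed.

Lemma closable_diff f g u : closable -> form_converges mu D h f u -> form_converges mu D h g u ->
  (fun n => q (fun x => f n x - g n x)) @ \oo --> (0 : R).
Proof.
move=> cl fu gu; have /form_convergesP[qfg _ cv] := form_converges_comb 1 (-1) fu gu.
have -> : (fun n => q (fun x => f n x - g n x)) =
    fun n => q (fun x => 1 * f n x + -1 * g n x).
  by apply/funext => n; under [in RHS]eq_fun do rewrite mul1r mulN1r.
apply: cl => //; move: cv; rewrite /L2cv.
have E n : (fun x => 1 * f n x + -1 * g n x - (1 * u x + -1 * u x)) =
    fun x => 1 * f n x + -1 * g n x.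
  have E0 (a b c : C) : 1 * a + -1 * b - (1 * c + -1 * c) = 1 * a + -1 * b by ring.
  by apply/funext => x; exact: E0.
by under eq_fun do rewrite E.
Qed.

(** [closure_val] supplies some pair of approximating sequences. By closability the given sequence
    has vanishing form distance to both, hence the same limit. *)
Lemma closure_limit f u z : closable -> form_converges mu D h f u ->
  closure_val mu D h u u z -> (fun n => h (f n)) @ \oo --> re z.
Proof.
move=> cl fu [phi [psi [phiu psiu zr zi]]].
have zcv : ccv (fun n => polar h (phi n) (psi n)) z by exact: ccv_reim.
have /form_convergesP[qf Lu fu'] := fu; have /form_convergesP[qphi _ phiu'] := phiu.
have /form_convergesP[qpsi _ psiu'] := psiu.
have Qcv : ccv (fun n => Q (phi n) (psi n)) (z + rc (K + 1) * dot u u).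
  rewrite (_ : (fun n => _) = fun n => polar h (phi n) (psi n) + rc (K + 1) * dot (phi n) (psi n)).
    apply: ccvD => //; apply: ccvZ; apply: dotL2_cvg => // n; apply: DL.
      exact: qphi.1.
    exact: qpsi.1.
  by apply/funext => n; rewrite polarB//; [exact: qphi.1|exact: qpsi.1].
have [M1 [N1 [M10 H1]]] := qcauchy_bounded Dlin shifted_herm shifted_pos qf.
have [M2 [N2 [M20 H2]]] := qcauchy_bounded Dlin shifted_herm shifted_pos qphi.
have Qcv' : ccv (fun n => Q (f n) (f n)) (z + rc (K + 1) * dot u u).
  apply: (ccv_trans Qcv).
  apply: (form_seq_diff (M := Num.max M1 M2) (N0 := maxn N1 N2) Dlin shifted_herm shifted_pos).
  - by move=> n; split; [exact: qf.1|exact: qphi.1|exact: qf.1|exact: qpsi.1].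
  - by move=> n; rewrite geq_max => /andP[n1 _]; rewrite le_max H1.
  - by move=> n; rewrite geq_max => /andP[_ n2]; rewrite le_max H2// orbT.
  - exact: closable_diff cl fu phiu.
  - exact: closable_diff cl fu psiu.
have Bcv : ccv (fun n => B (f n) (f n)) z.
  have -> : z = (z + rc (K + 1) * dot u u) + (- rc (K + 1)) * dot u u by ring.
  rewrite (_ : (fun n => _) = fun n => Q (f n) (f n) + (- rc (K + 1)) * dot (f n) (f n)).
    by apply: ccvD => //; apply: ccvZ; apply: dotL2_cvg => // n; apply: DL; exact: qf.1.
  by apply/funext => n; rewrite /Q; ring.
by have := ccv_re Bcv; under eq_fun do rewrite -hB.
Qed.

(** The matrices of h + e * nsq on the approximants converge entry by entry. As there are finitely
    many entries, the convergence is uniform in c relative to the sum of [csq (c j)], and half of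
    the gap (e' - e) * kappa absorbs the error. *)
Lemma test_family_approximation N (g : 'I_N -> T -> C) (e e' kappa : R) : closable ->
  (forall j, closure_dom mu D h (g j)) ->
  (forall c : 'I_N -> C, exists2 F, form_operator mu D h (fun x => \sum_j c j * g j x) F &
    re (dot F (fun x => \sum_j c j * g j x)) <= - (e' * nsq (fun x => \sum_j c j * g j x))) ->
  e < e' -> 0 < kappa ->
  (forall c : 'I_N -> C, kappa * \sum_j csq (c j) <= nsq (fun x => \sum_j c j * g j x)) ->
  exists (phi : 'I_N -> T -> C) (delta : R), [/\ forall j, D (phi j), 0 < delta &
    forall c : 'I_N -> C, h (fun x => \sum_j c j * phi j x) +
      e * nsq (fun x => \sum_j c j * phi j x) <= - (delta * \sum_j csq (c j))].
Proof.
move=> cl dg Hg ee' k0 gram.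
have [phi phig] := choice dg.
have phiP j := (form_convergesP _ _).1 (phig j).
have qphi j : qcauchy D Q (phi j) by have [] := phiP j.
have Dphi j n : D (phi j n) := (qphi j).1 n.
have Lg j : L2C mu (g j) by have [] := phiP j.
pose Z n (j k : 'I_N) : C := B (phi j n) (phi k n) + rc e * dot (phi j n) (phi k n).
have Zcv j k : exists p : C, ccv (fun n => Z n j k) p.
  have [b bcv] := qcauchy_cvg Dlin shifted_herm shifted_pos (qphi j) (qphi k).
  exists (b + (rc e - rc (K + 1)) * dot (g j) (g k)).
  rewrite (_ : (fun n => _) = fun n => Q (phi j n) (phi k n) +
      (rc e - rc (K + 1)) * dot (phi j n) (phi k n)); last first.
    by apply/funext => n; rewrite /Z /Q; ring.
  apply: ccvD => //; apply: ccvZ; apply: dotL2_cvg => //.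
  - by move=> n; exact: DL.
  - by move=> n; exact: DL.
  - by have [] := phiP j.
  - by have [] := phiP k.
have [p pcv] := choice (fun jk : 'I_N * 'I_N => Zcv jk.1 jk.2).
have valE n (c : 'I_N -> C) : h (fun x => \sum_j c j * phi j n x) +
      e * nsq (fun x => \sum_j c j * phi j n x) =
    re (\sum_j \sum_k c j * (c k)^* * Z n j k).
  rewrite hB (form_sum Dlin Bherm)// (form_sum L2lin dot_herm); last by move=> j; exact: DL.
  rewrite -re_rcM -reD; congr (re _); rewrite mulr_sumr -big_split/=; apply: eq_bigr => j _.
  by rewrite mulr_sumr -big_split/=; apply: eq_bigr => k _; rewrite /Z; ring.
pose dl := (e' - e) * kappa.
have dl0 : 0 < dl by rewrite mulr_gt0// subr_gt0.
have lim c : re (\sum_j \sum_k c j * (c k)^* * p (j, k)) <= - (dl * \sum_j csq (c j)).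
  have fc := form_converges_sum c phig.
  have [F [_ LF HF] Fle] := Hg c.
  have dc : closure_dom mu D h (fun x => \sum_j c j * g j x) by eexists; exact: fc.
  have cv1 := closure_limit cl fc (HF _ dc).
  have /form_convergesP[qc Lc cc] := fc.
  have cv2 := ccv_re (dotL2_cvg (fun n => DL (qc.1 n)) (fun n => DL (qc.1 n)) Lc Lc cc cc).
  have cv3 : (fun n => re (\sum_j \sum_k c j * (c k)^* * Z n j k)) @ \oo -->
     re (dot F (fun x => \sum_j c j * g j x)) + e * nsq (fun x => \sum_j c j * g j x).
    under eq_fun do rewrite -valE.
    by apply: cvgD => //; apply: cvgM => //; exact: cvg_cst.
  have cv4 : (fun n => re (\sum_j \sum_k c j * (c k)^* * Z n j k)) @ \oo -->
      re (\sum_j \sum_k c j * (c k)^* * p (j, k)).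
    apply: ccv_re; apply: ccv_sum => j; apply: ccv_sum => k; apply: ccvZ; exact: (pcv (j, k)).
  have -> : re (\sum_j \sum_k c j * (c k)^* * p (j, k)) =
     re (dot F (fun x => \sum_j c j * g j x)) + e * nsq (fun x => \sum_j c j * g j x).
    exact: (cvg_unique _ cv4 cv3).
  have e1 : 0 <= e' - e by rewrite subr_ge0 ltW.
  have := ler_wpM2l e1 (gram c); rewrite /dl; lra.
(* A bound eta on all entries of an N by N matrix bounds its form by eta * N; this choice keeps that
   below dl / 2. *)
pose eta := dl / (2 * (N%:R + 1)).
have N1 : 0 < 2 * (N%:R + 1) :> R by rewrite mulr_gt0// ltr_wpDl.
have eta0 : 0 < eta by rewrite divr_gt0.
have etaN : eta * N%:R <= dl / 2.
  rewrite /eta mulrAC ler_pdivrMr//; have := ltW dl0; lra.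
have [n Hn] : exists n, forall j k, csq (Z n j k - p (j, k)) <= eta ^+ 2.
  have H (jk : 'I_N * 'I_N) : exists n0 : nat, forall n, (n0 <= n)%N ->
      csq (Z n jk.1 jk.2 - p jk) <= eta ^+ 2.
    have [n0 Hn0] := (seq_cvg0P _).1 (pcv jk) _ (exprn_gt0 2 eta0).
    exists n0 => n n0n; have := Hn0 n n0n; rewrite (ger0_norm (csq_ge0 _)); exact: ltW.
  have [f fH] := choice H.
  exists (\max_jk f jk)%N => j k; apply: (fH (j, k)); exact: leq_bigmax.
exists (fun j => phi j n), (dl / 2); split => //; first by rewrite divr_gt0.
move=> c; rewrite valE.
have -> : \sum_j \sum_k c j * (c k)^* * Z n j k =
   \sum_j \sum_k c j * (c k)^* * p (j, k) +
   \sum_j \sum_k c j * (c k)^* * (Z n j k - p (j, k)).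
  rewrite -big_split/=; apply: eq_bigr => j _; rewrite -big_split/=.
  by apply: eq_bigr => k _; ring.
rewrite reD; have := lim c.
suff : re (\sum_j \sum_k c j * (c k)^* * (Z n j k - p (j, k))) <= eta * N%:R * \sum_j csq (c j).
  have S0 : 0 <= \sum_j csq (c j) by apply: sumr_ge0 => j _; exact: csq_ge0.
  have := ler_wpM2r S0 etaN; lra.
rewrite re_sum; apply: (@le_trans _ _ (\sum_(j < N) \sum_(k < N) (eta / 2 * csq (c j) + eta / 2 * csq (c k)))).
  apply: ler_sum => j _; rewrite re_sum; apply: ler_sum => k _.
  apply: (le_trans (ler_norm _)); apply: (le_trans (re_le_cmod _)).
  rewrite !cmodM cmod_conj -!cmod_sq.
  have zeta : cmod (Z n j k - p (j, k)) <= eta.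
    by rewrite -(@ler_pXn2r _ 2)// ?nnegrE ?cmod_ge0 ?(ltW eta0)// cmod_sq.
  have := cmod_ge0 (c j); have := cmod_ge0 (c k).
  set x := cmod (c j); set y := cmod (c k) => y0 x0.
  have := ler_wpM2l (mulr_ge0 x0 y0) zeta; have := mulr_ge0 (ltW eta0) (sqr_ge0 (x - y)).
  nra.
have -> : \sum_(j < N) \sum_(k < N) (eta / 2 * csq (c j) + eta / 2 * csq (c k)) =
   eta * N%:R * \sum_j csq (c j).
  under eq_bigr do rewrite big_split/= sumr_const card_ord -mulr_sumr.
  rewrite big_split/= sumr_const card_ord.
  have aux (a b x : R) : a * (x / 2 * b) + a * (x / 2 * b) = x * a * b by field.
  by rewrite sumrMnl -mulr_sumr -[_ *+ N]mulr_natl aux.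
by [].
Qed.

End closable_forms.

(** * The magnetic form *)

Section magnetic_form.
Context {R : realType} (d : nat).
Local Notation C := (cplx R).
Local Notation n := (d + 1)%N.
Local Notation mu := (lebesgue_rV n).
Local Notation nu := (lebesgue_rV d).
Implicit Types (u w : 'rV[R]_n -> C).
Variables (A : 'rV[R]_n -> 'rV[R]_n) (v : 'rV[R]_d -> R).
Hypotheses (LA : L2loc A) (Iv : forall L, rint nu (cube d L) v).

Definition covariant k u z : C := cgrad u k z - ci * rc (A z ord0 k) * u z.

Definition potential_form u w : C :=
  (\int[nu]_x (v x * re (u (embed x) * (w (embed x))^*)) +i*
   \int[nu]_x (v x * im (u (embed x) * (w (embed x))^*)))%C.

Definition magnetic_bilinear u w : C :=
  (\int[mu]_z (\sum_k re (covariant k u z * (covariant k w z)^*)) +i*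
   \int[mu]_z (\sum_k im (covariant k u z * (covariant k w z)^*)))%C + potential_form u w.

Lemma test_function_cube u : test_function u -> exists2 L, 0 < L &
  forall z, ~ cube n L z -> u z = 0 /\ forall k, cgrad u k z = 0.
Proof.
move=> tu; have [r r0 ur] := test_function_support tu.
by exists r => // z /notin_cube; exact: ur.
Qed.

Lemma test_function_L2C : @test_function R n `<=` L2C mu.
Proof.
move=> u tu; have [L L0 uL] := test_function_cube tu.
have mc : measurable (cube n L : set 'rV[R]_n) by exact: measurable_box.
have fc : (lebesgue_rV n (cube n L : set 'rV[R]_n) < +oo)%E by exact: fin_box.
have [B B0 [b1 _ _]] := test_function_bounds tu.
apply/L2CP; split; [exact: measurable_re_test|exact: measurable_im_test|].
apply: (rint_support mc); first by move=> x /uL[-> _]; exact: csq0.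
apply: (@rint_bounded _ _ _ _ _ _ B mc fc).
  by apply: measurable_funTS; exact: measurable_csq_test.
by move=> x _; rewrite (ger0_norm (csq_ge0 _)); exact: b1.
Qed.

Lemma test_function_closed : lin_closed (@test_function R n).
Proof.
split; first exact: test_function0.
by move=> a b u w tu tw; exact: test_function_lin.
Qed.

Lemma covariant_L2C k u : test_function u -> L2C mu (covariant k u).
Proof.
move=> tu; have [L L0 uL] := test_function_cube tu.
have mc : measurable (cube n L : set 'rV[R]_n) by exact: measurable_box.
have fc : (lebesgue_rV n (cube n L : set 'rV[R]_n) < +oo)%E by exact: fin_box.
have mA := L2loc_coord k LA.
apply/L2CP; split.
- have -> : re \o covariant k u = fun z => re (cgrad u k z) + A z ord0 k * im (u z).
    apply/funext => z; rewrite [LHS]/= /covariant !reimE re_ci im_ci. ring.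
  apply: measurable_funD; first exact: measurable_re_cgrad.
  by apply: measurable_funM => //; exact: measurable_im_test.
- have -> : im \o covariant k u = fun z => im (cgrad u k z) - A z ord0 k * re (u z).
    apply/funext => z; rewrite [LHS]/= /covariant !reimE re_ci im_ci. ring.
  apply: measurable_funB; first exact: measurable_im_cgrad.
  by apply: measurable_funM => //; exact: measurable_re_test.
apply: (rint_support mc).
  by move=> x /uL[u0 g0]; rewrite /covariant u0 g0 mulr0 subr0 csq0.
apply: (@rint_le _ _ _ _ _ _ (kinetic A u)) => //.
- apply: (rint_kinetic mc fc) => //; first by move=> j; exact: L2loc_coord.
  by move=> j; exact: L2loc_cube.
- by apply: measurable_funTS; exact: measurable_csq_kinetic.
- move=> z _; rewrite (ger0_norm (csq_ge0 _)) /kinetic (bigD1 k)//= lerDl.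
  by apply: sumr_ge0 => j _; exact: csq_ge0.
Qed.

Lemma covariant_lin k u w a b : test_function u -> test_function w ->
  covariant k (fun z => a * u z + b * w z) = fun z => a * covariant k u z + b * covariant k w z.
Proof.
by move=> tu tw; apply/funext => z; rewrite /covariant cgrad_lin//; ring.
Qed.

Lemma rint_potential u w : test_function u -> test_function w ->
  rint nu setT (fun x => v x * re (u (embed x) * (w (embed x))^*)) /\
  rint nu setT (fun x => v x * im (u (embed x) * (w (embed x))^*)).
Proof.
move=> tu tw; have [L L0 uL] := test_function_cube tu.
have mc : measurable (cube d L : set 'rV[R]_d) by exact: measurable_box.
have fc : (lebesgue_rV d (cube d L : set 'rV[R]_d) < +oo)%E by exact: fin_box.
have out (x : 'rV[R]_d) : ~ cube d L x -> u (embed x) = 0.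
  move=> xL; suff /uL[] : ~ cube n L (embed x) by [].
  by apply: contra_not xL => H k; have := H (lshift 1 k); rewrite row_mxEl.
have [B1 B10 [b1 _ _]] := test_function_bounds tu.
have [B2 B20 [b2 _ _]] := test_function_bounds tw.
have me := @measurable_embed R d.
have bnd x : csq (u (embed x) * (w (embed x))^*) <= B1 * B2.
  by rewrite csqM csq_conj; apply: ler_pM; rewrite ?csq_ge0.
have m1 : measurable_fun [set: 'rV[R]_d] (fun x => re (u (embed x))).
  by apply: (@measurableT_comp _ _ _ _ _ _ (re \o u)); first exact: measurable_re_test.
have m2 : measurable_fun [set: 'rV[R]_d] (fun x => im (u (embed x))).
  by apply: (@measurableT_comp _ _ _ _ _ _ (im \o u)); first exact: measurable_im_test.
have m3 : measurable_fun [set: 'rV[R]_d] (fun x => re (w (embed x))).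
  by apply: (@measurableT_comp _ _ _ _ _ _ (re \o w)); first exact: measurable_re_test.
have m4 : measurable_fun [set: 'rV[R]_d] (fun x => im (w (embed x))).
  by apply: (@measurableT_comp _ _ _ _ _ _ (im \o w)); first exact: measurable_im_test.
split; apply: (rint_support mc); try by move=> x /out ->; rewrite mul0r ?re0 ?im0 mulr0.
- apply: (rint_mul_bounded (B := Num.sqrt (B1 * B2)) mc (Iv L)).
    apply: measurable_funTS.
    have -> : (fun x => re (u (embed x) * (w (embed x))^*)) =
      fun x => re (u (embed x)) * re (w (embed x)) + im (u (embed x)) * im (w (embed x)).
      by apply/funext => x; rewrite !reimE; ring.
    by apply: measurable_funD; apply: measurable_funM.
  move=> x _; rewrite -sqrtr_sqr ler_wsqrtr//; apply: le_trans (bnd x).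
  by rewrite /csq lerDl sqr_ge0.
- apply: (rint_mul_bounded (B := Num.sqrt (B1 * B2)) mc (Iv L)).
    apply: measurable_funTS.
    have -> : (fun x => im (u (embed x) * (w (embed x))^*)) =
      fun x => im (u (embed x)) * re (w (embed x)) - re (u (embed x)) * im (w (embed x)).
      by apply/funext => x; rewrite !reimE; ring.
    by apply: measurable_funB; apply: measurable_funM.
  move=> x _; rewrite -sqrtr_sqr ler_wsqrtr//; apply: le_trans (bnd x).
  by rewrite /csq lerDr sqr_ge0.
Qed.

Lemma potential_herm : hermitian_form (@test_function R n) potential_form.
Proof.
have mT := @measurableT _ 'rV[R]_d.
split=> [a b u w z tu tw tz|u w tu tw].
  have [I1 I2] := rint_potential tu tz; have [J1 J2] := rint_potential tw tz.
  apply: cplx_eq; rewrite /potential_form [LHS]/=.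
    have K1 := rintZ (re a) mT I1; have K2 := rintZ (- im a) mT I2.
    have K3 := rintZ (re b) mT J1; have K4 := rintZ (- im b) mT J2.
    transitivity (\int[nu]_x ((re a * (v x * re (u (embed x) * (z (embed x))^*)) +
       - im a * (v x * im (u (embed x) * (z (embed x))^*))) +
      (re b * (v x * re (w (embed x) * (z (embed x))^*)) +
       - im b * (v x * im (w (embed x) * (z (embed x))^*))))).
      by apply: eq_Rintegral => x _; rewrite !reimE; ring.
    rewrite (RintegralD mT (rintD mT K1 K2) (rintD mT K3 K4)) (RintegralD mT K1 K2) (RintegralD mT K3 K4).
    rewrite (RintegralZl _ mT I1) (RintegralZl _ mT I2) (RintegralZl _ mT J1) (RintegralZl _ mT J2).
    by rewrite !reimE /=; ring.
  have K1 := rintZ (re a) mT I2; have K2 := rintZ (im a) mT I1.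
  have K3 := rintZ (re b) mT J2; have K4 := rintZ (im b) mT J1.
  transitivity (\int[nu]_x ((re a * (v x * im (u (embed x) * (z (embed x))^*)) +
       im a * (v x * re (u (embed x) * (z (embed x))^*))) +
      (re b * (v x * im (w (embed x) * (z (embed x))^*)) +
       im b * (v x * re (w (embed x) * (z (embed x))^*))))).
    by apply: eq_Rintegral => x _; rewrite !reimE; ring.
  rewrite (RintegralD mT (rintD mT K1 K2) (rintD mT K3 K4)) (RintegralD mT K1 K2) (RintegralD mT K3 K4).
  rewrite (RintegralZl _ mT I1) (RintegralZl _ mT I2) (RintegralZl _ mT J1) (RintegralZl _ mT J2).
  by rewrite !reimE /=; ring.
have [I1 I2] := rint_potential tu tw.
apply: cplx_eq; rewrite ?re_conj ?im_conj /potential_form [LHS]/= [in RHS]/=.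
  by apply: eq_Rintegral => x _; rewrite !reimE; ring.
rewrite -mulN1r -(RintegralZl _ mT I2).
by apply: eq_Rintegral => x _; rewrite !reimE; ring.
Qed.

(** Under one integral sign the sum over k matches [magnetic_form]; as a sum of [dotL2] it inherits
    sesquilinearity and symmetry from L2. *)
Lemma magnetic_bilinearE u w : test_function u -> test_function w ->
  magnetic_bilinear u w =
  \sum_k dotL2 mu (covariant k u) (covariant k w) + potential_form u w.
Proof.
move=> tu tw; rewrite /magnetic_bilinear; congr (_ + _).
have I k := rint_dot (covariant_L2C k tu) (covariant_L2C k tw).
apply: cplx_eq; rewrite ?re_sum ?im_sum [LHS]/= (Rintegral_sum _ measurableT)//.
  by move=> k; have [] := I k.
by move=> k; have [] := I k.
Qed.

Lemma magnetic_herm : hermitian_form (@test_function R n) magnetic_bilinear.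
Proof.
have Dh := @dotL2_herm _ _ R mu.
split=> [a b u w z tu tw tz|u w tu tw].
  have tc := test_function_lin a b tu tw.
  rewrite !magnetic_bilinearE// potential_herm.1//.
  have -> : \sum_k dotL2 mu (covariant k (fun x => a * u x + b * w x)) (covariant k z) =
     a * \sum_k dotL2 mu (covariant k u) (covariant k z) +
     b * \sum_k (dotL2 mu (covariant k w) (covariant k z) : C).
    rewrite !mulr_sumr -big_split/=; apply: eq_bigr => k _.
    by rewrite covariant_lin// Dh.1//; exact: covariant_L2C.
  ring.
rewrite !magnetic_bilinearE// potential_herm.2// conjD; congr (_ + _).
rewrite conj_sum; apply: eq_bigr => k _.
by apply: Dh.2; exact: covariant_L2C.
Qed.

Lemma magnetic_form_diag u : magnetic_form A v u = re (magnetic_bilinear u u).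
Proof.
rewrite magnetic_formE /magnetic_bilinear reD; congr (_ + _); apply: eq_Rintegral => x _.
  by apply: eq_bigr => k _; rewrite mul_conj.
by rewrite mul_conj.
Qed.

End magnetic_form.

Section orthonormal_systems.
Context {R : realType} {T : Type}.
Local Notation C := (cplx R).
Variables (D : set (T -> C)) (B : (T -> C) -> (T -> C) -> C).
Hypotheses (Dlin : lin_closed D) (Bherm : hermitian_form D B).
Hypothesis Bpos : forall u, D u -> 0 <= re (B u u).
Local Notation q u := (re (B u u)).

Lemma form_sum_le n (c : 'I_n -> C) (u : 'I_n -> T -> C) : (forall j, D (u j)) ->
  q (fun x => \sum_j c j * u j x) <= n%:R * \sum_j csq (c j) * q (u j).
Proof.
move=> Du; rewrite (form_sum Dlin Bherm)// re_sum.
apply: (@le_trans _ _ (\sum_(j < n) \sum_(k < n)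
   (2^-1 * (csq (c j) * q (u j)) + 2^-1 * (csq (c k) * q (u k))))).
  apply: ler_sum => j _; rewrite re_sum; apply: ler_sum => k _.
  have := Bpos (Dlin.2 (c j) (- c k) _ _ (Du j) (Du k)).
  rewrite (form_comb Dlin Bherm)// csqN conjN mulrN mulNr reN; lra.
under eq_bigr do rewrite big_split/= sumr_const card_ord -mulr_sumr.
rewrite big_split/= sumr_const card_ord sumrMnl -mulr_sumr -[_ *+ n]mulr_natl.
lra.
Qed.

Lemma orthonormal_sum n (f : 'I_n -> T -> C) (c : 'I_n -> C) : (forall j, D (f j)) ->
  (forall j k, B (f j) (f k) = (j == k)%:R) ->
  q (fun x => \sum_j c j * f j x) = \sum_j csq (c j).
Proof.
move=> Df of_; rewrite (form_sum Dlin Bherm)// re_sum; apply: eq_bigr => j _.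
rewrite (bigD1 j)//= of_ eqxx mulr1 mul_conj big1 ?addr0// => k kj.
by rewrite of_ eq_sym (negbTE kj) mulr0.
Qed.

Lemma orthonormal_project n (f : 'I_n -> T -> C) u : (forall j, D (f j)) ->
  (forall j k, B (f j) (f k) = (j == k)%:R) -> D u ->
  q (fun x => u x - \sum_j B u (f j) * f j x) = q u - \sum_j csq (B u (f j)).
Proof.
move=> Df of_ Du; have DS := lin_closed_sum Dlin (fun j => B u (f j)) Df.
have DB := lin_closedB Dlin Du DS.
rewrite (formB Bherm)// !(formBr Dlin Bherm)// !(reD, reN).
rewrite (Bherm.2 _ _ Du DS) re_conj (orthonormal_sum _ Df of_).
rewrite (_ : re (B u (fun x => \sum_j B u (f j) * f j x)) = \sum_j csq (B u (f j))).
  lra.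
rewrite (Bherm.2 _ _ DS Du) re_conj (form_suml Dlin Bherm)// re_sum.
by apply: eq_bigr => j _; rewrite (Bherm.2 _ _ Du (Df j)) mul_conj.
Qed.

Lemma bessel n (f : 'I_n -> T -> C) u : (forall j, D (f j)) ->
  (forall j k, B (f j) (f k) = (j == k)%:R) -> D u ->
  \sum_j csq (B u (f j)) <= q u.
Proof.
move=> Df of_ Du; rewrite -subr_ge0 -orthonormal_project//; apply: Bpos.
by apply: lin_closedB => //; exact: lin_closed_sum.
Qed.

End orthonormal_systems.

(** * Spectral projections *)

Section spectral_measure.
Context d (T : measurableType d) {R : realType} (mu : {measure set T -> \bar R}).
Local Notation C := (cplx R).
Variables (H : (T -> C) -> (T -> C) -> Prop) (E : set R -> (T -> C) -> (T -> C)).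
Variable nu : (T -> C) -> {measure set (measurableTypeR R) -> \bar R}.
Hypothesis Hspec : spectral_resolution mu H E nu.
Local Notation dot := (dotL2 mu).
Local Notation nsq u := (re (dot u u)).
Local Notation meas B := (measurable (B : set (measurableTypeR R))).

Let dot_herm : hermitian_form (L2C mu) dot := @dotL2_herm d T R mu.
Let L2lin : lin_closed (L2C mu) := @L2C_lin d T R mu.
Let dot_pos u (_ : L2C mu u) : 0 <= nsq u := @dotL2_ge0 d T R mu u.

(** The range of E B in weak form. It is closed under linear combinations without any appeal to
    linearity of E B, which holds only up to almost everywhere equality. *)
Definition in_range (B : set R) f := L2C mu f /\
  forall w, L2C mu w -> dot f (E B w) = dot f w.

Lemma spectral_L2C B u : meas B -> L2C mu u -> L2C mu (E B u).
Proof. by have [[+ _ _ _ _] _ _ _] := Hspec; apply. Qed.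

Lemma spectral_sym B u w : meas B -> L2C mu u -> L2C mu w -> dot (E B u) w = dot u (E B w).
Proof. by have [[_ + _ _ _] _ _ _] := Hspec; apply. Qed.

Lemma spectral_measureE B u : meas B -> L2C mu u -> nu u B = (re (dot (E B u) u))%:E.
Proof. by have [[_ _ _ _ +] _ _ _] := Hspec; apply. Qed.

Lemma in_range_spectral B u : meas B -> L2C mu u -> in_range B (E B u).
Proof.
move=> mB Lu; have LE := spectral_L2C mB Lu; split => // w Lw.
rewrite -(spectral_sym mB LE Lw); apply: dotL2_ae => //; first exact: spectral_L2C.
have [[_ _ _ + _] _ _ _] := Hspec; move=> /(_ B B u mB mB Lu); rewrite setIid.
by apply: filterS => x /= ->.
Qed.

Lemma in_range_fixed B f : meas B -> L2C mu f -> E B f = f %[ae mu] -> in_range B f.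
Proof.
move=> mB Lf fE; split=> // w Lw; rewrite -spectral_sym//.
by apply: dotL2_ae => //; exact: spectral_L2C.
Qed.

Lemma in_range_lin B : meas B -> lin_closed (in_range B).
Proof.
move=> mB; split.
  split; first exact: L2lin.1.
  by move=> w Lw; rewrite !(form0 L2lin dot_herm)//; exact: spectral_L2C.
move=> a b u w [Lu ru] [Lw rw]; split; first exact: L2lin.2.
move=> z Lz; have LE := spectral_L2C mB Lz.
by rewrite !dot_herm.1// ru// rw.
Qed.

Lemma spectral_measure_in_range B f : meas B -> in_range B f -> nu f B = (nsq f)%:E.
Proof. by move=> mB [Lf rf]; rewrite spectral_measureE// spectral_sym// rf. Qed.

Lemma spectral_measureT u : L2C mu u -> nu u setT = (nsq u)%:E.
Proof.
move=> Lu; rewrite spectral_measureE//; congr (re _)%:E; apply: dotL2_ae => //.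
  exact: spectral_L2C.
by have [[_ _ + _ _] _ _ _] := Hspec; apply.
Qed.

Lemma spectral_measure_out B f : meas B -> in_range B f -> nu f (~` B) = 0%E.
Proof.
move=> mB rf.
have : (nu f B + nu f (~` B) = nu f setT)%E.
  by rewrite -measureU ?setUv ?setICr//; exact: measurableC.
rewrite (spectral_measureT rf.1) (spectral_measure_in_range mB rf).
have key (x : R) (y : \bar R) : (0 <= y -> x%:E + y = x%:E -> y = 0)%E.
  by case: y => [y|//|//]; rewrite lee_fin -EFinD => y0 [] yE; congr (_%:E); lra.
exact/key/measure_ge0.
Qed.

Lemma spectral_residual B u : meas B -> L2C mu u ->
  nsq (fun x => u x - E B u x) = nsq u - re (dot (E B u) u).
Proof.
move=> mB Lu; have [LE rE] := in_range_spectral mB Lu.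
have LB := lin_closedB L2lin Lu LE.
rewrite (formB dot_herm)// !(formBr L2lin dot_herm)// rE// -spectral_sym//.
by rewrite !reD !reN; ring.
Qed.

(** The spectral measure of f is carried by [a, b]: the second moment is finite, so f lies in the
    domain, and the first moment is at most b times the total mass. *)
Lemma operator_in_range (a b : R) f : in_range `[a, b] f ->
  exists2 F, H f F & re (dot F f) <= b * nsq f.
Proof.
move=> rf; have Lf := rf.1.
have mB : meas `[a, b] by exact: measurable_itv.
have nuT := spectral_measureT Lf.
have nu0 := spectral_measure_out mB rf.
have fT : (nu f setT < +oo)%E by rewrite nuT ltry.
(* The identity clamped to [a, b]: it agrees with l almost everywhere for [nu f], and being bounded
   it has all the integrability needed. *)
pose g (l : R) : R := Num.min b (Num.max a l).
have gE l : `[a, b]%classic l -> g l = l.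
  by rewrite /= in_itv/= => /andP[al lb]; rewrite /g (max_idPr al) (min_idPr lb).
have gb l : g l <= b by rewrite /g ge_min lexx.
have gB l : `|g l| <= `|a| + `|b|.
  have := ler_norm a; have := ler_norm (- a); have := ler_norm b; have := ler_norm (- b).
  rewrite !normrN /g ler_norml le_min ge_min => h1 h2 h3 h4.
  have h5 := normr_ge0 a; have h6 := normr_ge0 b.
  apply/andP; split; [apply/andP; split; last rewrite le_max|]; apply/orP || lra; left; lra.
have mg : measurable_fun [set: measurableTypeR R] g.
  by apply: measurable_minr => //; apply: measurable_maxr.
have aeB (F G : R -> \bar R) : (forall l, `[a, b]%classic l -> F l = G l) ->
    ae_eq (nu f) setT F G.
  move=> FG; exists (~` `[a, b]); split => //; first exact: measurableC.
  by move=> l /= nFG lB; apply: nFG => _; exact: FG.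
have Ig : rint (nu f) setT g by apply: (@rint_bounded _ _ _ _ _ _ (`|a| + `|b|)).
have Ig2 : rint (nu f) setT (fun l => g l ^+ 2).
  apply: (@rint_bounded _ _ _ _ _ _ ((`|a| + `|b|) ^+ 2)) => //.
    exact: measurable_funX.
  move=> l _; rewrite normrX ler_pXn2r ?nnegrE ?addr_ge0//; exact: gB.
have [_ _ + R4] := Hspec; move=> /(_ f Lf)[_ R3].
have [|F HF] := R3; last exists F => //.
  have -> : (\int[nu f]_l (l ^+ 2)%:E = \int[nu f]_l (g l ^+ 2)%:E)%E; last first.
    exact: integrable_lty Ig2.
  apply: ae_eq_integral => //.
  - by apply/measurable_EFinP; apply: measurable_funX.
  - by apply/measurable_EFinP; apply: measurable_funX.
  - by apply: aeB => l lB; rewrite /= gE.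
rewrite (R4 _ _ HF) re_rc.
have -> : \int[nu f]_l l = \int[nu f]_l g l.
  rewrite /Rintegral; congr fine; apply: ae_eq_integral => //.
  - exact/measurable_EFinP.
  - by apply: aeB => l lB; rewrite /= gE.
have Ib : rint (nu f) setT (fun=> b) by exact: rint_cst.
apply: (le_trans (le_Rintegral measurableT Ig Ib (fun l _ => gb l))).
by rewrite Rintegral_cst//= nuT.
Qed.

End spectral_measure.

(** * Counting by orthonormal systems in a spectral range *)

Section spectral_counting.
Context d (T : measurableType d) {R : realType} (mu : {measure set T -> \bar R}).
Local Notation C := (cplx R).
Variables (H : (T -> C) -> (T -> C) -> Prop) (E : set R -> (T -> C) -> (T -> C)).
Variable nu : (T -> C) -> {measure set (measurableTypeR R) -> \bar R}.
Hypothesis Hspec : spectral_resolution mu H E nu.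
Local Notation dot := (dotL2 mu).
Local Notation nsq u := (re (dot u u)).
Local Notation meas B := (measurable (B : set (measurableTypeR R))).

Let dot_herm : hermitian_form (L2C mu) dot := @dotL2_herm d T R mu.
Let L2lin : lin_closed (L2C mu) := @L2C_lin d T R mu.
Let dot_pos u (_ : L2C mu u) : 0 <= nsq u := @dotL2_ge0 d T R mu u.

Lemma in_range_extend (B : set R) N (f : 'I_N -> T -> C) r : meas B ->
  orthonormalL2 mu f -> (forall j, in_range mu E B (f j)) ->
  in_range mu E B r -> (forall j, dot r (f j) = 0) -> 0 < nsq r ->
  exists g : 'I_N.+1 -> T -> C, orthonormalL2 mu g /\ forall j, in_range mu E B (g j).
Proof.
move=> mB [Lf of_] rf rr rf0 r0.
have rl := in_range_lin Hspec mB.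
pose s := (Num.sqrt (nsq r))^-1.
pose e x := rc s * r x.
have eE : e = fun x => rc s * r x + 0 * r x by apply/funext => x; rewrite mul0r addr0.
have re_ : in_range mu E B e by rewrite eE; exact: rl.2.
have e1 : dot e e = 1.
  rewrite (form_diag dot_herm re_.1) {1 2}eE.
  rewrite (form_comb L2lin dot_herm _ _ rr.1 rr.1) csq0 csq_rc mulrC /s.
  rewrite exprVn sqr_sqrtr ?dotL2_ge0// mulfV ?gt_eqF//.
  by rewrite rmorph0 mulr0 !mul0r re0 mulr0 !addr0 rc1.
have ef j : dot e (f j) = 0.
  by rewrite eE dot_herm.1 ?rf0 ?mulr0 ?addr0//; exact: rr.1.
have fe j : dot (f j) e = 0.
  by rewrite (dot_herm.2 _ _ re_.1 (Lf j)) ef rmorph0.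
exists (fun j => if unlift ord_max j is Some i then f i else e).
split; [split|].
- by move=> j; case: unliftP => [i _|_]; [exact: Lf|exact: re_.1].
- move=> j k; case: (unliftP ord_max j) => [i ->|->]; case: (unliftP ord_max k) => [l ->|->].
  + by rewrite of_ (inj_eq lift_inj).
  + by rewrite fe eq_sym (negbTE (neq_lift _ _)).
  + by rewrite ef (negbTE (neq_lift _ _)).
  + by rewrite e1 eqxx.
- by move=> j; case: unliftP => [i _|_].
Qed.

(* The range is the span of a maximal orthonormal system, which exists because
   the size of such systems is bounded; conclude by Bessel's inequality. *)
Lemma spectral_trace_le (B : set R) (X : R) (e : nat -> T -> C) J : meas B ->
  (forall N (f : 'I_N -> T -> C), orthonormalL2 mu f -> (forall j, in_range mu E B (f j)) ->
     N%:R <= X) ->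
  orthonormalL2 mu e -> \sum_(j < J) re (dot (E B (e j)) (e j)) <= X.
Proof.
move=> mB HX [Le oe].
pose P N := `[< exists f : 'I_N -> T -> C, orthonormalL2 mu f /\ forall j, in_range mu E B (f j) >].
have P0 : exists N, P N.
  exists 0%N; apply/asboolP; exists (fun _ _ => 0); split; last by case.
  by split; case.
have PX N : P N -> (N <= Num.trunc X)%N.
  move=> /asboolP[f [of_ rf]]; have NX := HX N f of_ rf.
  by rewrite -ltnS -(ltr_nat R); apply: (le_lt_trans NX); exact: truncnS_gt.
case: (ex_maxnP P0 PX) => N /asboolP[f [[Lf of_] rf]] Nmax.
have Nle := HX N f (conj Lf of_) rf.
have key u : L2C mu u -> re (dot (E B u) u) = \sum_i csq (dot u (f i)).
  move=> Lu; have rE := in_range_spectral Hspec mB Lu; have LE := rE.1.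
  have dotE i : dot (E B u) (f i) = dot u (f i).
    by rewrite (dot_herm.2 _ _ (Lf i) LE) (rf i).2// -dot_herm.2.
  pose r x := E B u x - \sum_i dot (E B u) (f i) * f i x.
  have rl := in_range_lin Hspec mB.
  have rS := lin_closed_sum rl (fun i => dot (E B u) (f i)) rf.
  have rr : in_range mu E B r by exact: (lin_closedB rl).
  have r0 : nsq r = 0.
    apply/eqP; rewrite eq_le dotL2_ge0 andbT leNgt; apply/negP => r0.
    have rf0 j : dot r (f j) = 0.
      rewrite /r (formB dot_herm) ?(form_suml L2lin dot_herm)//; last exact: rS.1.
      rewrite (bigD1 j)//= of_ eqxx mulr1 big1 ?addr0 ?subrr// => k kj.
      by rewrite of_ (negbTE kj) mulr0.
    have [g [og rg]] := in_range_extend mB (conj Lf of_) rf rr rf0 r0.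
    have : P N.+1 by apply/asboolP; exists g.
    by move=> /Nmax; rewrite ltnn.
  have := orthonormal_project L2lin dot_herm Lf of_ LE; rewrite -/r r0.
  have -> : nsq (E B u) = re (dot (E B u) u).
    by rewrite rE.2.
  under eq_bigr do rewrite dotE.
  lra.
apply: le_trans Nle.
under eq_bigr do rewrite key//.
rewrite exchange_big/= -[leRHS](_ : \sum_(i < N) 1 = _); last first.
  by rewrite sumr_const card_ord.
apply: ler_sum => i _.
have := bessel L2lin dot_herm dot_pos (fun j : 'I_J => Le j) (fun j k => oe j k) (Lf i).
rewrite of_ eqxx re1; apply: le_trans; apply: ler_sum => j _.
by rewrite (dot_herm.2 _ _ (Lf i) (Le j)) csq_conj.
Qed.

Section test_functions.
Variables (D : set (T -> C)) (h : (T -> C) -> R) (B : (T -> C) -> (T -> C) -> C) (K : R).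
Hypotheses (Dlin : lin_closed D) (DL : D `<=` L2C mu) (Bherm : hermitian_form D B).
Hypothesis hB : forall u, h u = re (B u u).
Hypotheses (K0 : 0 <= K) (semib : forall u, D u -> - (K * nsq u) <= h u).
Hypothesis HE : H = form_operator mu D h.

(** The closed windows increase to the half-line, and the squared distance from f to its projection
    is the mass of [nu f] outside the window, so continuity from below applies. *)
Lemma spectral_exhaust (e : R) f (eps : R) : in_range mu E `]-oo, (- e)%R[ f -> 0 < eps ->
  exists m0 : nat, forall m, (m0 <= m)%N ->
    nsq (fun x => f x - E `[- m%:R, - (e + m.+1%:R^-1)] f x) < eps.
Proof.
move=> rf eps0; have Lf := rf.1.
pose F (m : nat) := `[- m%:R, - (e + m.+1%:R^-1)]%classic : set R.
have mF m : meas (F m) by exact: measurable_itv.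
have UF : \bigcup_m F m = `]-oo, (- e)%R[%classic.
  apply/seteqP; split => [l [m _]|l] /=; rewrite /F /= !in_itv/=.
    move=> /andP[_ lm]; apply: (le_lt_trans lm); rewrite ltrN2 ltrDl invr_gt0//.
  move=> le; have el : 0 < - e - l by rewrite subr_gt0.
  exists (Num.trunc (`|l| + (- e - l)^-1)).+1 => //=.
  set m := (Num.trunc _).+1; have mP : `|l| + (- e - l)^-1 < m%:R by exact: truncnS_gt.
  rewrite /F /= in_itv/=; apply/andP; split.
    have := ler_norm (- l); rewrite normrN; have := invr_gt0 (- e - l); rewrite el.
    by move=> /esym; lra.
  have : m.+1%:R^-1 <= - e - l.
    rewrite invf_ple ?posrE// ltW// (lt_trans _ (_ : m%:R < _))// ?ltr_nat//.
    by apply: le_lt_trans mP; rewrite lerDr.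
  by move: (m.+1%:R^-1 : R) => y; lra.
have mlt : meas `]-oo, (- e)%R[ by exact: measurable_itv.
have ndF : nondecreasing_seq F.
  move=> m n mn; apply/subsetPset => l; rewrite /F /= !in_itv/= => /andP[h1 h2].
  apply/andP; split; first by apply: le_trans h1; rewrite lerN2 ler_nat.
  by apply: (le_trans h2); rewrite lerN2 lerD2l lef_pV2 ?posrE ?ler_nat.
have cv := @nondecreasing_cvg_mu _ _ _ (nu f) F mF (bigcup_measurable (fun m _ => mF m)) ndF.
rewrite UF (spectral_measure_in_range Hspec mlt rf) in cv.
have e1 : nsq f - eps < nsq f by rewrite ltrBlDr ltrDl.
have [m0 _ Hm0] := cvgr_gt _ (fine_cvg cv) _ e1.
exists m0 => m m0m; have := Hm0 m m0m.
have -> : (fine \o (nu f \o F)) m = re (dot (E (F m) f) f).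
  by rewrite [LHS]/= (spectral_measureE Hspec (mF m) Lf).
have := spectral_residual Hspec (mF m) Lf; rewrite -/(F m).
set x := re _; set y := re _; set z := re _; lra.
Qed.

(* The projections of the f_j to the spectral window [- m, - e - 1 / (m + 1)] lie in
   the domain of the operator, and the gap 1 / (m + 1) pays for the approximation
   by test functions. *)
Theorem range_test_functions N (f : 'I_N.+1 -> T -> C) (e : R) :
  orthonormalL2 mu f -> (forall j, in_range mu E `]-oo, (- e)%R[ (f j)) ->
  exists (phi : 'I_N.+1 -> T -> C) (delta : R), [/\ forall j, D (phi j), 0 < delta &
    forall c : 'I_N.+1 -> C, h (fun x => \sum_j c j * phi j x) +
      e * nsq (fun x => \sum_j c j * phi j x) <= - (delta * \sum_j csq (c j))].
Proof.
move=> [Lf of_] rf.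
(* The residuals of N + 1 functions at this accuracy add up to at most a quarter of the sum of
   [csq (c j)]. As 1 <= 2 nsq g + 2 / 4 for normalised c, the projected family keeps the lower Gram
   bound 1/4. *)
have eps0 : 0 < (4 * N.+1%:R)^-1 :> R by rewrite invr_gt0 mulr_gt0.
have [m0 Hm0] := choice (fun j => spectral_exhaust (rf j) eps0).
pose m := (\max_j m0 j)%N.
have Hm j := Hm0 j m (leq_bigmax j).
pose b := - (e + m.+1%:R^-1); pose I := `[- m%:R, b]%classic : set R.
have mI : meas I by exact: measurable_itv.
pose g j := E I (f j).
have rg j : in_range mu E I (g j) by exact: (in_range_spectral Hspec).
have Lg j := (rg j).1.
have rl := in_range_lin Hspec mI.
have gram (c : 'I_N.+1 -> C) : 4^-1 * \sum_j csq (c j) <= nsq (fun x => \sum_j c j * g j x).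
  rewrite -(orthonormal_sum L2lin dot_herm c Lf of_).
  have Lr j : L2C mu (fun x => f j x - g j x) by exact: lin_closedB.
  have LS1 := lin_closed_sum L2lin c Lg; have LS2 := lin_closed_sum L2lin c Lr.
  have := formD_le L2lin dot_herm dot_pos LS1 LS2.
  have -> : (fun x => \sum_j c j * g j x + \sum_j c j * (f j x - g j x)) =
      fun x => \sum_j c j * f j x.
    apply/funext => x; rewrite -big_split/=; apply: eq_bigr => j _.
    by rewrite mulrBr addrC subrK.
  have := form_sum_le L2lin dot_herm dot_pos c Lr.
  have : N.+1%:R * \sum_j csq (c j) * nsq (fun x => f j x - g j x) <= 4^-1 * \sum_j csq (c j).
    rewrite !mulr_sumr; apply: ler_sum => j _.
    have := ler_wpM2l (csq_ge0 (c j)) (ltW (Hm j)).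
    set y := nsq _ => hy; have N0 : 0 < N.+1%:R :> R by [].
    apply: (le_trans (ler_wpM2l (ltW N0) hy)).
    move: (N.+1%:R : R) N0 => M M0.
    by rewrite le_eqVlt; apply/orP; left; apply/eqP; field; rewrite gt_eqF.
  rewrite (orthonormal_sum L2lin dot_herm c Lf of_); lra.
have op (c : 'I_N.+1 -> C) : exists2 F, form_operator mu D h (fun x => \sum_j c j * g j x) F &
    re (dot F (fun x => \sum_j c j * g j x)) <=
      - ((e + m.+1%:R^-1) * nsq (fun x => \sum_j c j * g j x)).
  have rc_ := lin_closed_sum rl c rg.
  have [F HF Fle] := operator_in_range Hspec rc_.
  by exists F; [rewrite -HE|rewrite -mulNr].
have opg j : exists F, H (g j) F by have [F HF _] := operator_in_range Hspec (rg j); exists F.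
have dom j : closure_dom mu D h (g j).
  by have [F] := opg j; rewrite HE => -[].
have g0 : 0 < nsq (g ord0).
  have S1 : \sum_(j < N.+1) csq ((j == ord0)%:R : C) = 1.
    by rewrite (bigD1 ord0)//= csq1 big1 ?addr0// => j /negbTE ->; rewrite csq0.
  have := gram (fun j => (j == ord0)%:R); rewrite S1.
  have -> : (fun x => \sum_j (j == ord0)%:R * g j x) = g ord0.
    apply/funext => x; rewrite (bigD1 ord0)//= mul1r big1 ?addr0// => j /negbTE ->.
    by rewrite mul0r.
  by apply: lt_le_trans; rewrite mulr1 invr_gt0.
(* The spectral resolution determines [dot F (g ord0)] as the first moment of the spectral measure,
   whatever F. A nonzero element of the domain is needed here, which is why the family is indexed by
   ['I_N.+1]. *)
have cl : closable mu D B K.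
  apply: (closable_of_operator Dlin DL Bherm hB K0 semib (dom ord0) g0
    (kappa := (\int[nu (g ord0)]_l l)%:C%C)) => F.
  by rewrite -HE => HF; have [_ _ _ +] := Hspec; apply.
have e1 : e < e + m.+1%:R^-1 by rewrite ltrDl invr_gt0.
have k4 : 0 < 4^-1 :> R by rewrite invr_gt0.
exact: (test_family_approximation Dlin DL Bherm hB K0 semib cl dom op e1 k4 gram).
Qed.

End test_functions.
End spectral_counting.

(** * The bounds in terms of the potential *)

Section potentials.
Context {R : realType}.

Lemma geometric_tail (theta : R) (x : nat -> R) n : 1 < theta ->
  (forall i, 0 <= x i) -> (forall i, x i.+1 = theta * x i) ->
  \sum_(i < n.+1) x i <= (1 - theta^-1)^-1 * x n.
Proof.
move=> t1 x0 xS; have t0 : 0 < theta by rewrite (lt_trans ltr01).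
have k0 : 0 < 1 - theta^-1 by rewrite subr_gt0 invf_lt1.
elim: n => [|n IH].
  by rewrite big_ord1 ler_peMl// invf_ge1// gerBl invr_ge0 ltW.
rewrite big_ord_recr/=; apply: (le_trans (lerD IH (lexx _))).
rewrite xS le_eqVlt; apply/orP; left; apply/eqP; field.
by rewrite (gt_eqF t0) /= subr_eq0 gt_eqF.
Qed.

(** An increasing geometric sum is controlled by its last term. Only the largest index satisfying P
    matters: terms after it are zero, and those before it may all be added back. *)
Lemma geometric_cut (theta Y : R) (x : nat -> R) (P : nat -> bool) n : 1 < theta ->
  (forall i, 0 <= x i) -> (forall i, x i.+1 = theta * x i) -> 0 <= Y ->
  (forall i, P i -> x i <= Y) ->
  \sum_(i < n) (if P i then x i else 0) <= (1 - theta^-1)^-1 * Y.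
Proof.
move=> t1 x0 xS Y0 PY; have t0 : 0 < theta by rewrite (lt_trans ltr01).
have k0 : 0 <= (1 - theta^-1)^-1 by rewrite invr_ge0 subr_ge0 invf_le1// ltW.
elim: n => [|n IH]; first by rewrite big_ord0 mulr_ge0.
have [Pn|nPn] := boolP (P n).
  apply: (@le_trans _ _ (\sum_(i < n.+1) x i)).
    by apply: ler_sum => i _; case: ifP.
  by apply: (le_trans (geometric_tail n t1 x0 xS)); rewrite ler_wpM2l// PY.
by rewrite big_ord_recr/= (negbTE nPn) addr0.
Qed.

Variables (d : nat) (s : R) (v : 'rV[R]_d -> R).
Local Notation nu := (lebesgue_rV d).
Local Notation p := (2 * s + d%:R).
Hypotheses (d1 : (1 <= d)%N) (s0 : 0 <= s) (Lv : v \in Lfun nu p%:E).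

Definition negative_part x : R := Num.max (- v x) 0.
Definition excess (E : R) x : R := Num.max (- v x - Num.sqrt E / 2) 0.
Definition count_bound (E : R) : R :=
  count_const d s * E `^ (- s / 2) * \int[nu]_x (excess E x `^ (d%:R + s)).

Let d1R : 1 <= d%:R :> R.
Proof. by rewrite ler1n. Qed.

Let p1 : 1 <= p.
Proof. by have h1 := d1R; have h2 := s0; lra. Qed.

Let q0 : d%:R + s != 0.
Proof. by have h1 := d1R; have h2 := s0; rewrite gt_eqF//; lra. Qed.

Lemma measurable_potential : measurable_fun [set: 'rV[R]_d] v.
Proof. by have := Lv; rewrite inE => /andP[]; rewrite inE. Qed.

Lemma measurable_negative_part : measurable_fun [set: 'rV[R]_d] negative_part.
Proof.
apply: measurable_maxr => //; apply: measurableT_comp => //; exact: measurable_potential.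
Qed.

Lemma measurable_excess E : measurable_fun [set: 'rV[R]_d] (excess E).
Proof.
apply: measurable_maxr => //; apply: measurable_funB => //.
apply: measurableT_comp => //; exact: measurable_potential.
Qed.

Lemma negative_part_ge0 x : 0 <= negative_part x.
Proof. by rewrite le_max lexx orbT. Qed.

Lemma excess_ge0 E x : 0 <= excess E x.
Proof. by rewrite le_max lexx orbT. Qed.

Lemma excess_le E x : excess E x <= negative_part x.
Proof.
rewrite /excess ge_max negative_part_ge0 andbT le_max; apply/orP; left.
by have := sqrtr_ge0 E; lra.
Qed.

Lemma excess0 E x : negative_part x <= Num.sqrt E / 2 -> excess E x = 0.
Proof.
rewrite /negative_part /excess ge_max => /andP[h _].
by apply/max_idPr; lra.
Qed.

Lemma potential_excess E x : - v x <= excess E x + Num.sqrt E / 2.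
Proof.
have : - v x - Num.sqrt E / 2 <= excess E x by rewrite le_max lexx.
lra.
Qed.

Lemma rint_potential_cube L : rint nu (cube d L) v.
Proof.
have mc : measurable (cube d L : set 'rV[R]_d) by exact: measurable_box.
have fc : (nu (cube d L : set 'rV[R]_d) < +oo)%E by exact: fin_box.
have Ip : rint nu (cube d L) (fun x => `|v x| `^ p).
  by apply: integrableS (Lfun_integrable p1 Lv).
apply: (rint_le mc (rintD mc (rint_cst 1 mc fc) Ip)).
  by apply: measurable_funTS; exact: measurable_potential.
by move=> x _; apply: le1_powR.
Qed.

Lemma rint_negative_part : rint nu setT (fun x => negative_part x `^ p).
Proof.
apply: (rint_le measurableT (Lfun_integrable p1 Lv)).
  apply: (measurableT_comp (measurable_powR _)); exact: measurable_negative_part.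
move=> x _; rewrite ger0_norm ?powR_ge0// ge0_ler_powR ?nnegrE ?negative_part_ge0//.
  by have h := p1; lra.
by rewrite /negative_part ge_max normr_ge0 andbT -normrN ler_norm.
Qed.

(** Where the excess is positive, v_- exceeds sqrt E / 2, so v_-^(-s) is at most the value of that
    power at sqrt E / 2. This trades the power d + s, which need not be integrable for v_-, for the
    available power 2 s + d. *)
Lemma excess_powR_le E x : 0 < E ->
  excess E x `^ (d%:R + s) <= (Num.sqrt E / 2) `^ (- s) *
    (if `|negative_part x| <= Num.sqrt E / 2 then 0 else negative_part x `^ p).
Proof.
move=> E0; have c0 : 0 < Num.sqrt E / 2 by rewrite divr_gt0// sqrtr_gt0.
rewrite ger0_norm ?negative_part_ge0//; case: (leP _ (Num.sqrt E / 2)) => vc.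
  by rewrite excess0// powR0// mulr0.
have v0 : 0 < negative_part x by exact: lt_trans vc.
apply: (@le_trans _ _ (negative_part x `^ (d%:R + s))).
  rewrite ge0_ler_powR ?nnegrE ?excess_ge0 ?negative_part_ge0 ?excess_le//.
  by have h1 := d1R; have h2 := s0; lra.
have -> : d%:R + s = - s + p by ring.
rewrite powRD; last by rewrite (gt_eqF v0) implybT.
apply: ler_wpM2r; first exact: powR_ge0.
rewrite !powRN lef_pV2 ?posrE ?powR_gt0//.
by rewrite ge0_ler_powR ?nnegrE ?(ltW c0) ?(ltW v0)// ltW.
Qed.

Lemma rint_excess E : 0 < E -> rint nu setT (fun x => excess E x `^ (d%:R + s)).
Proof.
move=> E0; apply: (rint_le measurableT (rintZ ((Num.sqrt E / 2) `^ (- s)) measurableT rint_negative_part)).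
  apply: (measurableT_comp (measurable_powR _)); exact: measurable_excess.
move=> x _; rewrite ger0_norm ?powR_ge0//; apply: (le_trans (excess_powR_le x E0)).
by apply: ler_wpM2l; [exact: powR_ge0|case: ifP => // _; exact: powR_ge0].
Qed.

Hypothesis beta0 : 0 < d%:R - 1 + s.

Lemma count_const_ge0 : 0 <= count_const d s.
Proof.
by apply: mulr_ge0; [apply: lattice_const_ge0; exact: ltW|exact: powR_ge0].
Qed.

Lemma count_bound_ge0 E : 0 <= count_bound E.
Proof.
apply: mulr_ge0; first by apply: mulr_ge0; [exact: count_const_ge0|exact: powR_ge0].
by apply: Rintegral_ge0 => x _; exact: powR_ge0.
Qed.

(** For large E only the tail of the integral of v_-^p enters, and the other factors stay bounded.
    The resulting E is the constant of semiboundedness of the magnetic form. *)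
Lemma count_bound_lt1 : exists2 E, 0 < E & count_bound E < 1.
Proof.
pose K := count_const d s * 2 `^ s.
have K0 : 0 <= K by apply: mulr_ge0; [exact: count_const_ge0|exact: powR_ge0].
have K1 : 0 < K + 1 by rewrite ltr_wpDl.
have mv := measurable_negative_part.
have e0 : 0 < (K + 1)^-1 by rewrite invr_gt0.
have [m0 Hm0] := rint_tail measurableT rint_negative_part mv (fun x _ => powR_ge0 _ _) e0.
have [It Ht] := Hm0 _ (leqnSn m0); set m := m0.+1 in It Ht.
have mR : 0 < m%:R :> R by rewrite ltr0n.
have m1 : 1 <= m%:R :> R by rewrite ler1n.
(* Makes sqrt E / 2 equal to the cut-off level m of the tail. *)
pose E : R := (2 * m%:R) ^+ 2.
have m20 : 0 < 2 * m%:R :> R by rewrite mulr_gt0.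
have E0 : 0 < E by rewrite exprn_gt0.
have sE : Num.sqrt E / 2 = m%:R.
  by rewrite /E sqrtr_sqr gtr0_norm// mulrAC divff// mul1r.
exists E => //; rewrite /count_bound.
have st : \int[nu]_x (excess E x `^ (d%:R + s)) <= m%:R `^ (- s) * (K + 1)^-1.
  apply: (@le_trans _ _ (m%:R `^ (- s) *
    \int[nu]_x (if `|negative_part x| <= m%:R then 0 else negative_part x `^ p))).
    rewrite -(RintegralZl _ measurableT It).
    apply: (le_Rintegral measurableT (rint_excess E0) (rintZ _ measurableT It)) => x _.
    by have := excess_powR_le x E0; rewrite sE.
  by rewrite ler_wpM2l ?powR_ge0// ltW.
have m_le1 (y : R) : 1 <= y -> y `^ (- s) <= 1.
  move=> y1; rewrite -[leRHS](powRr0 y) ler_powR// oppr_le0; exact: s0.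
have EK : count_const d s * E `^ (- s / 2) <= K.
  rewrite ler_wpM2l ?count_const_ge0//.
  have -> : E `^ (- s / 2) = (2 * m%:R) `^ (- s).
    by rewrite /E -powR_mulrn ?(ltW m20)// -powRrM; congr (_ `^ _); field.
  apply: (@le_trans _ _ 1); first by apply: m_le1; lra.
  by rewrite -[leLHS](powRr0 2) ler_powR ?ler1n//; exact: s0.
have st2 : m%:R `^ (- s) * (K + 1)^-1 <= (K + 1)^-1.
  by rewrite ler_piMl ?(ltW e0)// m_le1.
have c0 : 0 <= count_const d s * E `^ (- s / 2).
  by apply: mulr_ge0; [exact: count_const_ge0|exact: powR_ge0].
apply: (@le_lt_trans _ _ (K * (K + 1)^-1)); last by rewrite ltr_pdivrMr// mul1r ltrDl.
apply: ler_pM => //; last exact: le_trans st st2.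
by apply: Rintegral_ge0 => x _; exact: powR_ge0.
Qed.

Lemma count_bound0 E : 0 < E -> s = 0 ->
  count_bound E <= count_const d s * \int[nu]_x (negative_part x `^ p).
Proof.
move=> E0 s00; rewrite /count_bound {2}s00 oppr0 mul0r powRr0 mulr1.
apply: ler_wpM2l; first exact: count_const_ge0.
apply: (le_Rintegral measurableT (rint_excess E0) rint_negative_part) => x _.
rewrite s00 mulr0 add0r addr0 ge0_ler_powR ?nnegrE ?excess_ge0 ?negative_part_ge0 ?excess_le//.
Qed.

(** 4^s is 2^s from the weights (2 t)^s of the dyadic sum times 2^s from the cut-off t < (2 y)^2;
    the last factor sums the geometric series of ratio 2^(s/2). *)
Definition trace_const : R :=
  count_const d s * 4 `^ s * (1 - (2 `^ (s / 2))^-1)^-1.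

Lemma dyadic_count_bound (a : R) n : 0 < s -> 0 < a ->
  \sum_(i < n) (2 * (a * 2 ^+ i)) `^ s * count_bound (a * 2 ^+ i) <=
    trace_const * \int[nu]_x (negative_part x `^ p).
Proof.
move=> sp a0.
pose t i : R := a * 2 ^+ i.
have t0 i : 0 < t i by rewrite mulr_gt0 ?exprn_gt0.
have theta1 : 1 < 2 `^ (s / 2) :> R.
  have sp2 : 0 < s / 2 by rewrite divr_gt0.
  have n1 : (1 : R) \is Num.nneg by rewrite nnegrE.
  have n2 : (2 : R) \is Num.nneg by rewrite nnegrE.
  by have := gt0_ltr_powR sp2 n1 n2; rewrite powR1 ltr1n; apply.
have It i := rint_excess (t0 i).
have E1 : \sum_(i < n) (2 * t i) `^ s * count_bound (t i) =
   count_const d s * 2 `^ s * \int[nu]_x (\sum_(i < n) t i `^ (s / 2) * excess (t i) x `^ (d%:R + s)).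
  rewrite (Rintegral_sum _ measurableT); last by move=> i; exact: rintZ.
  rewrite mulr_sumr; apply: eq_bigr => i _.
  rewrite (RintegralZl _ measurableT (It i)) /count_bound powRM ?(ltW (t0 i))//.
  have -> : t i `^ (s / 2) = t i `^ s * t i `^ (- s / 2).
    rewrite -powRD; last by rewrite (gt_eqF (t0 i)) implybT.
    by congr (_ `^ _); field.
  ring.
rewrite E1.
have c0 : 0 <= count_const d s * 2 `^ s.
  by apply: mulr_ge0; [exact: count_const_ge0|exact: powR_ge0].
have k0 : 0 <= (1 - (2 `^ (s / 2))^-1)^-1 :> R.
  by rewrite invr_ge0 subr_ge0 invf_le1 ?(lt_trans ltr01 theta1)// ltW.
apply: (@le_trans _ _ (count_const d s * 2 `^ s *
    ((1 - (2 `^ (s / 2))^-1)^-1 * 2 `^ s * \int[nu]_x (negative_part x `^ p)))); last first.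
  have -> : trace_const = count_const d s * (2 `^ s * 2 `^ s) * (1 - (2 `^ (s / 2))^-1)^-1.
    by rewrite /trace_const -powRM// -natrM.
  by rewrite le_eqVlt; apply/orP; left; apply/eqP; ring.
apply: ler_wpM2l => //; rewrite -(RintegralZl _ measurableT rint_negative_part).
apply: (le_Rintegral measurableT _ (rintZ _ measurableT rint_negative_part)).
  by apply: rint_sum => // i; exact: rintZ.
move=> x _; set y := negative_part x; have y0 : 0 <= y by exact: negative_part_ge0.
apply: (@le_trans _ _ (\sum_(i < n) (if t i < (2 * y) ^+ 2 then t i `^ (s / 2) else 0) * y `^ (d%:R + s))).
  apply: ler_sum => i _; case: ltP => ty.
    apply: ler_wpM2l; first exact: powR_ge0.
    rewrite ge0_ler_powR ?nnegrE ?excess_ge0 ?excess_le//.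
    by have h1 := d1R; have h2 := s0; lra.
  rewrite excess0 ?powR0 ?mulr0 ?mul0r// -/y ler_pdivlMr// mulrC.
  by rewrite -(ler_sqr _ _) ?nnegrE ?sqrtr_ge0 ?mulr_ge0// sqr_sqrtr// ltW.
rewrite -mulr_suml.
have Y0 : 0 <= (2 * y) `^ s by exact: powR_ge0.
have := @geometric_cut (2 `^ (s / 2)) ((2 * y) `^ s) (fun i => t i `^ (s / 2))
  (fun i => t i < (2 * y) ^+ 2) n theta1 (fun i => powR_ge0 _ _) _ Y0 _.
have h1 i : t i.+1 `^ (s / 2) = 2 `^ (s / 2) * t i `^ (s / 2).
  have -> : t i.+1 = 2 * t i by rewrite /t exprS; ring.
  by rewrite powRM ?(ltW (t0 i)).
have h2 i : t i < (2 * y) ^+ 2 -> t i `^ (s / 2) <= (2 * y) `^ s.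
  move=> ty; have -> : (2 * y) `^ s = ((2 * y) ^+ 2) `^ (s / 2).
    by rewrite -powR_mulrn ?mulr_ge0// -powRrM; congr (_ `^ _); field.
  by rewrite ge0_ler_powR ?nnegrE ?divr_ge0 ?sqr_ge0 ?(ltW (t0 i))// ltW.
move=> /(_ h1 h2) /(ler_wpM2r (powR_ge0 y (d%:R + s)))/le_trans; apply.
have -> : y `^ p = y `^ s * y `^ (d%:R + s).
  rewrite -powRD; last by have h3 := d1R; rewrite gt_eqF//; lra.
  by congr (_ `^ _); ring.
by rewrite powRM// le_eqVlt; apply/orP; left; apply/eqP; ring.
Qed.

End potentials.

(** * A dyadic layer-cake formula *)

Section layer_cake.
Context {R : realType} (m : {measure set (measurableTypeR R) -> \bar R}).

(** The term of the largest i with a 2^i < x already dominates x^gamma, because x <= a 2^(i+1); the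
    constant a^gamma covers x <= a. *)
Lemma dyadic_powR_le (gamma a x : R) n : 0 <= gamma -> 0 < a -> 0 <= x -> x <= a * 2 ^+ n ->
  x `^ gamma <= a `^ gamma +
    \sum_(i < n) (if a * 2 ^+ i < x then (2 * (a * 2 ^+ i)) `^ gamma else 0).
Proof.
move=> g0 a0 x0; elim: n => [|n IH].
  by rewrite expr0 mulr1 big_ord0 addr0 => xa; rewrite ge0_ler_powR ?nnegrE ?(ltW a0).
move=> xa; rewrite big_ord_recr/=; case: ltP => xn.
  have an : 0 <= 2 * (a * 2 ^+ n) by rewrite !mulr_ge0 ?exprn_ge0 ?(ltW a0).
  apply: (@le_trans _ _ ((2 * (a * 2 ^+ n)) `^ gamma)).
    by rewrite ge0_ler_powR ?nnegrE//; move: xa; rewrite exprS mulrCA.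
  rewrite addrA lerDr addr_ge0 ?powR_ge0//; apply: sumr_ge0 => i _.
  by case: ifP => // _; exact: powR_ge0.
by rewrite addr0; exact: IH.
Qed.

(** Integration of [dyadic_powR_le]. The vanishing mass below - a 2^n stops the scale after n
    levels. *)
Lemma negative_power_le (gamma a M : R) n : 0 <= gamma -> 0 < a -> m setT = M%:E ->
  m `]-oo, (- (a * 2 ^+ n))%R[%classic = 0%E ->
  (\int[m]_l (Num.max (- l) 0 `^ gamma)%:E <= (a `^ gamma * M +
    \sum_(i < n) (2 * (a * 2 ^+ i)) `^ gamma * fine (m `]-oo, (- (a * 2 ^+ i))%R[%classic))%:E)%E.
Proof.
move=> g0 a0 mT mn.
pose B (t : R) := `]-oo, (- t)%R[%classic : set (measurableTypeR R).
have mB t : measurable (B t) by exact: measurable_itv.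
have fT : (m setT < +oo)%E by rewrite mT ltry.
pose g i (l : R) : R := (2 * (a * 2 ^+ i)) `^ gamma * \1_(B (a * 2 ^+ i)) l.
pose G (l : R) : R := a `^ gamma + \sum_(i < n) g i l.
have I1 i : rint m setT (\1_(B (a * 2 ^+ i)) : R -> R).
  apply: (@rint_bounded _ _ _ _ _ _ 1) => //.
  by move=> l _; rewrite indicE; case: (_ \in _); rewrite ?normr1 ?normr0.
have Ig i : rint m setT (g i) by exact: rintZ.
have Is : rint m setT (fun l => \sum_(i < n) g i l) by exact: rint_sum.
have Ic : rint m setT (fun=> a `^ gamma) by exact: rint_cst.
have IG : rint m setT G by exact: (rintD measurableT Ic Is).
have GE : (\int[m]_l (G l)%:E = (a `^ gamma * M +
    \sum_(i < n) (2 * (a * 2 ^+ i)) `^ gamma * fine (m (B (a * 2 ^+ i))))%:E)%E.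
  rewrite -[LHS]fineK; last exact: integrable_fin_num.
  congr (_%:E); rewrite [LHS](RintegralD measurableT Ic Is) Rintegral_cst//= mT; congr (_ + _).
  rewrite (Rintegral_sum _ measurableT (fun i : 'I_n => Ig i)); apply: eq_bigr => i _.
  rewrite (RintegralZl _ measurableT (I1 i)); congr (_ * _).
  by rewrite /Rintegral; congr fine; rewrite integral_indic ?setIT.
rewrite -GE; apply: ae_ge0_le_integral => //.
- by move=> l _; rewrite lee_fin powR_ge0.
- apply/measurable_EFinP; apply: (measurableT_comp (measurable_powR _)).
  by apply: measurable_maxr.
- move=> l _; rewrite lee_fin addr_ge0 ?powR_ge0// sumr_ge0// => i _.
  by rewrite mulr_ge0 ?powR_ge0// indicE.
- exact: measurable_int IG.
exists (B (a * 2 ^+ n)); split => //.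
move=> l /= nle; rewrite /B /= in_itv/= ltNge; apply/negP => ln; apply: nle => _.
rewrite lee_fin; apply: (@le_trans _ _ _ _ _ (dyadic_powR_le g0 a0 _ _ (n := n))).
- by rewrite le_max lexx orbT.
- by rewrite ge_max lerNl ln mulr_ge0 ?exprn_ge0// ltW.
rewrite lerD2l; apply: ler_sum => i _; rewrite /g indicE.
have ai : 0 < a * 2 ^+ i by rewrite mulr_gt0 ?exprn_gt0.
rewrite lt_max [_ < 0]ltNge (ltW ai) orbF ltrNr.
case: ifP => li; first by rewrite mem_set ?mulr1//= /B /= in_itv.
by rewrite mulr_ge0 ?powR_ge0.
Qed.

End layer_cake.

(** * Spectral bounds for the magnetic operator *)

Section magnetic_counting.
Context {R : realType}.
Local Notation C := (cplx R).
Variables (d : nat) (s : R) (v : 'rV[R]_d -> R) (A : 'rV[R]_(d + 1) -> 'rV[R]_(d + 1)).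
Local Notation nu := (lebesgue_rV d).
Local Notation mu := (lebesgue_rV (d + 1)).
Local Notation p := (2 * s + d%:R).
Local Notation dot := (dotL2 mu).
Local Notation nsq u := (re (dot u u)).
Local Notation h := (magnetic_form A v).
Hypotheses (d1 : (1 <= d)%N) (s0 : 0 <= s) (Lv : v \in Lfun nu p%:E).
Hypotheses (beta0 : 0 < d%:R - 1 + s) (LA : L2loc A).

Let Iv L : rint nu (cube d L) v := rint_potential_cube d1 s0 Lv L.
Let Bherm := magnetic_herm LA Iv.
Let hB := magnetic_form_diag A v.
Let Dlin := @test_function_closed R d.
Let DL := @test_function_L2C R d.
Let dot_herm : hermitian_form (L2C mu) dot := @dotL2_herm _ _ R mu.
Let L2lin : lin_closed (L2C mu) := @L2C_lin _ _ R mu.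
Let dot_pos u (_ : L2C mu u) : 0 <= nsq u := @dotL2_ge0 _ _ R mu u.

Lemma test_family_count N (u : 'I_N -> 'rV[R]_(d + 1) -> C) (E delta : R) : 0 < E -> 0 < delta ->
  (forall j, test_function (u j)) ->
  (forall c : 'I_N -> C, h (fun z => \sum_j c j * u j z) + E * nsq (fun z => \sum_j c j * u j z) <=
     - (delta * \sum_j csq (c j))) ->
  N%:R <= count_bound s v E.
Proof.
move=> E0 delta0 tu ineq.
apply: (count_magnetic E0 s0 beta0 delta0 tu LA Iv (excess_ge0 v E) (measurable_excess Lv E)
  (potential_excess v E) (rint_excess d1 s0 Lv E0)) => c.
by have := ineq c; rewrite dotL2_diag.
Qed.

(** The counting bound for a family of one function: a violation would give 1 <=
    [count_bound s v E]. *)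
Lemma magnetic_semibounded E u : 0 < E -> count_bound s v E < 1 -> test_function u ->
  - (E * nsq u) <= h u.
Proof.
move=> E0 X1 tu; rewrite leNgt; apply/negP => hu.
have delta0 : 0 < - (h u + E * nsq u) by lra.
have := @test_family_count 1 (fun=> u) E _ E0 delta0 (fun=> tu) _.
suff H : forall c : 'I_1 -> C, h (fun z => \sum_j c j * u z) + E * nsq (fun z => \sum_j c j * u z) <=
     - (- (h u + E * nsq u) * \sum_j csq (c j)).
  by move=> /(_ H); rewrite leNgt X1.
move=> c; rewrite !hB (form_sum Dlin Bherm c (fun j : 'I_1 => tu)).
rewrite (form_sum L2lin dot_herm c (fun j : 'I_1 => DL tu)) !big_ord1 mul_conj !re_rcM; lra.
Qed.

Variables (E : set R -> ('rV[R]_(d + 1) -> C) -> ('rV[R]_(d + 1) -> C)).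
Variable m : ('rV[R]_(d + 1) -> C) -> {measure set (measurableTypeR R) -> \bar R}.
Hypothesis Hspec : spectral_resolution mu (magnetic_operator A v) E m.

Lemma spectral_test_functions N (f : 'I_N.+1 -> 'rV[R]_(d + 1) -> C) (e : R) :
  orthonormalL2 mu f -> (forall j, in_range mu E `]-oo, (- e)%R[ (f j)) ->
  exists (phi : 'I_N.+1 -> 'rV[R]_(d + 1) -> C) (delta : R),
    [/\ forall j, test_function (phi j), 0 < delta &
    forall c : 'I_N.+1 -> C, h (fun x => \sum_j c j * phi j x) +
      e * nsq (fun x => \sum_j c j * phi j x) <= - (delta * \sum_j csq (c j))].
Proof.
have [K K0 K1] := count_bound_lt1 d1 s0 Lv beta0.
apply: (range_test_functions Hspec Dlin DL Bherm hB (ltW K0)) => // u tu.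
exact: magnetic_semibounded.
Qed.

Lemma count_below N (f : 'I_N -> 'rV[R]_(d + 1) -> C) (e : R) : 0 < e ->
  orthonormalL2 mu f -> (forall j, in_range mu E `]-oo, (- e)%R[ (f j)) ->
  N%:R <= count_bound s v e.
Proof.
case: N f => [|N] f e0 of_ rf; first exact: count_bound_ge0.
have [phi [delta [tphi delta0 H]]] := spectral_test_functions of_ rf.
exact: (test_family_count e0 delta0 tphi H).
Qed.

(** For s = 0 the bound stays finite as the energy tends to 0, and the approximating test functions
    retain a margin [delta] even at the threshold 0. A small e > 0 is paid for out of that margin
    and brings the family within reach of [test_family_count]. *)
Lemma count_negative N (f : 'I_N -> 'rV[R]_(d + 1) -> C) : s = 0 ->
  orthonormalL2 mu f -> (forall j, in_range mu E `]-oo, 0%R[ (f j)) ->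
  N%:R <= count_const d s * \int[nu]_x (negative_part v x `^ p).
Proof.
move=> s00; case: N f => [|N] f of_ rf.
  apply: mulr_ge0; first exact: count_const_ge0.
  by apply: Rintegral_ge0 => x _; exact: powR_ge0.
have rf' j : in_range mu E `]-oo, (- 0)%R[ (f j) by rewrite oppr0.
have [phi [delta [tphi delta0 H]]] := spectral_test_functions of_ rf'.
(* M bounds the squared norm of a combination by the sum of [csq (c j)], so that e times that norm
   costs at most half of [delta]. *)
pose M := N.+1%:R * \sum_j nsq (phi j).
have M0 : 0 <= M by rewrite mulr_ge0// sumr_ge0// => j _; exact: dotL2_ge0.
have M1 : 0 < 2 * (M + 1) by rewrite mulr_gt0// ltr_wpDl.
pose e := delta / (2 * (M + 1)).
have e0 : 0 < e by rewrite divr_gt0.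
apply: le_trans (count_bound0 d1 s0 Lv beta0 e0 s00).
apply: (@test_family_count _ phi e (delta / 2) e0 _ tphi); first exact: divr_gt0.
move=> c; have := H c; rewrite mul0r addr0.
have Lphi j : L2C mu (phi j) := DL (tphi j).
have := form_sum_le L2lin dot_herm dot_pos c Lphi.
set S := \sum_j csq (c j); have S0 : 0 <= S by apply: sumr_ge0 => j _; exact: csq_ge0.
have : N.+1%:R * \sum_j csq (c j) * nsq (phi j) <= M * S.
  rewrite /M -mulrA ler_pM2l// mulr_suml; apply: ler_sum => j _.
  rewrite mulrC ler_wpM2l ?dotL2_ge0// /S (bigD1 j)//= lerDl.
  by apply: sumr_ge0 => i _; exact: csq_ge0.
set y := nsq _ => h1 h2 h3.
have h4 : e * y <= delta / 2 * S.
  apply: (@le_trans _ _ (e * ((M + 1) * S))).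
    by rewrite ler_pM2l// (le_trans h2)// (le_trans h1)// ler_wpM2r// lerDl.
  rewrite mulrA ler_wpM2r// /e le_eqVlt; apply/orP; left; apply/eqP; field.
  by rewrite gt_eqF// ltr_wpDl.
lra.
Qed.

(** Interchanging the sums over basis vectors and dyadic levels turns each level into a partial
    trace of a spectral projection, which [count_below] bounds. The term a^s of the layer-cake
    formula contributes J * a^s; the scale starts so low that this is below [eps]. *)
Lemma spectral_trace (e : nat -> 'rV[R]_(d + 1) -> C) J : 0 < s -> orthonormalL2 mu e ->
  (\sum_(0 <= j < J) \int[m (e j)]_l (Num.max (- l) 0 `^ s)%:E <=
   (trace_const d s * \int[nu]_x (negative_part v x `^ p))%:E)%E.
Proof.
move=> sp oe; have [Le oe'] := oe.
have [K K0 K1] := count_bound_lt1 d1 s0 Lv beta0.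
have mI (t : R) : measurable (`]-oo, t[%classic : set (measurableTypeR R)) by exact: measurable_itv.
have trace (t X : R) : (forall N (f : 'I_N -> 'rV[R]_(d + 1) -> C), orthonormalL2 mu f ->
     (forall i, in_range mu E `]-oo, t[ (f i)) -> N%:R <= X) ->
    forall J, \sum_(j < J) fine (m (e j) `]-oo, t[%classic) <= X.
  move=> HX J'; have := spectral_trace_le Hspec J' (mI t) HX oe.
  apply: le_trans; apply: ler_sum => j _.
  by rewrite (spectral_measureE Hspec (mI _) (Le j)).
(* A natural number below 1 is 0: there are no functions in the range for ]-oo, -K[, hence no
   spectral mass there. *)
have zero j : m (e j) `]-oo, (- K)%R[%classic = 0%E.
  have H : forall N (f : 'I_N -> 'rV[R]_(d + 1) -> C), orthonormalL2 mu f ->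
     (forall i, in_range mu E `]-oo, (- K)%R[ (f i)) -> N%:R <= 0 :> R.
    move=> N f of_ rf; have := count_below K0 of_ rf; case: N f of_ rf => // N f _ _ NX.
    by have := le_lt_trans NX K1; rewrite ltrn1.
  have mE := spectral_measureE Hspec (mI (- K)) (Le j).
  have : fine (m (e j) `]-oo, (- K)%R[%classic) <= 0.
    apply: le_trans (trace _ _ H j.+1); rewrite big_ord_recr/= lerDr.
    by apply: sumr_ge0 => i _; exact: fine_ge0.
  have key (y : \bar R) (x : R) : y = x%:E -> (0 <= y)%E -> fine y <= 0 -> y = 0%E.
    by move=> ->; rewrite lee_fin /= => x0 x1; congr (_%:E); apply/eqP; rewrite eq_le x0 x1.
  exact/(key _ _ mE)/measure_ge0.
apply/lee_addgt0Pr => eps eps0.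
have J1 : 0 < J%:R + 1 :> R by rewrite ltr_wpDl.
(* The largest start of the scale with (J + 1) * b^s <= eps. The actual start [a] is K divided by a
   power of 2, so that the scale ends exactly at K. *)
pose b := (eps / (J%:R + 1)) `^ s^-1.
have b0 : 0 < b by rewrite powR_gt0// divr_gt0.
pose n := (Num.trunc (K / b)).+1.
pose a := K / 2 ^+ n.
have p2 : 0 < 2 ^+ n :> R by rewrite exprn_gt0.
have a0 : 0 < a by rewrite divr_gt0.
have ab : a <= b.
  rewrite ler_pdivrMr// mulrC -ler_pdivrMr//.
  apply: (le_trans (ltW (truncnS_gt _))); rewrite -/n -natrX ler_nat.
  by rewrite ltnW// ltn_expl.
have as_ : a `^ s * J%:R <= eps.
  apply: (@le_trans _ _ (b `^ s * J%:R)).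
    by rewrite ler_wpM2r// ge0_ler_powR ?nnegrE ?(ltW a0) ?(ltW b0).
  rewrite /b -powRrM mulVf ?gt_eqF// powRr1 ?divr_ge0 ?(ltW eps0) ?(ltW J1)//.
  by rewrite mulrAC ler_pdivrMr// ler_pM2l// lerDl.
have aK : a * 2 ^+ n = K by rewrite divfK// gt_eqF.
have mT j : m (e j) setT = 1%:E.
  by rewrite (spectral_measureT Hspec (Le j)) oe' eqxx.
have mK j : m (e j) `]-oo, (- (a * 2 ^+ n))%R[%classic = 0%E by rewrite aK zero.
rewrite big_mkord; pose F (j : nat) : R := a `^ s * 1 +
  \sum_(i < n) (2 * (a * 2 ^+ i)) `^ s * fine (m (e j) `]-oo, (- (a * 2 ^+ i))%R[%classic).
apply: (@le_trans _ _ (\sum_(j < J) (F j)%:E)%E).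
  by apply: lee_sum => j _; exact: (negative_power_le (ltW sp) a0 (mT j) (mK j)).
rewrite sumEFin -EFinD lee_fin big_split/= sumr_const card_ord mulr1 addrC.
apply: lerD; last by rewrite -[leLHS]mulr_natr.
rewrite exchange_big/=.
apply: le_trans (dyadic_count_bound d1 s0 Lv beta0 n sp a0).
apply: ler_sum => i _; rewrite -mulr_sumr; apply: ler_wpM2l; first exact: powR_ge0.
apply: trace => N f of_ rf; apply: (count_below _ of_ rf).
by rewrite mulr_gt0// exprn_gt0.
Qed.

End magnetic_counting.

Theorem theorem2p10 (R : realType) (d : nat) (gamma : R) :
  (1 <= d)%N -> 0 <= gamma -> (d = 1%N -> 0 < gamma) ->
  exists S : R,
    forall (v : 'rV[R]_d -> R) (A : 'rV[R]_(d + 1) -> 'rV[R]_(d + 1)),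
      v \in Lfun (lebesgue_rV d) (2 * gamma + d%:R)%:E ->
      L2loc A ->
      forall t : \bar R,
        is_tr_neg (lebesgue_rV (d + 1)) (magnetic_operator A v) gamma t ->
        (t <= S%:E * \int[lebesgue_rV d]_x
                       (Num.max (- v x) 0 `^ (2 * gamma + d%:R))%:E)%E.
Proof.
move=> d1 g0 gd1.
have beta0 : 0 < d%:R - 1 + gamma.
  move: d1; rewrite leq_eqVlt => /orP[/eqP dE|d2].
    by rewrite -dE subrr add0r; apply: gd1.
  by rewrite ltr_pwDl// subr_gt0 ltr1n.
exists (if gamma == 0 then count_const d gamma else trace_const d gamma) => v A Lv LA t.
have IE : (\int[lebesgue_rV d]_x (Num.max (- v x) 0 `^ (2 * gamma + d%:R))%:E =
    (\int[lebesgue_rV d]_x (negative_part v x `^ (2 * gamma + d%:R)))%:E)%E.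
  rewrite /Rintegral fineK//; apply: integrable_fin_num => //.
  exact: (rint_negative_part d1 g0 Lv).
rewrite IE -EFinM => -[E [nu [Hspec]]].
case: eqVneq => [g00|gn0] => [->|[e [[oe _] ->]]].
  apply: ge_ereal_sup => _ [N [f [of_ fE]] <-]; rewrite lee_fin.
  apply: (count_negative d1 g0 Lv beta0 LA Hspec g00 of_) => j.
  by apply: (in_range_fixed Hspec) => //; exact: of_.1.
have gp : 0 < gamma by rewrite lt_def gn0.
(* The trace is the limit of its partial sums, and [spectral_trace] bounds these uniformly in their
   length. *)
apply: lime_le.
  by apply: is_cvg_nneseries => j _ _; apply: integral_ge0 => l _; rewrite lee_fin powR_ge0.
apply: nearW => J; exact: (spectral_trace d1 g0 Lv beta0 LA Hspec).
Qed.
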